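(* Let $(M,Z)$ be an $n$-dimensional $b$-manifold with critical hypersurface $Z$ and let $\rho:G\times M\to M$ be an action of a Lie group $G$ that preserves $Z$ (each $\rho_g$ maps $Z$ to $Z$). Then the canonical $b$-cotangent lift, i.e. the lifted action $\hat\rho$ of $G$ on ${}^bT^*M$ endowed with the canonical $b$-symplectic form $\omega=-d\lambda$, is Hamiltonian with equivariant moment map $\mu:{}^bT^*M\to\mathfrak{g}^*$ given by $$\langle\mu(p),X\rangle:=\langle\lambda_p,X^\#|_p\rangle=\langle p,X^\#|_{\pi(p)}\rangle,\qquad p\in{}^bT^*M,\ X\in\mathfrak{g},$$ where $\pi:{}^bT^*M\to M$ is the projection, $X^\#$ denotes the fundamental vector field of $X$ under the action on ${}^bT^*M$ (respectively, in the last expression, on $M$), and the function $\langle\lambda,X^\#\rangle$ is smooth because $X^\#$ is a $b$-vector field.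
   Context: A $b$-manifold $(M,Z)$ is an oriented manifold $M$ with an oriented hypersurface $Z$. $b$-vector fields are vector fields tangent to $Z$; they are the sections of a vector bundle ${}^bTM$, the $b$-tangent bundle, whose dual is the $b$-cotangent bundle ${}^bT^*M$. If $x_1,\dots,x_n$ are local coordinates with $Z=\{x_1=0\}$, then $x_1\frac{\partial}{\partial x_1},\frac{\partial}{\partial x_2},\dots,\frac{\partial}{\partial x_n}$ is a local frame of ${}^bTM$ with dual frame $\frac{dx_1}{x_1},dx_2,\dots,dx_n$. $b$-forms are sections of $\Lambda^k({}^bT^*M)$; each can be written $\alpha\wedge\frac{df}{f}+\beta$ with $f$ a defining function of $Z$ and $\alpha,\beta$ smooth forms, and $d(\alpha\wedge\frac{df}{f}+\beta)=d\alpha\wedge\frac{df}{f}+d\beta$. A $b$-symplectic form is a closed $b$-form of degree 2 of maximal rank at every point. ${}^bT^*M$ is regarded as a $b$-manifold with hypersurface $\pi^{-1}(Z)$. The canonical $b$-one-form $\lambda$ on ${}^bT^*M$ is $\langle\lambda_p,v\rangle=\langle p,(\pi_p)_*(v)\rangle$ for $p\in{}^bT^*M$ and $v\in{}^bT_p({}^bT^*M)$; locally $\lambda=p_1\frac{dx_1}{x_1}+\sum_{i=2}^n p_i\,dx_i$, where $(x,p)$ represents the $b$-covector $p_1\frac{dx_1}{x_1}+\sum_{i\ge2}p_i\,dx_i$. The canonical $b$-symplectic form is $\omega=-d\lambda$. Lifted action: since each $\rho_g$ preserves $Z$, its differential induces maps on ${}^bTM$ and, dually, $\hat\rho_g(p):=(\rho_{g^{-1}})^*(p)$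 on ${}^bT^*M$, covering $\rho_g$. Hamiltonian with moment map $\mu$ means: $\iota_{X^\#}\omega=d\langle\mu,X\rangle$ for all $X\in\mathfrak{g}$. Equivariant means $\mu\circ\hat\rho_g=\mathrm{Ad}^*_{g^{-1}}\circ\mu$ for all $g\in G$, where $\langle\mathrm{Ad}^*_{g^{-1}}\xi,X\rangle=\langle\xi,\mathrm{Ad}_{g^{-1}}X\rangle$. *)

(* Defs.v *)
From HB Require Import structures.
From mathcomp Require Import all_boot all_order all_algebra.
From mathcomp Require Import all_classical all_reals all_analysis.
Import numFieldNormedType.Exports.
Set Implicit Arguments.
Unset Strict Implicit.
Unset Printing Implicit Defensive.
Import Order.TTheory GRing.Theory Num.Theory.
Local Open Scope classical_set_scope.
Local Open Scope ring_scope.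

(* Vectors and covectors are row vectors. A linear map with matrix A sends the
   vector v to v *m A, hence pulls the covector xi back to xi *m A^T. *)
Definition pairing (R : realType) m (xi v : 'rV[R]_m) : R := (xi *m v^T) 0 0.

(** * Smooth maps between open subsets of Euclidean spaces *)

Fixpoint Ck_on (R : realType) (k m p : nat) (U : set 'rV[R]_m)
    (f : 'rV[R]_m -> 'rV[R]_p) : Prop :=
  match k with
  | 0%N => forall y, U y -> {for y, continuous f}
  | k'.+1 => (forall y, U y -> differentiable f y) /\
             forall i : 'I_m, Ck_on k' U (fun y => 'D_(delta_mx 0 i) f y)
  end.

Definition smooth_on (R : realType) m p (U : set 'rV[R]_m)
    (f : 'rV[R]_m -> 'rV[R]_p) : Prop := forall k, Ck_on k U f.

(** * Charts and manifolds *)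

(* [coord] is meaningful on [dom] only, [param] (the inverse parametrization) on
   [img] only. *)
Record chart (R : realType) (T : Type) (m : nat) := Chart {
  dom : set T;
  coord : T -> 'rV[R]_m;
  param : 'rV[R]_m -> T
}.

Definition img R T m (c : chart R T m) : set 'rV[R]_m := coord c @` dom c.

Definition homeo_chart R (T : topologicalType) m (c : chart R T m) : Prop :=
  [/\ open (dom c), open (img c),
      (forall x, dom c x -> param c (coord c x) = x),
      {within dom c, continuous (coord c)} &
      {within img c, continuous (param c)}].

Definition smooth_transition R T m (c c' : chart R T m) : Prop :=
  smooth_on (coord c @` (dom c `&` dom c')) (coord c' \o param c).

Definition covers R T m (A : set (chart R T m)) (S : set T) : Prop :=
  forall x, S x -> exists2 c, A c & dom c x.

Record is_manifold (R : realType) (T : topologicalType) (m : nat)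
    (A : set (chart R T m)) : Prop := IsManifold {
  mf_hausdorff : hausdorff_space T;
  mf_second_countable : @second_countable T;
  mf_homeo : forall c, A c -> homeo_chart c;
  mf_covers : covers A setT;
  mf_compat : forall c c', A c -> A c' -> smooth_transition c c'
}.

Record smooth_manifold (R : realType) (m : nat) := SmoothManifold {
  mf_space :> topologicalType;
  atlas : set (chart R mf_space m);
  atlas_manifold : is_manifold atlas
}.

Definition maximal_atlas R m (M : smooth_manifold R m) : set (chart R M m) :=
  [set c | homeo_chart c /\
    forall c', atlas c' -> smooth_transition c c' /\ smooth_transition c' c].

(* Smoothness of a map read in charts. The preimage of each target chart domain
   is required to be open in each source chart: this is continuity. *)
Definition smooth_map (R : realType) (T T' : Type) (m m' : nat)
    (A : set (chart R T m)) (A' : set (chart R T' m')) (f : T -> T') : Prop :=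
  forall c c', A c -> A' c' ->
    open [set y | img c y /\ dom c' (f (param c y))] /\
    smooth_on [set y | img c y /\ dom c' (f (param c y))]
      (coord c' \o f \o param c).

Definition chart_prod (R : realType) (T T' : Type) (m m' : nat)
    (c : chart R T m) (c' : chart R T' m') : chart R (T * T') (m + m') :=
  Chart [set p | dom c p.1 /\ dom c' p.2]
    (fun p => row_mx (coord c p.1) (coord c' p.2))
    (fun z => (param c (lsubmx z), param c' (rsubmx z))).

Definition atlas_prod R T T' m m' (A : set (chart R T m))
    (A' : set (chart R T' m')) : set (chart R (T * T') (m + m')) :=
  [set chart_prod c.1 c.2 | c in A `*` A'].

(** * Lie groups, smooth actions, the adjoint action *)

#[short(type="topGroupType")]
HB.structure Definition TopGroup := {G of Group G & Topological G}.

Record lie_group (R : realType) (k : nat) := LieGroup {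
  lg_group :> topGroupType;
  lg_atlas : set (chart R lg_group k);
  lg_manifold : is_manifold lg_atlas;
  lg_mul : smooth_map (atlas_prod lg_atlas lg_atlas) lg_atlas
             (fun gh => (gh.1 * gh.2)%g);
  lg_inv : smooth_map lg_atlas lg_atlas (fun g => g^-1%g)
}.

Definition smooth_action R k (G : lie_group R k) (T : Type) m
    (A : set (chart R T m)) (act : G -> T -> T) : Prop :=
  [/\ forall x, act 1%g x = x,
      forall g h x, act (g * h)%g x = act g (act h x) &
      smooth_map (atlas_prod (@lg_atlas R k G) A) A (fun gx => act gx.1 gx.2)].

(* A chart e of G around 1 identifies the Lie algebra T_1 G with 'rV_k through
   the frame of e at 1, and its dual with 'rV_k through [pairing]. *)
Definition Ad R k (G : lie_group R k) (e : chart R G k) (g : G) : 'M[R]_k :=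
  jacobian (coord e \o (fun h => (g * h * g^-1)%g) \o param e) (coord e 1%g).

(* coAd e g = Ad^*_g, that is <Ad^*_g xi, X> = <xi, Ad_g X>. *)
Definition coAd R k (G : lie_group R k) (e : chart R G k) (g : G)
  (xi : 'rV[R]_k) : 'rV[R]_k := xi *m (Ad e g)^T.

(** * b-manifolds *)

(* The coordinate called x_1 in the literature has index 0 here. *)
Definition b_chart R n (M : smooth_manifold R n.+1) (Z : set M) :
    set (chart R M n.+1) :=
  [set c | maximal_atlas c /\ forall x, dom c x -> (Z x <-> coord c x 0 0 = 0)].

Definition hypersurface R n (M : smooth_manifold R n.+1) (Z : set M) : Prop :=
  closed Z /\ covers (b_chart Z) Z.

Definition orientation R n (M : smooth_manifold R n)
    (O : set (chart R M n)) : Prop :=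
  [/\ O `<=` @maximal_atlas R n M, covers O setT &
      forall c c' x, O c -> O c' -> dom c x -> dom c' x ->
        0 < \det (jacobian (coord c' \o param c) (coord c x))].

(* b-charts restrict to charts (x_2, ..., x_n) of Z; along Z the Jacobian matrix
   of the change of these coordinates is the minor below. *)
Definition hypersurface_orientation R n (M : smooth_manifold R n.+1) (Z : set M)
    (O : set (chart R M n.+1)) : Prop :=
  [/\ O `<=` b_chart Z, covers O Z &
      forall c c' x, O c -> O c' -> dom c x -> dom c' x -> Z x ->
        0 < \det (row' 0 (col' 0
                    (jacobian (coord c' \o param c) (coord c x))))].

(* A b-manifold of dimension n.+1: a manifold containing a hypersurface has
   positive dimension. *)
Record b_manifold (R : realType) (n : nat) := BManifold {
  bm_manifold :> smooth_manifold R n.+1;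
  bm_hyp : set bm_manifold;
  bm_hypersurface : hypersurface bm_hyp;
  bm_orient : set (chart R bm_manifold n.+1);
  bm_orientation : orientation bm_orient;
  bm_hyp_orient : set (chart R bm_manifold n.+1);
  bm_hyp_orientation : hypersurface_orientation bm_hyp bm_hyp_orient
}.

(** * b-geometry in b-charts *)

(* The structure through which b-tangent and b-cotangent vectors, b-forms and d
   are defined, on M as well as on its b-cotangent bundle: an atlas of b-charts
   (charts in which the hypersurface is {y | y 0 0 = 0}) and a preferred b-chart
   around each point. The fibre at x of the b-tangent (b-cotangent) bundle is
   'rV_(bdim.+1), by components in the b-frame x_1 d/dx_1, d/dx_2, ... (in the
   dual frame dx_1/x_1, dx_2, ...) of the preferred b-chart at x; likewise, the
   tangent space at x is 'rV_(bdim.+1), by components in d/dx_1, d/dx_2, ... *)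
Record b_space (R : realType) := BSpace {
  bs_point :> Type;
  bdim : nat;
  bcharts : set (chart R bs_point bdim.+1);
  bchart_at : bs_point -> chart R bs_point bdim.+1
}.

(* The second branch is never taken, as b-charts cover a b-manifold. *)
Definition b_chart_around R n (M : b_manifold R n) (x : M) : chart R M n.+1 :=
  match pselect (exists c, b_chart (@bm_hyp R n M) c /\ dom c x) with
  | left h => sval (cid h)
  | right _ => Chart set0 (fun=> 0) (fun=> x)
  end.

Definition b_space_of R n (M : b_manifold R n) : b_space R :=
  BSpace (b_chart (@bm_hyp R n M)) (@b_chart_around R n M).

Section Local.
Context {R : realType}.

(* The i-th vector of the b-frame, acting on functions. *)
Definition b_partial m (i : 'I_m.+1) (f : 'rV[R]_m.+1 -> R)
    (y : 'rV[R]_m.+1) : R :=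
  (if i == 0 then y 0 0 else 1) * 'D_(delta_mx 0 i) f y.

(* Value at y of the continuous extension across {z | z 0 0 = 0}. *)
Definition b_extend m (f : 'rV[R]_m.+1 -> R) (y : 'rV[R]_m.+1) : R :=
  lim (f z @[z --> within [set z : 'rV[R]_m.+1 | z 0 0 != 0] (nbhs y)]).

(* Matrix of the map of b-tangent spaces induced by F, in the b-frames of the
   source and of the target. The components of the image of e_i are e_i(F_j) for
   j <> 0 and (dx_1/x_1)(F_* e_i) = e_i(F_0) / F_0, smoothly extended to the
   hypersurface. *)
Definition b_jacobian m p (F : 'rV[R]_m.+1 -> 'rV[R]_p.+1) (y : 'rV[R]_m.+1) :
    'M[R]_(m.+1, p.+1) :=
  \matrix_(i, j)
    if j == 0 then b_extend (fun z => b_partial i (fun w => F w 0 0) z / F z 0 0) y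
    else b_partial i (fun w => F w 0 j) y.

End Local.

Section BSpace.
Context {R : realType}.
Implicit Types S : b_space R.

Definition bcoord S (x : S) : 'rV[R]_(bdim S).+1 := coord (bchart_at x) x.

(* T^b f at x, for f : S -> S' mapping the hypersurface to the hypersurface and
   its complement to the complement. *)
Definition b_diff S S' (f : S -> S') (x : S) :
    'M[R]_((bdim S).+1, (bdim S').+1) :=
  b_jacobian (coord (bchart_at (f x)) \o f \o param (bchart_at x)) (bcoord x).

(* Components, in the dual b-frame of the b-chart c, of a b-covector at x. *)
Definition covector_in S (c : chart R S (bdim S).+1) (x : S)
    (xi : 'rV[R]_(bdim S).+1) : 'rV[R]_(bdim S).+1 :=
  xi *m (b_jacobian (coord (bchart_at x) \o param c) (coord c x))^T.

(** ** Vector fields *)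

Definition vector_field S := S -> 'rV[R]_(bdim S).+1.

Definition vf_in S (V : vector_field S) (c : chart R S (bdim S).+1)
    (y : 'rV[R]_(bdim S).+1) : 'rV[R]_(bdim S).+1 :=
  let x := param c y in
  V x *m jacobian (coord c \o param (bchart_at x)) (bcoord x).

Definition b_vector_field S (V : vector_field S) : Prop :=
  forall c, bcharts c ->
    smooth_on (img c) (vf_in V c) /\
    forall y, img c y -> y 0 0 = 0 -> vf_in V c y 0 0 = 0.

(* The section of the b-tangent bundle given by a vector field tangent to the
   hypersurface: V_1 d/dx_1 = (V_1 / x_1) (x_1 d/dx_1). *)
Definition b_section S (V : vector_field S) : S -> 'rV[R]_(bdim S).+1 :=
  fun x => \row_i
    if i == 0 then b_extend (fun y => vf_in V (bchart_at x) y 0 0 / y 0 0) (bcoord x)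
    else V x 0 i.

(** ** b-forms: 1-forms are fields of b-covectors; a 2-form w is given by the
    matrices (w(e_i, e_j))_(i, j) in the preferred b-frames *)

Definition b_d0 S (f : S -> R) : S -> 'rV[R]_(bdim S).+1 :=
  fun x => \row_i b_partial i (f \o param (bchart_at x)) (bcoord x).

Definition b_form1_in S (a : S -> 'rV[R]_(bdim S).+1)
    (c : chart R S (bdim S).+1) (y : 'rV[R]_(bdim S).+1) :=
  covector_in c (param c y) (a (param c y)).

(* The coframe dx_1/x_1, dx_2, ... being closed, d(\sum_j a_j e^j) is
   \sum_j d a_j /\ e^j = \sum_(i, j) e_i(a_j) e^i /\ e^j. *)
Definition b_d1 S (a : S -> 'rV[R]_(bdim S).+1) :
    S -> 'M[R]_((bdim S).+1) :=
  fun x => \matrix_(i, j)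
    (b_partial i (fun y => b_form1_in a (bchart_at x) y 0 j) (bcoord x) -
     b_partial j (fun y => b_form1_in a (bchart_at x) y 0 i) (bcoord x)).

Definition contract m (v : 'rV[R]_m) (w : 'M[R]_m) : 'rV[R]_m := v *m w.

(** ** The b-cotangent bundle *)

(* The b-chart (x, p) of the b-cotangent bundle over the b-chart c = (x): it
   sends the b-covector p_1 dx_1/x_1 + \sum_(i > 1) p_i dx_i at x to (x, p). *)
Definition cotangent_chart S (c : chart R S (bdim S).+1) :
    chart R (S * 'rV[R]_(bdim S).+1) (bdim S + (bdim S).+1).+1 :=
  Chart [set p | dom c p.1]
    (fun p => row_mx (coord c p.1) (covector_in c p.1 p.2))
    (fun z : 'rV[R]_((bdim S).+1 + (bdim S).+1) =>
       let x := param c (lsubmx z) in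
       (x, rsubmx z *m
             (b_jacobian (coord c \o param (bchart_at x)) (bcoord x))^T)).

(* In cotangent_chart c, the preimage under the projection of the hypersurface
   of S is again the zero set of the coordinate of index 0. *)
Definition b_cotangent S : b_space R :=
  BSpace [set cotangent_chart c | c in @bcharts R S]
    (fun p : S * 'rV[R]_(bdim S).+1 => cotangent_chart (bchart_at p.1)).

Definition b_proj S (p : b_cotangent S) : S := p.1.

Definition b_covector S (p : b_cotangent S) : 'rV[R]_(bdim S).+1 := p.2.

Definition canonical_form1 S : b_cotangent S -> 'rV[R]_(bdim (b_cotangent S)).+1 :=
  fun p => b_covector p *m (b_diff (@b_proj S) p)^T.

Definition canonical_form2 S : b_cotangent S -> 'M[R]_((bdim (b_cotangent S)).+1) :=
  fun p => - b_d1 (@canonical_form1 S) p.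

End BSpace.

(** * Actions on b-spaces, lifted actions and moment maps *)

Section Actions.
Context {R : realType} {k : nat} {G : lie_group R k}.
Implicit Types S : b_space R.

(* X^# at x is the image of X under the differential at 1 of g |-> act g x, i.e.
   the velocity at t = 0 of act (exp (t X)) x. *)
Definition fundamental_field S (e : chart R G k) (act : G -> S -> S)
    (X : 'rV[R]_k) : vector_field S :=
  fun x => X *m jacobian
    (coord (bchart_at x) \o (fun g => act g x) \o param e) (coord e 1%g).

Definition cotangent_lift S (act : G -> S -> S) (g : G) (p : b_cotangent S) :
    b_cotangent S :=
  (act g (b_proj p),
   b_covector p *m (b_diff (act g^-1%g) (act g (b_proj p)))^T).

Definition hamiltonian_with S (e : chart R G k) (act : G -> S -> S)
    (omega : S -> 'M[R]_((bdim S).+1)) (mu : S -> 'rV[R]_k) : Prop :=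
  forall X : 'rV[R]_k,
    b_vector_field (fundamental_field e act X) /\
    forall p, contract (b_section (fundamental_field e act X) p) (omega p) =
              b_d0 (fun q => pairing (mu q) X) p.

Definition equivariant S (e : chart R G k) (act : G -> S -> S)
    (mu : S -> 'rV[R]_k) : Prop :=
  forall (g : G) p, mu (act g p) = coAd e g^-1%g (mu p).

End Actions.

(* Main.v *)
Require Import Defs.
From mathcomp Require Import all_boot all_order all_algebra.
From mathcomp Require Import all_classical all_reals all_analysis.
From mathcomp Require Import ring lra zify.
Import numFieldNormedType.Exports.
Set Implicit Arguments.
Unset Strict Implicit.
Unset Printing Implicit Defensive.
Import Order.TTheory GRing.Theory Num.Theory.
Local Open Scope classical_set_scope.
Local Open Scope ring_scope.

(* A map F preserving the hypersurface has F_1 = x_1 u with u smooth (Hadamard's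
   lemma) and u nowhere 0, so that its b-Jacobian consists of derivatives of
   log u and of F_2, F_3, ...; it is smooth and obeys the chain rule.  This
   applies to the action in charts as a map of (x, s), s being the coordinates
   of the group element: the x-rows A of its b-Jacobian act on b-covectors and,
   at the unit, the s-rows are the b-components of the fundamental fields.  The
   chain rule yields the smoothness of the lifted action (p is sent to
   p (A^-1)^T) and the equivariance of the moment map p |-> p V^T, V denoting
   the s-rows.  The lifted fundamental field has base component X V and fibre
   component - p d(X V), since the s-derivative of A is the x-derivative of V by
   the symmetry of second derivatives; this is the Hamiltonian vector field of
   <p, X V>. *)

(** * Germs of smooth functions *)

(** The fibres are encoded through a preferred b-chart at each point, chosen with no continuity
    whatsoever. Hence every object (covectors, velocities, the canonical form, the lift) must be
    rewritten in one fixed b-chart before it can be differentiated, and the cocycle relation between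
    chart changes is what removes the preferred charts. The b-cotangent bundle is only a [b_space],
    on a bare type. The proof therefore isolates two properties, [compatible_b_charts] and
    [b_action], shows that they pass from [S] to [b_cotangent S] and from an action to its lift, and
    applies the results on fundamental fields twice, downstairs and upstairs. Hadamard's lemma is
    proved without integrals: the quotient by x_1 is an average whose partial derivatives are
    averages of the same kind, so an induction on the order of differentiability closes up. That u
    is nowhere 0 comes from an inverse map. The action as a map of (x, s) has none; there u is
    compared, at fixed s, with the factor of a single diffeomorphism. *)

Section Differentiability.
Context {R : realType} {V : normedModType R}.
Implicit Types f g : V -> R.

(** Yields differentiability together with the differential from a bare estimate. It serves
    functions defined by cases, such as the averages in Hadamard's lemma, which no calculus rule
    reaches on the hyperplane. *)
Lemma differentiable_eps f (L : {linear V -> R}) x : continuous L ->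
  (forall e, 0 < e ->
     \forall z \near x, `|f z - f x - L (z - x)| <= e * `|z - x|) ->
  differentiable f x /\ 'd f x = L :> (V -> R).
Proof.
move=> Lc fL.
have fE : f \o shift x = cst (f x) + L +o_ 0 id.
  apply/eqaddoP => _/posnumP[e] /=.
  have := fL e%:num [gt0 of e%:num].
  rewrite (near_shift 0)/= subr0; apply: filterS => z /=.
  by rewrite addrK /cst /= opprD addrA.
have dfE := diff_unique Lc fE.
by split=> //; apply/diff_locallyP; rewrite dfE.
Qed.

Lemma differentiable_epsP f x : differentiable f x ->
  forall e, 0 < e ->
     \forall z \near x, `|f z - f x - 'd f x (z - x)| <= e * `|z - x|.
Proof.
move=> /diff_locally /eqaddoP fE _/posnumP[e].
have := fE e%:num [gt0 of e%:num].
rewrite [X in _ -> X](near_shift 0)/= subr0; apply: filterS => z /=.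
by rewrite addrK /cst /= opprD addrA.
Qed.

Lemma near_eq_differentiable f g x :
  (\near x, f x = g x) -> differentiable f x -> differentiable g x.
Proof.
move=> fg df; apply: (proj1 (differentiable_eps (diff_continuous df) _)).
move=> e e0; have := differentiable_epsP df e0.
apply: filterS2 (fg) => z fz.
by rewrite -(nbhs_singleton fg) -fz.
Qed.

End Differentiability.

Section PartialDerivatives.
Context {R : realType}.

Definition partial m (i : 'I_m) (f : 'rV[R]_m -> R) (y : 'rV[R]_m) : R :=
  'D_(delta_mx 0 i) f y.

Lemma differentiable_rV m p (F : 'rV[R]_m -> 'rV[R]_p) y :
  (forall j, differentiable (fun z => F z 0 j) y) -> differentiable F y.
Proof.
move=> dF.
have -> : F = \sum_(j < p) (fun z => F z 0 j *: delta_mx 0 j).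
  by apply/funext => z; rewrite fct_sumE [LHS]row_sum_delta.
apply: differentiable_sum => j; exact: (@differentiableZl _ _ _ (fun z => F z 0 j)) (dF j).
Qed.

Lemma differentiable_comp_coord m p (F : 'rV[R]_m -> 'rV[R]_p) y j :
  differentiable F y -> differentiable (fun z => F z 0 j) y.
Proof.
move=> dF; have := differentiable_comp dF (differentiable_coord (F y) 0 j).
exact.
Qed.

Lemma continuous_rV m p (F : 'rV[R]_m -> 'rV[R]_p) y :
  (forall j, {for y, continuous (fun z => F z 0 j)}) -> {for y, continuous F}.
Proof.
move=> cF.
have -> : F = (fun z => \sum_(j < p) F z 0 j *: delta_mx 0 j).
  by apply/funext => z; rewrite [LHS]row_sum_delta.
rewrite /prop_for /continuous_at.
refine (@cvg_big 'rV[R]_p 'I_p +%R 0 xpredT (@add_continuous _) _ (nbhs y) _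
  (fun j z => F z 0 j *: delta_mx 0 j) (fun j => F y 0 j *: delta_mx 0 j) _ _).
move=> j _.
by apply: cvgZr_tmp; exact: cF.
Qed.

Lemma continuous_comp_coord m p (F : 'rV[R]_m -> 'rV[R]_p) y j :
  {for y, continuous F} -> {for y, continuous (fun z => F z 0 j)}.
Proof.
by move=> cF; have := continuous_comp cF (@coord_continuous _ _ _ 0 j (F y)).
Qed.

Lemma derive_rV m p (F : 'rV[R]_m -> 'rV[R]_p) y v j :
  differentiable F y -> ('D_v F y) 0 j = 'D_v (fun z => F z 0 j) y.
Proof. by move=> /diff_derivable dF; rewrite derive_mx// mxE. Qed.

Lemma derive_partial m (f : 'rV[R]_m -> R) y v : differentiable f y ->
  'D_v f y = \sum_j v 0 j * partial j f y.
Proof.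
move=> df; rewrite deriveE// [in LHS](row_sum_delta v) linear_sum.
by apply: eq_bigr => j _; rewrite linearZ /partial deriveE.
Qed.

Lemma derive_chain m p (F : 'rV[R]_m -> 'rV[R]_p) (h : 'rV[R]_p -> R) y v :
  differentiable F y -> differentiable h (F y) ->
  'D_v (h \o F) y = \sum_j partial j h (F y) * 'D_v (fun z => F z 0 j) y.
Proof.
move=> dF dh; rewrite (deriveE v (differentiable_comp dF dh)) diff_comp//=.
rewrite -(deriveE v dF) -(deriveE _ dh) derive_partial//.
by apply: eq_bigr => j _; rewrite mulrC derive_rV.
Qed.

Lemma near_eq_partial m (i : 'I_m) (f g : 'rV[R]_m -> R) y :
  (\near y, f y = g y) -> partial i f y = partial i g y.
Proof. exact: near_eq_derive. Qed.

Lemma partialD m (i : 'I_m) (f g : 'rV[R]_m -> R) y : differentiable f y -> differentiable g y ->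
  partial i (fun z => f z + g z) y = partial i f y + partial i g y.
Proof. by move=> df dg; rewrite /partial deriveD//; exact: diff_derivable. Qed.

Lemma partialM m (i : 'I_m) (f g : 'rV[R]_m -> R) y : differentiable f y -> differentiable g y ->
  partial i (fun z => f z * g z) y = partial i f y * g y + f y * partial i g y.
Proof.
move=> df dg; rewrite /partial deriveM; [|exact: diff_derivable..].
by rewrite addrC; congr (_ + _); rewrite mulrC.
Qed.

Lemma partialV m (i : 'I_m) (f : 'rV[R]_m -> R) y : differentiable f y -> f y != 0 ->
  partial i (fun z => (f z)^-1) y = - partial i f y * (f y)^-1 * (f y)^-1.
Proof.
move=> df f0; rewrite /partial deriveV//; last exact: diff_derivable.
by rewrite /GRing.scale/= expr2 invfM; ring.
Qed.

Lemma partial_cst m (i : 'I_m) (c : R) y : partial i (fun=> c) y = 0.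
Proof. exact: derive_cst. Qed.

Lemma partial_coord m (i j : 'I_m) y :
  partial i (fun z : 'rV[R]_m => z 0 j) y = (i == j)%:R.
Proof.
rewrite /partial -(@derive_rV _ _ id)//.
by rewrite derive_id mxE eqxx eq_sym.
Qed.

End PartialDerivatives.

(** * Germs of functions of class C^k *)

Section CkGerms.
Context {R : realType}.

(** Each clause is required near [y], so that an identity between derivatives, valid on a
    neighbourhood, may be differentiated again. *)
Fixpoint Ck_at k m (f : 'rV[R]_m -> R) (y : 'rV[R]_m) : Prop :=
  match k with
  | 0%N => \forall z \near y, {for z, continuous f}
  | k'.+1 => (\forall z \near y, differentiable f z) /\
             forall i, Ck_at k' (partial i f) y
  end.

Lemma Ck_near_eq k m (f g : 'rV[R]_m -> R) y :
  (\near y, f y = g y) -> Ck_at k f y -> Ck_at k g y.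
Proof.
elim: k f g => [|k IHk] f g fg /=.
  have fg' := near_join fg.
  apply: filterS2 fg' => z fgz cf.
  rewrite /prop_for /continuous_at -(nbhs_singleton fgz).
  by apply: cvg_trans cf; exact: (near_eq_cvg fgz).
move=> [df pf]; split.
  by apply: filterS2 (near_join fg) df => z fgz; exact: near_eq_differentiable.
move=> i; apply: IHk (pf i).
by apply: filterS (near_join fg) => z; exact: near_eq_partial.
Qed.

Lemma CkS k m (f : 'rV[R]_m -> R) y : Ck_at k.+1 f y -> Ck_at k f y.
Proof.
elim: k f => [|k IHk] f [df pf] /=.
  by apply: filterS df => z; exact: differentiable_continuous.
by split=> // i; exact: IHk.
Qed.

Lemma Ck_cst k m (c : R) (y : 'rV[R]_m) : Ck_at k (fun=> c) y.
Proof.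
elim: k c => [|k IHk] c /=; first by apply: filterE => z; exact: cst_continuous.
split; first by apply: filterE => z; exact: differentiable_cst.
by move=> i; apply: Ck_near_eq (IHk 0); apply: filterE => z; rewrite partial_cst.
Qed.

Lemma Ck_coord k m (j : 'I_m) (y : 'rV[R]_m) : Ck_at k (fun z => z 0 j) y.
Proof.
case: k => [|k] /=; first by apply: filterE => z; exact: coord_continuous.
split; first by apply: filterE => z; exact: differentiable_coord.
move=> i; apply: Ck_near_eq (Ck_cst _ (i == j)%:R _).
by apply: filterE => z; rewrite partial_coord.
Qed.

Lemma CkD k m (f g : 'rV[R]_m -> R) y :
  Ck_at k f y -> Ck_at k g y -> Ck_at k (fun z => f z + g z) y.
Proof.
elim: k f g => [|k IHk] f g /=.
  by apply: filterS2 => z; exact: continuousD.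
move=> [df pf] [dg pg]; split.
  by apply: filterS2 df dg => z; exact: differentiableD.
move=> i; apply: Ck_near_eq (IHk _ _ (pf i) (pg i)).
by apply: filterS2 df dg => z dfz dgz; rewrite partialD.
Qed.

Lemma CkM k m (f g : 'rV[R]_m -> R) y :
  Ck_at k f y -> Ck_at k g y -> Ck_at k (fun z => f z * g z) y.
Proof.
elim: k f g => [|k IHk] f g.
  by apply: filterS2 => z; exact: continuousM.
move=> Cf Cg; have [df pf] := Cf; have [dg pg] := Cg; split.
  by apply: filterS2 df dg => z; exact: differentiableM.
move=> i; apply: Ck_near_eq (CkD (IHk _ _ (pf i) (CkS Cg))
  (IHk _ _ (CkS Cf) (pg i))).
by apply: filterS2 df dg => z dfz dgz; rewrite partialM.
Qed.

Lemma CkV k m (f : 'rV[R]_m -> R) y :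
  Ck_at k f y -> f y != 0 -> Ck_at k (fun z => (f z)^-1) y.
Proof.
move=> Cf fy0; have near_f0 : \forall z \near y, f z != 0.
  have : {for y, continuous f}.
    by elim: k Cf => [/nbhs_singleton//|k IHk /CkS].
  move=> /(_ [set r | r != 0]); apply.
  exact: (open_nbhs_nbhs (conj (@open_neq R 0) fy0)).
elim: k Cf => [|k IHk] Cf.
  by apply: filterS2 near_f0 Cf => z fz cf; exact: continuousV.
have [df pf] := Cf; split.
  by apply: filterS2 near_f0 df => z fz dfz; exact: differentiableV.
move=> i; apply: Ck_near_eq (CkM (CkM (CkM (Ck_cst _ (-1) _) (pf i))
  (IHk (CkS Cf))) (IHk (CkS Cf))).
by apply: filterS2 near_f0 df => z fz dfz; rewrite partialV// mulN1r.
Qed.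

Lemma Ck_sum k m (I : Type) (r : seq I) (P : pred I)
    (f : I -> 'rV[R]_m -> R) y :
  (forall i, P i -> Ck_at k (f i) y) ->
  Ck_at k (fun z => \sum_(i <- r | P i) f i z) y.
Proof.
move=> Cf; elim: r => [|i r IHr].
  by apply: Ck_near_eq (Ck_cst k 0 y); apply: filterE => z; rewrite big_nil.
case: (boolP (P i)) => Pi; last first.
  by apply: Ck_near_eq IHr; apply: filterE => z; rewrite big_cons (negbTE Pi).
apply: Ck_near_eq (CkD (Cf i Pi) IHr).
by apply: filterE => z; rewrite big_cons Pi.
Qed.

Lemma Ck_continuous k m (f : 'rV[R]_m -> R) y : Ck_at k f y ->
  \forall z \near y, {for z, continuous f}.
Proof. by elim: k => [|k IHk /CkS]. Qed.

Lemma Ck_rV_continuous k m p (F : 'rV[R]_m -> 'rV[R]_p) y :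
  (forall j, Ck_at k (fun z => F z 0 j) y) ->
  \forall z \near y, {for z, continuous F}.
Proof.
move=> CF; apply: filterS (filter_forall _ (fun j => Ck_continuous (CF j))) => z.
 exact: continuous_rV.
Qed.

Lemma Ck_rV_differentiable k m p (F : 'rV[R]_m -> 'rV[R]_p) y :
  (forall j, Ck_at k.+1 (fun z => F z 0 j) y) ->
  \forall z \near y, differentiable F z.
Proof.
move=> CF; apply: filterS (filter_forall _ (fun j => proj1 (CF j))) => z.
 exact: differentiable_rV.
Qed.

Lemma near_comp (T U : topologicalType) (f : T -> U) x (P : set U) :
  {for x, continuous f} -> (\forall u \near f x, P u) ->
  \forall z \near x, P (f z).
Proof. by move=> cf /cf. Qed.

Lemma Ck_comp k m p (F : 'rV[R]_m -> 'rV[R]_p) (h : 'rV[R]_p -> R) y :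
  (forall j, Ck_at k (fun z => F z 0 j) y) -> Ck_at k h (F y) ->
  Ck_at k (h \o F) y.
Proof.
elim: k h => [|k IHk] h CF Ch; have cF := Ck_rV_continuous CF.
  have := near_comp (nbhs_singleton cF) Ch; apply: filterS2 cF => z cFz chz.
  exact: continuous_comp.
have [dh ph] := Ch; have dF := Ck_rV_differentiable CF.
have dhF := near_comp (nbhs_singleton cF) dh.
split; first by apply: filterS2 dF dhF => z; exact: differentiable_comp.
move=> i.
have Csum : Ck_at k (fun z => \sum_j partial j h (F z) *
    partial i (fun w => F w 0 j) z) y.
  apply: Ck_sum => j _; apply: CkM; last by have [_ +] := CF j; apply.
  by apply: (IHk (partial j h)) => [l|]; [exact: CkS|exact: ph].
apply: Ck_near_eq Csum.
by apply: filterS2 dF dhF => z dFz dhz; rewrite /partial derive_chain.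
Qed.

End CkGerms.

(** * Germs of smooth functions and maps *)

Section SmoothGerms.
Context {R : realType}.

(** One neighbourhood serves all orders [k]. Were it allowed to shrink with [k], smoothness at [y]
    would not spread to nearby points. *)
Definition smooth_at m (f : 'rV[R]_m -> R) (y : 'rV[R]_m) : Prop :=
  \forall z \near y, forall k, Ck_at k f z.

Definition smooth_rV_at m p (F : 'rV[R]_m -> 'rV[R]_p) y : Prop :=
  forall j, smooth_at (fun z => F z 0 j) y.

Lemma smooth_near m (f : 'rV[R]_m -> R) y :
  smooth_at f y -> \forall z \near y, smooth_at f z.
Proof. exact: near_join. Qed.

Lemma smooth_rV_near m p (F : 'rV[R]_m -> 'rV[R]_p) y :
  smooth_rV_at F y -> \forall z \near y, smooth_rV_at F z.
Proof. by move=> sF; exact: (filter_forall _ (fun j => smooth_near (sF j))). Qed.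

Lemma smooth_near_eq m (f g : 'rV[R]_m -> R) y :
  (\near y, f y = g y) -> smooth_at f y -> smooth_at g y.
Proof.
move=> fg; apply: filterS2 (near_join fg) => z fgz Cf k.
exact: Ck_near_eq (Cf k).
Qed.

Lemma smooth_rV_near_eq m p (F H : 'rV[R]_m -> 'rV[R]_p) y :
  (\near y, F y = H y) -> smooth_rV_at F y -> smooth_rV_at H y.
Proof.
by move=> FH sF j; apply: smooth_near_eq (sF j); apply: filterS FH => z ->.
Qed.

Lemma smooth_differentiable m (f : 'rV[R]_m -> R) y :
  smooth_at f y -> differentiable f y.
Proof. by move=> /nbhs_singleton/(_ 1%N)[/nbhs_singleton]. Qed.

Lemma smooth_rV_differentiable m p (F : 'rV[R]_m -> 'rV[R]_p) y :
  smooth_rV_at F y -> differentiable F y.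
Proof.
by move=> sF; apply: differentiable_rV => j; exact: smooth_differentiable (sF j).
Qed.

Lemma smooth_continuous m (f : 'rV[R]_m -> R) y :
  smooth_at f y -> {for y, continuous f}.
Proof. by move=> /smooth_differentiable; exact: differentiable_continuous. Qed.

Lemma smooth_rV_continuous m p (F : 'rV[R]_m -> 'rV[R]_p) y :
  smooth_rV_at F y -> {for y, continuous F}.
Proof. by move=> /smooth_rV_differentiable; exact: differentiable_continuous. Qed.

Lemma smooth_partial m (f : 'rV[R]_m -> R) i y :
  smooth_at f y -> smooth_at (partial i f) y.
Proof. by apply: filterS => z Cf k; have [_] := Cf k.+1; apply. Qed.

Lemma smooth_cst m (c : R) (y : 'rV[R]_m) : smooth_at (fun=> c) y.
Proof. by apply: filterE => z k; exact: Ck_cst. Qed.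

Lemma smooth_coord m (j : 'I_m) (y : 'rV[R]_m) : smooth_at (fun z => z 0 j) y.
Proof. by apply: filterE => z k; exact: Ck_coord. Qed.

Lemma smoothD m (f g : 'rV[R]_m -> R) y :
  smooth_at f y -> smooth_at g y -> smooth_at (fun z => f z + g z) y.
Proof. by apply: filterS2 => z Cf Cg k; exact: CkD. Qed.

Lemma smoothM m (f g : 'rV[R]_m -> R) y :
  smooth_at f y -> smooth_at g y -> smooth_at (fun z => f z * g z) y.
Proof. by apply: filterS2 => z Cf Cg k; exact: CkM. Qed.

Lemma smoothN m (f : 'rV[R]_m -> R) y :
  smooth_at f y -> smooth_at (fun z => - f z) y.
Proof.
move=> sf; apply: smooth_near_eq (smoothM (smooth_cst (-1) y) sf).
by apply: filterE => z; rewrite mulN1r.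
Qed.

Lemma smoothB m (f g : 'rV[R]_m -> R) y :
  smooth_at f y -> smooth_at g y -> smooth_at (fun z => f z - g z) y.
Proof. by move=> sf sg; exact: (smoothD sf (smoothN sg)). Qed.

Lemma smooth_near_neq0 m (f : 'rV[R]_m -> R) y :
  smooth_at f y -> f y != 0 -> \forall z \near y, f z != 0.
Proof.
move=> /smooth_continuous cf fy0.
exact: (near_comp cf (open_nbhs_nbhs (conj (@open_neq R 0) fy0))).
Qed.

Lemma smoothV m (f : 'rV[R]_m -> R) y :
  smooth_at f y -> f y != 0 -> smooth_at (fun z => (f z)^-1) y.
Proof.
move=> sf /(smooth_near_neq0 sf); apply: filterS2 sf => z Cf fz k.
exact: CkV.
Qed.

Lemma smooth_sum m (I : Type) (r : seq I) (P : pred I)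
    (f : I -> 'rV[R]_m -> R) y :
  (forall i, P i -> smooth_at (f i) y) ->
  smooth_at (fun z => \sum_(i <- r | P i) f i z) y.
Proof.
move=> Cf; elim: r => [|i r IHr].
  by apply: smooth_near_eq (smooth_cst 0 y); apply: filterE => z; rewrite big_nil.
case: (boolP (P i)) => Pi; last first.
  by apply: smooth_near_eq IHr; apply: filterE => z; rewrite big_cons (negbTE Pi).
apply: smooth_near_eq (smoothD (Cf i Pi) IHr).
by apply: filterE => z; rewrite big_cons Pi.
Qed.

Lemma smooth_prod m (I : Type) (r : seq I) (P : pred I)
    (f : I -> 'rV[R]_m -> R) y :
  (forall i, P i -> smooth_at (f i) y) ->
  smooth_at (fun z => \prod_(i <- r | P i) f i z) y.
Proof.
move=> Cf; elim: r => [|i r IHr].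
  by apply: smooth_near_eq (smooth_cst 1 y); apply: filterE => z; rewrite big_nil.
case: (boolP (P i)) => Pi; last first.
  by apply: smooth_near_eq IHr; apply: filterE => z; rewrite big_cons (negbTE Pi).
apply: smooth_near_eq (smoothM (Cf i Pi) IHr).
by apply: filterE => z; rewrite big_cons Pi.
Qed.

Lemma smoothX m (f : 'rV[R]_m -> R) n y :
  smooth_at f y -> smooth_at (fun z => f z ^+ n) y.
Proof.
move=> sf; have := @smooth_prod _ _ (index_enum 'I_n) xpredT _ y (fun i _ => sf).
by apply: smooth_near_eq; apply: filterE => z; rewrite prodr_const card_ord.
Qed.

Lemma smooth_comp m p (F : 'rV[R]_m -> 'rV[R]_p) (h : 'rV[R]_p -> R) y :
  smooth_rV_at F y -> smooth_at h (F y) -> smooth_at (h \o F) y.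
Proof.
move=> sF sh; have sFn : \forall z \near y, forall j k, Ck_at k (fun z => F z 0 j) z.
  exact: (filter_forall _ sF).
have shF := near_comp (smooth_rV_continuous sF) sh.
by apply: filterS2 sFn shF => z CF Ch k; exact: Ck_comp.
Qed.

Lemma smooth_rV_comp m p q (F : 'rV[R]_m -> 'rV[R]_p) (H : 'rV[R]_p -> 'rV[R]_q) y :
  smooth_rV_at F y -> smooth_rV_at H (F y) -> smooth_rV_at (H \o F) y.
Proof. by move=> sF sH j; exact: (smooth_comp sF (sH j)). Qed.

Lemma smooth_derive m (f : 'rV[R]_m -> R) v y :
  smooth_at f y -> smooth_at (fun z => 'D_v f z) y.
Proof.
move=> sf; have : smooth_at (fun z => \sum_j v 0 j * partial j f z) y.
  by apply: smooth_sum => j _; apply: smoothM (smooth_partial _ sf); exact: smooth_cst.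
apply: smooth_near_eq; apply: filterS (smooth_near sf) => z sfz.
by rewrite derive_partial//; exact: smooth_differentiable.
Qed.

Lemma smooth_lsubmx m p (y : 'rV[R]_(m + p)) :
  smooth_rV_at (lsubmx : 'rV[R]_(m + p) -> 'rV[R]_m) y.
Proof.
move=> j; apply: smooth_near_eq (smooth_coord (lshift p j) y).
by apply: filterE => z; rewrite mxE.
Qed.

Lemma smooth_rsubmx m p (y : 'rV[R]_(m + p)) :
  smooth_rV_at (rsubmx : 'rV[R]_(m + p) -> 'rV[R]_p) y.
Proof.
move=> j; apply: smooth_near_eq (smooth_coord (rshift m j) y).
by apply: filterE => z; rewrite mxE.
Qed.

Lemma smooth_row_mx m p q (F : 'rV[R]_m -> 'rV[R]_p) (H : 'rV[R]_m -> 'rV[R]_q) y :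
  smooth_rV_at F y -> smooth_rV_at H y ->
  smooth_rV_at (fun z => row_mx (F z) (H z)) y.
Proof.
move=> sF sH j; case: (split_ordP j) => l ->.
  by apply: smooth_near_eq (sF l); apply: filterE => z; rewrite row_mxEl.
by apply: smooth_near_eq (sH l); apply: filterE => z; rewrite row_mxEr.
Qed.

Lemma smooth_rV_cst m p (c : 'rV[R]_p) (y : 'rV[R]_m) : smooth_rV_at (fun=> c) y.
Proof. by move=> j; exact: smooth_cst. Qed.

Lemma smooth_rV_id m (y : 'rV[R]_m) : smooth_rV_at id y.
Proof. by move=> j; exact: smooth_coord. Qed.

Lemma smooth_det m p (A : 'rV[R]_m -> 'M[R]_p) y :
  (forall i j, smooth_at (fun z => A z i j) y) -> smooth_at (fun z => \det (A z)) y.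
Proof.
move=> sA; rewrite /determinant.
apply: smooth_sum => s _; apply: smoothM; first exact: smooth_cst.
by apply: smooth_prod => i _; exact: sA.
Qed.

(** By Cramer's formula, with which [invmx] agrees where the determinant is nonzero, an open
    condition. *)
Lemma smooth_invmx m p (A : 'rV[R]_m -> 'M[R]_p) y i j :
  (forall i j, smooth_at (fun z => A z i j) y) -> A y \in unitmx ->
  smooth_at (fun z => invmx (A z) i j) y.
Proof.
move=> sA Au; have sdet := smooth_det sA.
have det0 : \det (A y) != 0 by rewrite -unitfE -unitmxE.
have sadj : smooth_at (fun z => (\det (A z))^-1 * (\adj (A z)) i j) y.
  apply: smoothM; first exact: smoothV.
  apply: (@smooth_near_eq _ (fun z => cofactor (A z) j i)).
    by apply: filterE => z; rewrite !mxE.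
  rewrite /cofactor; apply: smoothM; first exact: smooth_cst.
  apply: smooth_det => a b; apply: smooth_near_eq (sA (lift j a) (lift i b)).
  by apply: filterE => z; rewrite !mxE.
apply: smooth_near_eq sadj; apply: filterS (smooth_near_neq0 sdet det0) => z dz.
by rewrite /invmx unitmxE unitfE dz !mxE.
Qed.

Lemma Ck_on_at k m p (U : set 'rV[R]_m) (F : 'rV[R]_m -> 'rV[R]_p) :
  open U -> Ck_on k U F -> forall y j, U y -> Ck_at k (fun z => F z 0 j) y.
Proof.
move=> oU; elim: k F => [|k IHk] F /=.
  move=> cF y j Uy; have nU := open_nbhs_nbhs (conj oU Uy).
  by apply: filterS nU => z Uz; exact: continuous_comp_coord (cF z Uz).
move=> [dF pF] y j Uy; have nU := open_nbhs_nbhs (conj oU Uy).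
split.
  by apply: filterS nU => z Uz; exact: differentiable_comp_coord (dF z Uz).
move=> i; apply: Ck_near_eq (IHk _ (pF i) y j Uy).
by apply: filterS nU => z Uz; rewrite derive_rV//; exact: dF.
Qed.

Lemma Ck_at_on k m p (U : set 'rV[R]_m) (F : 'rV[R]_m -> 'rV[R]_p) :
  (forall y j, U y -> Ck_at k (fun z => F z 0 j) y) -> Ck_on k U F.
Proof.
elim: k F => [|k IHk] F /= CF.
  by move=> y Uy; apply: continuous_rV => j; exact: nbhs_singleton (CF y j Uy).
split=> [y Uy|i].
  by apply: differentiable_rV => j; have [/nbhs_singleton] := CF y j Uy.
apply: IHk => y j Uy; have [_ /(_ i)] := CF y j Uy.
have dF : \forall z \near y, differentiable F z.
  by apply: Ck_rV_differentiable => l; exact: CF.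
by apply: Ck_near_eq; apply: filterS dF => z dFz; rewrite derive_rV.
Qed.

(** Openness of [U] turns conditions at the points of [U] into conditions on neighbourhoods, that
    is, into germs. *)
Lemma smooth_onP m p (U : set 'rV[R]_m) (F : 'rV[R]_m -> 'rV[R]_p) :
  open U -> smooth_on U F <-> (forall y, U y -> smooth_rV_at F y).
Proof.
move=> oU; split=> [sF y Uy j|sF k].
  apply: filterS (open_nbhs_nbhs (conj oU Uy)) => z Uz k.
  exact: Ck_on_at (sF k) _ _ Uz.
by apply: Ck_at_on => y j /sF /(_ j) /nbhs_singleton.
Qed.

Lemma smooth_on_at m p (U : set 'rV[R]_m) (F : 'rV[R]_m -> 'rV[R]_p) :
  (forall y, U y -> smooth_rV_at F y) -> smooth_on U F.
Proof. by move=> sF k; apply: Ck_at_on => y j /sF /(_ j) /nbhs_singleton. Qed.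

End SmoothGerms.

(** * Symmetry of second partial derivatives *)

Section SymmetryOfSecondDerivatives.
Context {R : realType} {m : nat}.
Implicit Types (f : 'rV[R]_m -> R) (a u v : 'rV[R]_m).

Lemma is_derive_line f a u s : derivable f (a + s *: u) u ->
  is_derive s 1 (fun t : R => f (a + t *: u)) ('D_u f (a + s *: u)).
Proof.
have lineE : (fun h : R => h^-1 *: (((fun t : R => f (a + t *: u)) \o shift s) (h *: 1) -
    f (a + s *: u))) =
    (fun h => h^-1 *: ((f \o shift (a + s *: u)) (h *: u) - f (a + s *: u))).
  apply/funext => h /=; congr (_ *: (f _ - _)).
  by rewrite scalerDl [h *: 1]mulr1 addrCA.
by move=> df; split; rewrite /derivable /derive lineE.
Qed.

Lemma derive_translate f u v y :
  'D_u (fun z => f (z + v)) y = 'D_u f (y + v).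
Proof.
rewrite /derive; set F := (fun h : R => _); set H := (fun h : R => _).
suff -> : F = H by [].
by apply/funext => h; rewrite /F /H /= addrA.
Qed.

Lemma mean_value_line f a u t : 0 < t ->
  (forall s, 0 <= s <= t -> differentiable f (a + s *: u)) ->
  exists2 s, 0 <= s <= t & f (a + t *: u) - f a = t * 'D_u f (a + s *: u).
Proof.
move=> t0 df.
have dl s : 0 <= s <= t ->
    is_derive s 1 (fun t : R => f (a + t *: u)) ('D_u f (a + s *: u)).
  by move=> /df dfs; apply: is_derive_line; exact: diff_derivable.
have [||s st] := @MVT _ (fun t : R => f (a + t *: u))
    (fun s => 'D_u f (a + s *: u)) 0 t t0.
- by move=> s; rewrite in_itv/= => /andP[s0 st]; apply: dl; rewrite !ltW.
- apply: derivable_within_continuous => s; rewrite in_itv/= => s0t.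
  by have [] := dl s s0t.
rewrite scale0r addr0 subr0 mulrC => ->; exists s => //.
by move: st; rewrite in_itv/= => /andP[s0 st]; rewrite !ltW.
Qed.

(** The mean value theorem is used twice: along [u] for z |-> f(z + t v) - f(z), then along [v] for
    the derivative of [f] along [u]. As [u] and [v] have norm at most 1, the condition [2 * t < r]
    keeps the whole parallelogram in the ball. *)
Lemma second_difference f a u v t (r : R) : 0 < t -> `|u| <= 1 -> `|v| <= 1 ->
  2 * t < r ->
  (forall z, `|z - a| < r -> differentiable f z /\
     differentiable (fun z => 'D_u f z) z) ->
  exists2 p, `|p - a| < r &
    f (a + t *: u + t *: v) - f (a + t *: u) - (f (a + t *: v) - f a) =
    t * (t * 'D_v (fun z => 'D_u f z) p).
Proof.
move=> t0 u1 v1 tr df.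
have inball s s' : 0 <= s <= t -> 0 <= s' <= t -> `|a + s *: u + s' *: v - a| < r.
  move=> /andP[s0 st] /andP[s0' st']; rewrite addrC !addrA addNr add0r.
  apply: le_lt_trans tr; apply: le_trans (ler_normD _ _) _.
  rewrite !normrZ !ger0_norm// mulr2n mulrDl !mul1r.
  by apply: lerD; rewrite -[leRHS]mulr1 ler_pM.
have tt : 0 <= t <= t by rewrite lexx ltW.
have zt : (0 : R) <= 0 <= t by rewrite lexx ltW.
pose g z := f (z + t *: v) - f z.
have dshift s : 0 <= s <= t -> differentiable (fun z => f (z + t *: v)) (a + s *: u).
  move=> st; apply: (@differentiable_comp _ _ _ _ (fun z => z + t *: v) f) => //.
  by have [] := df _ (inball s t st tt).
have dfs s : 0 <= s <= t -> differentiable f (a + s *: u).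
  by move=> st; have := inball s 0 st zt; rewrite scale0r addr0 => /df[].
have [s st gE] : exists2 s, 0 <= s <= t & g (a + t *: u) - g a = t * 'D_u g (a + s *: u).
  apply: mean_value_line => // s st; apply: differentiableB; first exact: dshift.
  exact: dfs.
have dgE : 'D_u g (a + s *: u) =
    'D_u f (a + s *: u + t *: v) - 'D_u f (a + s *: u).
  rewrite deriveB; [|exact: diff_derivable (dshift _ st)|exact: diff_derivable (dfs _ st)].
  by rewrite derive_translate.
have [s' st' D2E] : exists2 s', 0 <= s' <= t &
    'D_u f (a + s *: u + t *: v) - 'D_u f (a + s *: u) =
    t * 'D_v (fun z => 'D_u f z) (a + s *: u + s' *: v).
  exact: (@mean_value_line (fun z => 'D_u f z) _ v t t0
    (fun s' st' => proj2 (df _ (inball s s' st st')))).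
exists (a + s *: u + s' *: v); first exact: inball.
by rewrite -[LHS]/(g (a + t *: u) - g a) gE dgE D2E.
Qed.

Lemma normr_delta_mx (i : 'I_m) : `|delta_mx 0 i : 'rV[R]_m| <= 1.
Proof.
rewrite /Num.Def.normr/= mx_normrE; apply: bigmax_le => // -[j l] _ /=.
by rewrite mxE; case: (_ && _); rewrite ?normr1 ?normr0.
Qed.

Lemma dist_half (x y p q e : R) :
  `|x - p| < e / 2 -> `|y - q| < e / 2 -> p = q -> `|x - y| <= e.
Proof.
move=> xp yq pq; apply: (le_trans (ler_distD p _ _)); rewrite [leRHS]splitr.
by rewrite lerD ?(ltW xp)// pq distrC ltW.
Qed.

(** The second difference is symmetric in the two directions, so the two mixed derivatives agree at
    two points close to [y]. Their continuity makes the values at [y] differ by at most any [e]. *)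
Lemma partialC f (i j : 'I_m) y : smooth_at f y ->
  partial i (partial j f) y = partial j (partial i f) y.
Proof.
move=> sf; apply/eqP; rewrite -subr_eq0 -normr_le0; apply/ler_addgt0Pr => e e0.
rewrite add0r.
pose P i j := partial i (partial j f).
have e2 : 0 < e / 2 by rewrite divr_gt0.
have cP i' j' : \forall z \near y, `|P i' j' y - P i' j' z| < e / 2.
  have := smooth_continuous (smooth_partial i' (smooth_partial j' sf)).
  by move=> /cvgrPdist_lt/(_ _ e2).
have sfn := smooth_near sf.
have : \forall z \near y, [/\ smooth_at f z, `|P i j y - P i j z| < e / 2 &
    `|P j i y - P j i z| < e / 2].
  by apply: filterS3 sfn (cP i j) (cP j i) => z.
move=> /nbhs_normP[r /= r0 rP].
have inr z : `|z - y| < r -> [/\ smooth_at f z, `|P i j y - P i j z| < e / 2 &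
    `|P j i y - P j i z| < e / 2].
  by move=> zy; apply: rP => /=; rewrite /ball_/= distrC.
(* Any positive [t] with [2 * t < r] would do. *)
pose t := r / 4.
have t0 : 0 < t by rewrite divr_gt0.
have tr : 2 * t < r by rewrite /t; lra.
have [p1 p1r E1] := @second_difference f y (delta_mx 0 j) (delta_mx 0 i) t r t0
  (normr_delta_mx j) (normr_delta_mx i) tr (fun z zr => let: And3 s _ _ := inr z zr in
  conj (smooth_differentiable s) (smooth_differentiable (smooth_partial j s))).
have [p2 p2r E2] := @second_difference f y (delta_mx 0 i) (delta_mx 0 j) t r t0
  (normr_delta_mx i) (normr_delta_mx j) tr (fun z zr => let: And3 s _ _ := inr z zr in
  conj (smooth_differentiable s) (smooth_differentiable (smooth_partial i s))).
have P12 : P i j p1 = P j i p2.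
  have tn0 : t != 0 by rewrite gt_eqF.
  apply: (mulfI tn0); apply: (mulfI tn0); rewrite -[LHS]E1 -[RHS]E2.
  rewrite addrAC [y + _ + _]addrAC; ring.
have [_ d1 _] := inr _ p1r; have [_ _ d2] := inr _ p2r.
exact: (dist_half d1 d2 P12).
Qed.

End SymmetryOfSecondDerivatives.

(** * Hadamard's lemma: smooth division by the first coordinate *)

Section Hadamard.
Context {R : realType}.

Lemma tangent_differentiable m (f g : 'rV[R]_m -> R) x :
  differentiable g x -> f x = g x ->
  (forall e, 0 < e -> \forall z \near x, `|f z - g z| <= e * `|z - x|) ->
  differentiable f x /\ forall v, 'D_v f x = 'D_v g x.
Proof.
move=> dg fgx fg.
have cL := diff_continuous dg.
have fL e : 0 < e ->
    \forall z \near x, `|f z - f x - 'd g x (z - x)| <= e * `|z - x|.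
  move=> e0; have e2 : 0 < e / 2 by rewrite divr_gt0.
  apply: filterS2 (fg _ e2) (differentiable_epsP dg e2) => z fgz gz.
  rewrite fgx; have -> : f z - g x - 'd g x (z - x) =
      (f z - g z) + (g z - g x - 'd g x (z - x)) by ring.
  apply: (le_trans (ler_normD _ _)).
  by rewrite [e in leRHS]splitr mulrDl lerD.
have [df dfE] := differentiable_eps cL fL.
by split=> [|v]; [exact: df|rewrite (deriveE v df) (deriveE v dg) dfE].
Qed.

(** Cauchy's mean value theorem for [W] against t^(j+1), obtained from Rolle's theorem for W - W(1)
    t^(j+1). It replaces the mean value theorem for integrals with weight t^j. *)
Lemma rolle_division (W H : R -> R) (c : R) j :
  (forall t : R, 0 <= t <= 1 -> is_derive t 1 W (c * ((t * c) ^+ j * H t))) ->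
  W 0 = 0 -> exists2 t, 0 <= t <= 1 & W 1 = c ^+ j.+1 * H t / j.+1%:R.
Proof.
move=> dW W0; pose phi := W - cst (W 1) * (id ^+ j.+1).
have dphi (t : R) : 0 <= t <= 1 -> is_derive t 1 phi
    (c * ((t * c) ^+ j * H t) - W 1 * (j.+1%:R * t ^+ j)).
  move=> t01; have dWt := dW t t01; apply: is_derive_eq.
  by rewrite scaler0 addr0 /cst/= /GRing.scale/= mulr1.
have [||||t t01 dphit] := @Rolle _ phi 0 1.
- exact: ltr01.
- by move=> t; rewrite in_itv/= => /andP[t0 t1]; have [] := dphi t; rewrite ?(ltW t0)?(ltW t1).
- by apply: derivable_within_continuous => t; rewrite in_itv/= => t01; have [] := dphi t t01.
- rewrite /phi !fctE /cst/= W0 expr0n/= mulr0 subr0 expr1n mulr1.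
  by rewrite subrr.
move: t01; rewrite in_itv/= => /andP[t0 t1].
have t01 : 0 <= t <= 1 by rewrite !ltW.
exists t => //; have [_ E] := dphi t t01; move: E.
rewrite (@derive_val _ _ _ _ _ _ _ dphit) => /esym/eqP; rewrite subr_eq0 => /eqP E.
(* Rolle's point lies in the open interval, so [t] is not 0. *)
have tj : t ^+ j != 0 by rewrite expf_neq0// gt_eqF.
have j0 : j.+1%:R != 0 :> R by rewrite pnatr_eq0.
apply: (mulfI (mulf_neq0 j0 tj)); rewrite mulrC -[LHS]E exprMn exprS.
by field; rewrite addrC natr1.
Qed.

Lemma partialX m (i : 'I_m) (f : 'rV[R]_m -> R) n y : differentiable f y ->
  partial i (fun z => f z ^+ n) y = n%:R * f y ^+ n.-1 * partial i f y.
Proof.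
move=> df; have -> : (fun z => f z ^+ n) = f ^+ n.
  by apply/funext => z; rewrite exprfctE.
by rewrite /partial deriveX//; exact: diff_derivable.
Qed.

Lemma norm_rV_le m (x y : 'rV[R]_m) :
  (forall i, `|x 0 i| <= `|y 0 i|) -> `|x| <= `|y|.
Proof.
move=> xy; rewrite [leLHS]/Num.Def.normr/= mx_normrE; apply: bigmax_le => // -[i j] _ /=.
rewrite ord1; apply: (le_trans (xy j)).
rewrite [leRHS]/Num.Def.normr/= mx_normrE.
exact: (le_bigmax _ (fun i : 'I_1 * 'I_m => `|y i.1 i.2|) (0, j)).
Qed.

Lemma partial_sum m p (i : 'I_m) (f : 'I_p -> 'rV[R]_m -> R) y :
  (forall j, differentiable (f j) y) ->
  partial i (fun z => \sum_j f j z) y = \sum_j partial i (f j) y.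
Proof.
move=> df; rewrite /partial -derive_sum; last by move=> j; exact: diff_derivable.
by rewrite fct_sumE.
Qed.

Lemma partial_affine m (i k : 'I_m) (c l : R) y :
  partial i (fun z : 'rV[R]_m => (z 0 k - c) * l) y = (i == k)%:R * l.
Proof.
have sk := smooth_differentiable (smooth_coord k y).
have sc (b : R) := smooth_differentiable (smooth_cst b y).
rewrite partialM; [|exact: differentiableB (sk) (sc c)|exact: sc].
by rewrite partialD// partial_coord !partial_cst mulr0 !addr0.
Qed.

Lemma near_norm_lt m (a q : 'rV[R]_m) (r : R) : `|q - a| < r ->
  \forall z \near q, `|z - a| < r.
Proof.
rewrite -subr_gt0 => d0; apply/nbhs_normP; exists (r - `|q - a|) => //= z.
rewrite /ball_/= distrC => zq; apply: (le_lt_trans (ler_distD q _ _)).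
by rewrite -ltrBrDr.
Qed.

Context {m : nat}.
Implicit Types (h w : 'rV[R]_m.+1 -> R) (a z q : 'rV[R]_m.+1).

(** For t in [0, 1], the segment from the projection of [z] on the hyperplane to [z], over which
    averages are taken. *)
Definition flatten0 (t : R) z : 'rV[R]_m.+1 :=
  \row_i ((if i == 0 then t else 1) * z 0 i).

Lemma flatten0_line t z :
  flatten0 t z = flatten0 0 z + t *: (z 0 0 *: delta_mx 0 0).
Proof.
apply/rowP => i; rewrite !mxE eqxx/=.
by case: eqVneq => [->|i0] /=; ring.
Qed.

Lemma flatten0_1 z : flatten0 1 z = z.
Proof. by apply/rowP => i; rewrite !mxE if_same mul1r. Qed.

Lemma flatten0_dist t z q : 0 <= t <= 1 -> q 0 0 = 0 ->
  `|flatten0 t z - q| <= `|z - q|.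
Proof.
move=> /andP[t0 t1] q0; apply: norm_rV_le => i; rewrite !mxE.
case: eqVneq => [->|i0]; last by rewrite mul1r.
by rewrite q0 !subr0 normrM ger0_norm// ler_piMl.
Qed.

(* With w(z) = \int_0^(z_0) s^j h(s, z') ds, the quotient w / z_0^(j+1) is the
   average \int_0^1 t^j h(t z_0, z') dt; stating the relation through the
   derivative of w spares the integral. *)
Definition weighted_primitive a (r : R) j h w : Prop :=
  forall z, `|z - a| < r -> [/\ smooth_at h z, smooth_at w z,
    (z 0 0 = 0 -> w z = 0) & partial 0 w z = z 0 0 ^+ j * h z].

(** On the hyperplane the integrand is t^j h(z), whence the value h(z) / (j + 1). *)
Definition weighted_average j h w z : R :=
  if z 0 0 == 0 then h z / j.+1%:R else w z / z 0 0 ^+ j.+1.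

(** Differentiation under the integral sign: a derivative along the hyperplane falls on [h] alone,
    while the one in direction 0 also brings out a factor t, raising [j]. The new primitive, of
    s^(j+1) times the derivative of [h], is found by integration by parts. *)
Definition average_partial j h w (i : 'I_m.+1) : 'rV[R]_m.+1 -> R :=
  if i == 0 then weighted_average j.+1 (partial 0 h)
      (fun z => z 0 0 ^+ j.+1 * h z - j.+1%:R * w z)
  else weighted_average j (partial i h) (partial i w).

(** The affine function is the average of the first-order expansion of [h] at [q]; the extra factor
    t in direction 0 turns j + 1 into j + 2. The error is the error of [h] at some point of the
    segment, and no such point is farther from [q] than [z]. Since [a] lies on the hyperplane, the
    segment also stays in the ball around [a]. *)
Lemma weighted_average_taylor a r j h w q e : a 0 0 = 0 ->
  weighted_primitive a r j h w -> `|q - a| < r -> q 0 0 = 0 -> 0 < e ->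
  \forall z \near q, `|weighted_average j h w z - (h q / j.+1%:R +
     \sum_i (z 0 i - q 0 i) * (partial i h q / (if i == 0 then j.+2 else j.+1)%:R))|
     <= e * `|z - q|.
Proof.
move=> a0 hw qa q0 e0; have [sh _ _ _] := hw _ qa.
pose hbar z := h q + \sum_i (z 0 i - q 0 i) * partial i h q.
have hbarP : \forall z \near q, `|h z - hbar z| <= e * `|z - q|.
  apply: filterS (differentiable_epsP (smooth_differentiable sh) e0) => z.
  rewrite -deriveE; last exact: smooth_differentiable.
  rewrite derive_partial; last exact: smooth_differentiable.
  rewrite /hbar opprD addrA; under eq_bigr do rewrite !mxE; exact.
have inU := near_norm_lt qa.
have /nbhs_normP[d /= d0 dP] : \forall z \near q, `|h z - hbar z| <= e * `|z - q|
    /\ `|z - a| < r by apply: filterS2 hbarP inU.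
apply/nbhs_normP; exists d => //= z zd.
have [hz za] := dP _ zd.
set S := \sum_(i | i != 0) (z 0 i - q 0 i) * partial i h q.
pose A := h q + S; pose B := partial 0 h q.
(* Along the segment the expansion is affine in s = t z_0, so its weighted primitive is explicit. *)
have hbarE t : hbar (flatten0 t z) = A + B * (t * z 0 0).
  rewrite /hbar (bigD1 0)//= !mxE eqxx q0 subr0 /A /B -addrA; congr (_ + _).
  rewrite addrC mulrC; congr (_ + _).
  by apply: eq_bigr => i /negbTE i0; rewrite !mxE i0 mul1r.
have gE : h q / j.+1%:R +
     \sum_i (z 0 i - q 0 i) * (partial i h q / (if i == 0 then j.+2 else j.+1)%:R)
     = A / j.+1%:R + B * z 0 0 / j.+2%:R.
  rewrite (bigD1 0)//= q0 subr0 /A /B mulrDl -addrA; congr (_ + _).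
  rewrite addrC mulrCA mulrA; congr (_ + _).
  by rewrite /S mulr_suml; apply: eq_bigr => i /negbTE ->; rewrite mulrA.
rewrite gE.
have close (p : 'rV[R]_m.+1) : `|p - q| <= `|z - q| ->
    `|(h p - hbar p) / j.+1%:R| <= e * `|z - q|.
  move=> pq; have : `|h p - hbar p| <= e * `|p - q|.
    by have [] := dP p; rewrite // /ball_/= distrC (le_lt_trans pq)// distrC.
  move=> /le_trans hp; rewrite normrM.
  apply: le_trans (ler_piMr _ _) (hp _ (ler_pM _ _ _ _)) => //; last exact: ltW.
  by rewrite normfV ger0_norm// invf_le1// ler1n.
rewrite /weighted_average; case: eqVneq => [z0|z0].
  have -> : h z / j.+1%:R - (A / j.+1%:R + B * z 0 0 / j.+2%:R) =
      (h z - hbar z) / j.+1%:R.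
    rewrite -[z in hbar z]flatten0_1 hbarE z0 !mulr0 mul0r !addr0.
    by rewrite mulrBl.
  exact: close.
pose c := z 0 0.
(* Along the segment, [w] minus the primitive of s^j (A + B s): its derivative involves only
   [h - hbar], as [rolle_division] demands. *)
pose W t := w (flatten0 t z) - (A / j.+1%:R * (t * c) ^+ j.+1 +
   B / j.+2%:R * (t * c) ^+ j.+2).
pose H t := h (flatten0 t z) - hbar (flatten0 t z).
have j1 : j.+1%:R != 0 :> R by rewrite pnatr_eq0.
have j2 : j.+2%:R != 0 :> R by rewrite pnatr_eq0.
have [||t t01 E] := @rolle_division W H c j.
- move=> t t01.
  have pa : `|flatten0 t z - a| < r by exact: le_lt_trans (flatten0_dist _ t01 a0) za.
  have [shp swp _ dwp] := hw _ pa.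
  have dw : is_derive t 1 (fun t => w (flatten0 t z))
      (c * ((t * c) ^+ j * h (flatten0 t z))).
    have -> : (fun t => w (flatten0 t z)) =
        (fun t => w (flatten0 0 z + t *: (c *: delta_mx 0 0))).
      by apply/funext => s; rewrite flatten0_line.
    have dfw := smooth_differentiable swp.
    have := @is_derive_line _ _ w (flatten0 0 z) (c *: delta_mx 0 0) t.
    rewrite -flatten0_line => /(_ (diff_derivable dfw)).
    rewrite deriveE// linearZ/= -deriveE// -/(partial 0 w _) dwp.
    by rewrite mxE eqxx.
  have dtc : is_derive t 1 (fun t : R => t * c) c.
    apply: is_derive_eq; rewrite /GRing.scale/=; ring.
  have dX n : is_derive t 1 (fun t : R => (t * c) ^+ n.+1)
      (n.+1%:R * (t * c) ^+ n *: c).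
    have -> : (fun t : R => (t * c) ^+ n.+1) = (fun t => t * c) ^+ n.+1.
      by apply/funext => s; rewrite exprfctE.
    exact: is_deriveX.
  have dW := is_deriveB dw (is_deriveD (is_deriveZ (A / j.+1%:R) (dX j))
    (is_deriveZ (B / j.+2%:R) (dX j.+1))).
  refine (is_derive_eq (dW : is_derive t 1 W _) _).
  rewrite /H hbarE /GRing.scale/= exprS -/c; move: (h _) (_ ^+ j) => hp Xj.
  by field; rewrite -natrD addrC natr1 !pnatr_eq0.
- rewrite /W; have -> : w (flatten0 0 z) = 0.
    have p01 : (0 : R) <= 0 <= (1 : R) by rewrite lexx ler01.
    have pa : `|flatten0 0 z - a| < r by exact: le_lt_trans (flatten0_dist _ p01 a0) za.
    by have [_ _ + _] := hw _ pa; apply; rewrite mxE eqxx mul0r.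
  by rewrite mul0r !expr0n/= !mulr0 addr0 subr0.
move: E; rewrite /W /H flatten0_1 mul1r => E.
have -> : w z / z 0 0 ^+ j.+1 - (A / j.+1%:R + B * z 0 0 / j.+2%:R) =
    (h (flatten0 t z) - hbar (flatten0 t z)) / j.+1%:R.
  have c0 : c ^+ j.+1 != 0 by rewrite expf_neq0.
  apply: (mulfI c0); rewrite [RHS]mulrA -E -/c [c ^+ j.+2]exprS.
  by field; rewrite ?c0 ?z0 -?natrD ?(addrC 1) ?natr1 ?pnatr_eq0.
exact: close (flatten0_dist _ t01 q0).
Qed.

Lemma weighted_average_partial_on_hyperplane a r j h w q : a 0 0 = 0 ->
  weighted_primitive a r j h w -> `|q - a| < r -> q 0 0 = 0 ->
  differentiable (weighted_average j h w) q /\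
  forall i, partial i (weighted_average j h w) q = average_partial j h w i q.
Proof.
move=> a0 hw qa q0.
pose l i := partial i h q / (if i == 0 then j.+2 else j.+1)%:R.
pose g z := h q / j.+1%:R + \sum_i (z 0 i - q 0 i) * l i.
have sl i : smooth_at (fun z : 'rV[R]_m.+1 => (z 0 i - q 0 i) * l i) q.
  apply: smoothM (smooth_cst _ _); apply: smoothB; first exact: smooth_coord.
  exact: smooth_cst.
have dl i := smooth_differentiable (sl i).
have ssum : smooth_at (fun z => \sum_i (z 0 i - q 0 i) * l i) q.
  by apply: smooth_sum => i _; exact: sl.
have dg : differentiable g q.
  by apply: smooth_differentiable; apply: smoothD ssum; exact: smooth_cst.
have gq : weighted_average j h w q = g q.
  rewrite /weighted_average q0 eqxx /g big1 ?addr0// => i _.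
  by rewrite subrr mul0r.
have [df pf] := tangent_differentiable dg gq
  (fun e e0 => weighted_average_taylor a0 hw qa q0 e0).
split=> // i; rewrite /partial pf -/(partial i g q) partialD//; last first.
  exact: smooth_differentiable.
rewrite partial_cst add0r partial_sum// (bigD1 i)//= big1 => [|k ki].
  rewrite partial_affine eqxx mul1r addr0 /l /average_partial; case: eqVneq => [->|i0].
    by rewrite /weighted_average q0 eqxx.
  by rewrite /weighted_average q0 eqxx.
by rewrite partial_affine eq_sym (negbTE ki) mul0r.
Qed.

(** Off the hyperplane this is the quotient rule: the derivative of w / z_0^(j+1) in direction 0 is
    (z_0^(j+1) h - (j+1) w) / z_0^(j+2). *)
Lemma weighted_average_partial a r j h w q : a 0 0 = 0 ->
  weighted_primitive a r j h w -> `|q - a| < r ->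
  differentiable (weighted_average j h w) q /\
  forall i, partial i (weighted_average j h w) q = average_partial j h w i q.
Proof.
move=> a0 hw qa; have [q0|q0] := eqVneq (q 0 0) 0.
  exact: weighted_average_partial_on_hyperplane hw qa q0.
have [sh sw _ dw] := hw _ qa.
have sX : smooth_at (fun z : 'rV[R]_m.+1 => z 0 0 ^+ j.+1) q.
  by apply: smoothX; exact: smooth_coord.
have X0 : q 0 0 ^+ j.+1 != 0 by rewrite expf_neq0.
have sV := smoothV sX X0.
have near_q : \near q, w q * (q 0 0 ^+ j.+1)^-1 = weighted_average j h w q.
  apply: filterS (smooth_near_neq0 (smooth_coord 0 q) q0) => z z0.
  by rewrite /weighted_average (negbTE z0).
split.
  apply: near_eq_differentiable near_q _.
  exact: (smooth_differentiable (smoothM sw sV)).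
move=> i; rewrite -(near_eq_partial _ near_q) partialM; last 2 first.
- exact: smooth_differentiable.
- exact: smooth_differentiable sV.
rewrite partialV//; last exact: smooth_differentiable sX.
rewrite partialX ?partial_coord; last exact: smooth_differentiable (smooth_coord 0 q).
rewrite /average_partial; case: eqVneq => [->|i0].
  rewrite /weighted_average (negbTE q0) dw /= !exprS.
  have Xj0 : q 0 0 ^+ j != 0 by rewrite expf_neq0.
  by field; rewrite q0 Xj0.
by rewrite /weighted_average (negbTE q0)/=; ring.
Qed.

(** By the product rule, the term (j+1) z_0^j h cancels against the derivative of (j+1) w. *)
Lemma weighted_primitive_partial0 a r j h w : weighted_primitive a r j h w ->
  weighted_primitive a r j.+1 (partial 0 h)
    (fun z => z 0 0 ^+ j.+1 * h z - j.+1%:R * w z).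
Proof.
move=> hw z za; have [sh sw w0 dw] := hw _ za.
have sX : smooth_at (fun z : 'rV[R]_m.+1 => z 0 0 ^+ j.+1) z.
  by apply: smoothX; exact: smooth_coord.
have sc : smooth_at (fun z : 'rV[R]_m.+1 => - j.+1%:R : R) z by exact: smooth_cst.
split; first exact: smooth_partial.
- by apply: smoothB; apply: smoothM => //; exact: smooth_cst.
- by move=> z0; rewrite w0// z0 expr0n/= mul0r mulr0 subr0.
have -> : (fun z : 'rV[R]_m.+1 => z 0 0 ^+ j.+1 * h z - j.+1%:R * w z) =
    (fun z => z 0 0 ^+ j.+1 * h z + (- j.+1%:R) * w z).
  by apply/funext => y; rewrite mulNr.
rewrite partialD; last 2 first.
- exact: (smooth_differentiable (smoothM sX sh)).
- exact: (smooth_differentiable (smoothM sc sw)).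
rewrite !partialM; last 4 first.
- exact: smooth_differentiable sc.
- exact: smooth_differentiable sw.
- exact: smooth_differentiable sX.
- exact: smooth_differentiable sh.
rewrite partial_cst partialX ?partial_coord; last first.
  exact: smooth_differentiable (smooth_coord 0 z).
by rewrite dw/= exprS; ring.
Qed.

(** A line in direction [i] through a point of the hyperplane stays in it, so the difference
    quotients of [w] vanish there. The relation between primitive and integrand persists because
    second derivatives commute. *)
Lemma weighted_primitive_partial a r j h w i : i != 0 ->
  weighted_primitive a r j h w ->
  weighted_primitive a r j (partial i h) (partial i w).
Proof.
move=> i0 hw z za; have [sh sw w0 dw] := hw _ za.
have inU := near_norm_lt za.
split; [exact: smooth_partial|exact: smooth_partial| |].
  move=> z0; rewrite /partial /derive.
  set F := (fun h : R => _); suff : F h0 @[h0 --> 0^'] --> (0 : R) by apply: cvg_lim.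
  apply: (@cvg_trans _ ((fun=> 0 : R) @ (0 : R)^')); last exact: cvg_cst.
  apply: near_eq_cvg; apply: cvg_within.
  have cline : {for (0 : R), continuous (fun s : R => s *: delta_mx 0 i + z)}.
    apply: (@continuousD _ _ _ (fun s : R => s *: delta_mx 0 i) (fun=> z)).
      exact: scalel_continuous.
    exact: cst_continuous.
  have : \forall s \near (0 : R), `|s *: delta_mx 0 i + z - a| < r.
    have : \forall y \near (0 : R) *: delta_mx 0 i + z, `|y - a| < r.
      by rewrite scale0r add0r.
    by move=> /cline.
  apply: filterS => s sr; rewrite /F /= w0// subr0.
  have [_ _ + _] := hw _ sr => ->; first by rewrite scaler0.
  by rewrite !mxE z0 eq_sym (negbTE i0) mulr0 addr0.
rewrite partialC//.
have dw' : \near z, partial 0 w z = z 0 0 ^+ j * h z.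
  by apply: filterS inU => y ya; have [] := hw _ ya.
have sX : smooth_at (fun z : 'rV[R]_m.+1 => z 0 0 ^+ j) z.
  by apply: smoothX; exact: smooth_coord.
rewrite (near_eq_partial _ dw') partialM; last 2 first.
- exact: smooth_differentiable sX.
- exact: smooth_differentiable.
rewrite partialX ?partial_coord ?(negbTE i0) ?mulr0 ?mul0r ?add0r//.
exact: smooth_differentiable (smooth_coord 0 z).
Qed.

(** The induction on [k] quantifies over [j], [h] and [w], since differentiating changes all
    three. *)
Lemma Ck_weighted_average k a r j h w q : a 0 0 = 0 ->
  weighted_primitive a r j h w -> `|q - a| < r ->
  Ck_at k (weighted_average j h w) q.
Proof.
move=> a0; elim: k j h w q => [|k IHk] j h w q hw qa.
  have inU := near_norm_lt qa.
  apply: filterS inU => y ya; apply: differentiable_continuous.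
  by have [] := weighted_average_partial a0 hw ya.
have inU := near_norm_lt qa.
split.
  by apply: filterS inU => y ya; have [] := weighted_average_partial a0 hw ya.
move=> i; have Ci : Ck_at k (average_partial j h w i) q.
  rewrite /average_partial; case: eqVneq => [_|i0].
    by apply: IHk qa; exact: weighted_primitive_partial0.
  by apply: IHk qa; exact: weighted_primitive_partial.
apply: Ck_near_eq Ci; apply: filterS inU => y ya.
by have [_ ->] := weighted_average_partial a0 hw ya.
Qed.

Definition divide_coord0 (f : 'rV[R]_m.+1 -> R) z : R :=
  if z 0 0 == 0 then partial 0 f z else f z / z 0 0.

(** The case j = 0: [f], vanishing on the hyperplane, is itself the primitive of its derivative in
    direction 0. *)
Lemma smooth_divide_coord0 (f : 'rV[R]_m.+1 -> R) y : smooth_at f y ->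
  nbhs y [set z : 'rV[R]_m.+1 | z 0 0 = 0 -> f z = 0] -> smooth_at (divide_coord0 f) y.
Proof.
move=> sf f0; have [y0|y0] := eqVneq (y 0 0) 0; last first.
  apply: (smooth_near_eq _ (smoothM sf (smoothV (smooth_coord 0 y) y0))).
  apply: filterS (smooth_near_neq0 (smooth_coord 0 y) y0) => z z0.
  by rewrite /divide_coord0 (negbTE z0).
have /nbhs_normP[r /= r0 rP] : nbhs y [set z : 'rV[R]_m.+1 |
    smooth_at f z /\ (z 0 0 = 0 -> f z = 0)].
  by apply: filterS2 (smooth_near sf) f0.
have fw : weighted_primitive y r 0 (partial 0 f) f.
  move=> z zy; have [|sfz fz] := rP z; first by rewrite /ball_/= distrC.
  by split=> //; [exact: smooth_partial|rewrite expr0 mul1r].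
have -> : divide_coord0 f = weighted_average 0 (partial 0 f) f.
  by apply/funext => z; rewrite /divide_coord0 /weighted_average divr1 expr1.
have : \forall z \near y, `|z - y| < r.
  by apply/nbhs_normP; exists r => //= z; rewrite /ball_/= distrC.
by apply: filterS => z zy k; exact: Ck_weighted_average y0 fw zy.
Qed.

Lemma divide_coord0E (f : 'rV[R]_m.+1 -> R) z : (z 0 0 = 0 -> f z = 0) ->
  f z = z 0 0 * divide_coord0 f z.
Proof.
rewrite /divide_coord0; case: eqVneq => [->/(_ erefl)->|z0 _]; first by rewrite mul0r.
by field.
Qed.

End Hadamard.

(** * Germs of b-maps *)

Section BGerms.
Context {R : realType}.

Definition off_hyperplane m : set 'rV[R]_m.+1 := [set z | z 0 0 != 0].

(** The hyperplane has empty interior; this is what makes the limits in [b_extend] unique, also at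
    its points. *)
Lemma off_hyperplane_proper m (y : 'rV[R]_m.+1) :
  ProperFilter (within (@off_hyperplane m) (nbhs y)).
Proof.
apply: Build_ProperFilter.
rewrite /within/= => /nbhs_normP[r /= r0 rP].
have [y0|y0] := eqVneq (y 0 0) 0; last first.
  by apply: (rP y); rewrite /off_hyperplane //= /ball_ subrr normr0.
apply: (rP (y + (r / 2) *: delta_mx 0 0)); rewrite /off_hyperplane/=.
  rewrite /ball_/= opprD addNKr normrN normrZ.
  apply: (@le_lt_trans _ _ (r / 2)); last by rewrite ltr_pdivrMr// ltr_pMr// ltr1n.
  rewrite ger0_norm; last by rewrite divr_ge0// ltW.
  by rewrite ler_piMr ?normr_delta_mx// divr_ge0// ltW.
by rewrite !mxE y0 add0r eqxx/= mulr1 gt_eqF// divr_gt0.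
Qed.

(** The complement of the hyperplane is dense, so identities obtained by cancelling z_0 extend
    across it by continuity. *)
Lemma eq_on_hyperplane m (f g : 'rV[R]_m.+1 -> R) y :
  {for y, continuous f} -> {for y, continuous g} ->
  nbhs y [set z : 'rV[R]_m.+1 | z 0 0 != 0 -> f z = g z] -> f y = g y.
Proof.
move=> cf cg fg; pose W := within (@off_hyperplane m) (nbhs y).
have PW : ProperFilter W := off_hyperplane_proper y.
have fW : f @ W --> f y by apply: cvg_trans cf; apply: cvg_app; exact: cvg_within.
have gW : g @ W --> g y by apply: cvg_trans cg; apply: cvg_app; exact: cvg_within.
have fgW : f @ W --> g y.
  by apply: cvg_trans gW; apply: near_eq_cvg; apply: filterS fg => z fgz /fgz ->.
exact: (cvg_unique _ fW fgW).
Qed.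

Lemma b_extendE m (f g : 'rV[R]_m.+1 -> R) y : {for y, continuous g} ->
  nbhs y [set z : 'rV[R]_m.+1 | z 0 0 != 0 -> f z = g z] -> b_extend f y = g y.
Proof.
move=> cg fg; have PW := off_hyperplane_proper y.
apply: cvg_lim => //.
have gW : g @ within (@off_hyperplane m) (nbhs y) --> g y.
  by apply: cvg_trans cg; apply: cvg_app; exact: cvg_within.
by apply: cvg_trans gW; apply: near_eq_cvg; apply: filterS fg => z fgz /fgz ->.
Qed.

(** The factor [u] makes the pullback of dx_1/x_1 a smooth b-form, namely dx_1/x_1 + du/u; that it
    is nonzero keeps the complement of the hypersurface in the complement. *)
Definition b_map_with m p (F : 'rV[R]_m.+1 -> 'rV[R]_p.+1)
    (u : 'rV[R]_m.+1 -> R) (y : 'rV[R]_m.+1) : Prop :=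
  [/\ smooth_rV_at F y, smooth_at u y, u y != 0 &
      nbhs y [set z | F z 0 0 = z 0 0 * u z]].

Definition b_map_at m p (F : 'rV[R]_m.+1 -> 'rV[R]_p.+1) y : Prop :=
  exists u, b_map_with F u y.

Lemma b_map_with_near m p (F : 'rV[R]_m.+1 -> 'rV[R]_p.+1) u y :
  b_map_with F u y -> \forall z \near y, b_map_with F u z.
Proof.
move=> [sF su u0 Fu].
have sFn := smooth_rV_near sF; have sun := smooth_near su.
have u0n := smooth_near_neq0 su u0; have Fun := near_join Fu.
have h1 : \forall z \near y, smooth_rV_at F z /\ smooth_at u z by apply: filterS2 sFn sun.
by apply: filterS3 h1 u0n Fun => z [] *; split.
Qed.

Lemma b_map_near m p (F : 'rV[R]_m.+1 -> 'rV[R]_p.+1) y :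
  b_map_at F y -> \forall z \near y, b_map_at F z.
Proof. by move=> [u /b_map_with_near]; apply: filterS => z Fz; exists u. Qed.

Lemma b_map_near_eq m p (F H : 'rV[R]_m.+1 -> 'rV[R]_p.+1) y :
  (\near y, F y = H y) -> b_map_at F y -> b_map_at H y.
Proof.
move=> FH [u [sF su u0 Fu]]; exists u; split=> //.
  exact: smooth_rV_near_eq sF.
by apply: filterS2 FH Fu => z /= <-.
Qed.

Lemma b_map_smooth m p (F : 'rV[R]_m.+1 -> 'rV[R]_p.+1) y :
  b_map_at F y -> smooth_rV_at F y.
Proof. by move=> [u []]. Qed.

Definition b_weight m (i : 'I_m.+1) (z : 'rV[R]_m.+1) : R :=
  if i == 0 then z 0 0 else 1.

Lemma b_partialE m (i : 'I_m.+1) f (z : 'rV[R]_m.+1) :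
  b_partial i f z = b_weight i z * partial i f z.
Proof. by []. Qed.

Lemma b_partial_near_eq m (i : 'I_m.+1) (f g : 'rV[R]_m.+1 -> R) y :
  (\near y, f y = g y) -> b_partial i f y = b_partial i g y.
Proof. by move=> fg; rewrite !b_partialE (near_eq_partial _ fg). Qed.

Lemma smooth_b_partial m (i : 'I_m.+1) (f : 'rV[R]_m.+1 -> R) y :
  smooth_at f y -> smooth_at (b_partial i f) y.
Proof.
move=> sf; apply: smoothM; last exact: smooth_partial.
by case: (i == 0); [exact: smooth_coord|exact: smooth_cst].
Qed.

Lemma b_partial_coord0M m (i : 'I_m.+1) (u : 'rV[R]_m.+1 -> R) y :
  differentiable u y -> u y != 0 ->
  b_partial i (fun z => z 0 0 * u z) y =
  y 0 0 * u y * ((i == 0)%:R + b_partial i u y / u y).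
Proof.
move=> du u0; rewrite !b_partialE partialM//; last first.
  exact: smooth_differentiable (smooth_coord 0 y).
rewrite partial_coord /b_weight; case: eqVneq => [_|_] /=; last by field.
by field.
Qed.

(** Off the hyperplane this is the logarithmic derivative of x_1 u. The right-hand side is
    continuous, hence equal to the limit in [b_extend]. *)
Lemma b_jacobian0 m p (F : 'rV[R]_m.+1 -> 'rV[R]_p.+1) u y i :
  b_map_with F u y ->
  b_jacobian F y i 0 = (i == 0)%:R + b_partial i u y / u y.
Proof.
move=> Fu; have [_ su u0 _] := Fu; rewrite mxE eqxx.
apply: (@b_extendE _ _ (fun z => (i == 0)%:R + b_partial i u z / u z)).
  apply: smooth_continuous; apply: smoothD; first exact: smooth_cst.
  by apply: smoothM; [exact: smooth_b_partial|exact: smoothV].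
apply: filterS (b_map_with_near Fu) => z [_ suz uz0 Fuz] /= z0.
rewrite (b_partial_near_eq _ Fuz) b_partial_coord0M//; last first.
  exact: smooth_differentiable.
by rewrite (nbhs_singleton Fuz); field; rewrite z0 uz0.
Qed.

Lemma b_jacobianS m p (F : 'rV[R]_m.+1 -> 'rV[R]_p.+1) y i j : j != 0 ->
  b_jacobian F y i j = b_partial i (fun z => F z 0 j) y.
Proof. by move=> /negbTE j0; rewrite mxE j0. Qed.

Lemma b_jacobian_near_eq m p (F H : 'rV[R]_m.+1 -> 'rV[R]_p.+1) y :
  (\near y, F y = H y) -> b_map_at F y -> b_jacobian F y = b_jacobian H y.
Proof.
move=> FH [u Fu]; have [sF su u0 F0] := Fu.
have Hu : b_map_with H u y.
  split=> //; first exact: smooth_rV_near_eq sF.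
  by apply: filterS2 FH F0 => z /= <-.
apply/matrixP => i j; case: (eqVneq j 0) => [->|j0].
  by rewrite (b_jacobian0 _ Fu) (b_jacobian0 _ Hu).
rewrite !b_jacobianS//; apply: b_partial_near_eq.
by apply: filterS FH => z ->.
Qed.

Lemma smooth_b_jacobian m p (F : 'rV[R]_m.+1 -> 'rV[R]_p.+1) y i j :
  b_map_at F y -> smooth_at (fun z => b_jacobian F z i j) y.
Proof.
move=> [u Fu]; have [sF su u0 _] := Fu; case: (eqVneq j 0) => [->|j0].
  have s0 : smooth_at (fun z => (i == 0)%:R + b_partial i u z / u z) y.
    apply: smoothD; first exact: smooth_cst.
    by apply: smoothM; [exact: smooth_b_partial|exact: smoothV].
  apply: smooth_near_eq s0; apply: filterS (b_map_with_near Fu) => z Fuz.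
  by rewrite (b_jacobian0 _ Fuz).
apply: smooth_near_eq (smooth_b_partial i (sF j)).
by apply: filterE => z; rewrite b_jacobianS.
Qed.

(** For l = 0 the weight F_0 of the target frame cancels the division by F_0 in the first column, so
    the rule also holds on the hyperplane. *)
Lemma b_partial_comp m p (F : 'rV[R]_m.+1 -> 'rV[R]_p.+1) (h : 'rV[R]_p.+1 -> R) y i :
  b_map_at F y -> differentiable h (F y) ->
  b_partial i (h \o F) y = \sum_l b_jacobian F y i l * b_partial l h (F y).
Proof.
move=> [u Fu] dh; have [sF su u0 F0] := Fu.
rewrite b_partialE [partial i _ y]derive_chain//; last exact: smooth_rV_differentiable.
rewrite mulr_sumr; apply: eq_bigr => l _; rewrite -/(partial i _ y) !b_partialE.
case: (eqVneq l 0) => [->|l0]; last first.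
  by rewrite b_jacobianS// b_partialE /b_weight (negbTE l0); ring.
have -> : b_weight i y * (partial 0 h (F y) * partial i (fun z => F z 0 0) y) =
    partial 0 h (F y) * b_partial i (fun z => F z 0 0) y by rewrite b_partialE; ring.
rewrite (b_partial_near_eq _ F0) b_partial_coord0M//; last exact: smooth_differentiable.
by rewrite (b_jacobian0 _ Fu) /b_weight eqxx (nbhs_singleton F0); ring.
Qed.

Lemma b_map_comp_with m p q (F : 'rV[R]_m.+1 -> 'rV[R]_p.+1)
    (H : 'rV[R]_p.+1 -> 'rV[R]_q.+1) u w y :
  b_map_with F u y -> b_map_with H w (F y) ->
  b_map_with (H \o F) (fun z => u z * w (F z)) y.
Proof.
move=> [sF su u0 F0] [sH sw w0 H0]; split.
- exact: smooth_rV_comp.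
- by apply: smoothM => //; exact: (smooth_comp sF sw).
- exact: mulf_neq0.
- apply: filterS2 F0 (near_comp (smooth_rV_continuous sF) H0) => z /= Fz ->.
  by rewrite Fz mulrA.
Qed.

Lemma b_map_comp m p q (F : 'rV[R]_m.+1 -> 'rV[R]_p.+1)
    (H : 'rV[R]_p.+1 -> 'rV[R]_q.+1) y :
  b_map_at F y -> b_map_at H (F y) -> b_map_at (H \o F) y.
Proof.
by move=> [u Fu] [w Hw]; exists (fun z => u z * w (F z)); exact: b_map_comp_with.
Qed.

(** The first column needs its own argument: the factor of the composite is u times w o F, and its
    logarithmic derivative is the sum of those of the two factors. *)
Lemma b_jacobian_comp m p q (F : 'rV[R]_m.+1 -> 'rV[R]_p.+1)
    (H : 'rV[R]_p.+1 -> 'rV[R]_q.+1) y :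
  b_map_at F y -> b_map_at H (F y) ->
  b_jacobian (H \o F) y = b_jacobian F y *m b_jacobian H (F y).
Proof.
move=> bF bH; have [u Fu] := bF; have [w Hw] := bH.
have [sF su u0 F0] := Fu; have [sH sw w0 H0] := Hw.
apply/matrixP => i j; rewrite [RHS]mxE; case: (eqVneq j 0) => [->|j0].
  rewrite (b_jacobian0 _ (b_map_comp_with Fu Hw)).
  have -> : b_partial i (fun z => u z * w (F z)) y =
      b_partial i u y * w (F y) + u y * b_partial i (w \o F) y.
    rewrite !b_partialE partialM; last 2 first.
    - exact: smooth_differentiable.
    - exact: (smooth_differentiable (smooth_comp sF sw)).
    by rewrite mulrDr mulrA mulrCA.
  rewrite b_partial_comp//; last exact: smooth_differentiable.
  under [RHS]eq_bigr do rewrite (b_jacobian0 _ Hw) mulrDr.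
  rewrite big_split/=.
  have -> : \sum_l b_jacobian F y i l * (l == 0)%:R = b_jacobian F y i 0.
    rewrite (bigD1 0)//= mulr1 big1 ?addr0// => l /negbTE ->.
    by rewrite mulr0.
  rewrite (b_jacobian0 _ Fu).
  under [X in _ = _ + X]eq_bigr do rewrite mulrA.
  rewrite -mulr_suml; move: (\sum_(_ < _) _) => S.
  by field; rewrite u0 w0.
rewrite b_jacobianS// (@b_partial_comp _ _ F (fun z => H z 0 j))//; last first.
  exact: smooth_differentiable (sH j).
by apply: eq_bigr => l _; rewrite (b_jacobianS H).
Qed.

Lemma b_map_id m (y : 'rV[R]_m.+1) : b_map_at id y.
Proof.
exists (fun=> 1); split; first exact: smooth_rV_id.
- exact: smooth_cst.
- exact: oner_neq0.
- by apply: filterE => z; rewrite /= mulr1.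
Qed.

Lemma b_jacobian_id m (y : 'rV[R]_m.+1) : b_jacobian id y = 1%:M.
Proof.
have idu : b_map_with (@id 'rV[R]_m.+1) (fun=> 1) y.
  split; first exact: smooth_rV_id.
  - exact: smooth_cst.
  - exact: oner_neq0.
  - by apply: filterE => z; rewrite /= mulr1.
apply/matrixP => i j; rewrite [RHS]mxE; case: (eqVneq j 0) => [->|j0].
  by rewrite (b_jacobian0 _ idu) b_partialE partial_cst mulr0 mul0r addr0.
rewrite b_jacobianS// b_partialE partial_coord /b_weight.
by case: (eqVneq i 0) => [->|_]; rewrite ?mul1r// eq_sym (negbTE j0) mulr0.
Qed.

(** Hadamard's lemma gives factors u of [F] and w of [H]. Off the hyperplane H(F(z)) = z forces u(z)
    w(F(z)) = 1; by continuity this holds at [y], so u(y) is nonzero. *)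
Lemma b_map_left_inverse m p (F : 'rV[R]_m.+1 -> 'rV[R]_p.+1)
    (H : 'rV[R]_p.+1 -> 'rV[R]_m.+1) y :
  smooth_rV_at F y -> smooth_rV_at H (F y) ->
  nbhs y [set z : 'rV[R]_m.+1 | z 0 0 = 0 -> F z 0 0 = 0] ->
  nbhs (F y) [set z : 'rV[R]_p.+1 | z 0 0 = 0 -> H z 0 0 = 0] ->
  (\forall z \near y, H (F z) = z) -> b_map_at F y.
Proof.
move=> sF sH F0 H0 HF.
pose u := divide_coord0 (fun z => F z 0 0).
pose w := divide_coord0 (fun z => H z 0 0).
have su : smooth_at u y by exact: smooth_divide_coord0.
have sw : smooth_at w (F y) by exact: smooth_divide_coord0.
exists u; split=> //; last by apply: filterS F0 => z; exact: divide_coord0E.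
have uw : u y * w (F y) = 1.
  apply: (@eq_on_hyperplane _ (fun z => u z * w (F z)) (fun=> 1)).
  - by apply: smooth_continuous; apply: smoothM su _; exact: (smooth_comp sF sw).
  - exact: cst_continuous.
  have H0F := near_comp (smooth_rV_continuous sF) H0.
  apply: filterS3 F0 H0F HF => z Fz Hz HFz z0.
  apply: (mulfI z0); rewrite mulr1 mulrA -(divide_coord0E Fz).
  by rewrite -(divide_coord0E Hz) HFz.
by apply: contraPneq uw => ->; rewrite mul0r => /esym/eqP; rewrite oner_eq0.
Qed.

End BGerms.

(** * b-Jacobians in block form, with additional parameters *)

Section BGermBlocks.
Context {R : realType}.

Definition b_gradient m q (H : 'rV[R]_m.+1 -> 'rV[R]_q) (y : 'rV[R]_m.+1) :
    'M[R]_(m.+1, q) :=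
  \matrix_(i, j) b_partial i (fun z => H z 0 j) y.

(** [(p + q).+1] and [p.+1 + q] are convertible, which lets block matrices serve as b-Jacobians; the
    coordinate defining the hypersurface is the first one of the left block. *)
Lemma lshift_eq0 p q (l : 'I_p.+1) : (lshift q l == 0 :> 'I_(p + q).+1) = (l == 0).
Proof. by []. Qed.

Lemma rshift_eq0 p q (l : 'I_q) : (rshift p.+1 l == 0 :> 'I_(p + q).+1) = false.
Proof. by []. Qed.

Lemma lshift_eq p q (a b : 'I_p.+1) :
  (lshift q a == lshift q b :> 'I_(p + q).+1) = (a == b).
Proof. exact: (inj_eq (@lshift_inj p.+1 q)). Qed.

Lemma rshift_eq p q (a b : 'I_q) :
  (rshift p.+1 a == rshift p.+1 b :> 'I_(p + q).+1) = (a == b).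
Proof. exact: (inj_eq (@rshift_inj p.+1 q)). Qed.

Lemma lsubmx00 m k (z : 'rV[R]_(m.+1 + k)) :
  lsubmx z 0 0 = (z : 'rV[R]_(m + k).+1) 0 0.
Proof. by rewrite mxE; congr (z _ _); exact: val_inj. Qed.

Lemma row_mx00 p q (a : 'rV[R]_p.+1) (b : 'rV[R]_q) :
  (row_mx a b : 'rV[R]_(p + q).+1) 0 0 = a 0 0.
Proof. by rewrite -(row_mxEl a b); congr (row_mx a b _ _); exact: val_inj. Qed.

Lemma b_map_row_mx m p q (F : 'rV[R]_m.+1 -> 'rV[R]_p.+1)
    (H : 'rV[R]_m.+1 -> 'rV[R]_q) y :
  b_map_at F y -> smooth_rV_at H y ->
  @b_map_at R m (p + q) (fun z => row_mx (F z) (H z)) y.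
Proof.
move=> [u [sF su u0 F0]] sH; exists u; split=> //.
  exact: (smooth_row_mx sF sH).
by apply: filterS F0 => z /= <-; rewrite row_mx00.
Qed.

Lemma b_jacobian_row_mx m p q (F : 'rV[R]_m.+1 -> 'rV[R]_p.+1)
    (H : 'rV[R]_m.+1 -> 'rV[R]_q) y :
  @b_jacobian R m (p + q) (fun z => row_mx (F z) (H z)) y =
  row_mx (b_jacobian F y) (b_gradient H y).
Proof.
apply/matrixP => i j; rewrite [LHS]mxE.
have -> : (fun z => (row_mx (F z) (H z) : 'rV[R]_(p + q).+1) 0 0) =
    (fun z => F z 0 0) by apply/funext => z; rewrite row_mx00.
have -> : (fun z => b_partial i (fun w => F w 0 0) z /
      (row_mx (F z) (H z) : 'rV[R]_(p + q).+1) 0 0) =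
    (fun z => b_partial i (fun w => F w 0 0) z / F z 0 0).
  by apply/funext => z; rewrite row_mx00.
case: (@split_ordP p.+1 q j) => l ->.
  rewrite (@row_mxEl _ _ p.+1 q) mxE lshift_eq0; case: ifP => // _.
  by congr (b_partial _ _ _); apply/funext => z; rewrite (@row_mxEl _ _ p.+1 q).
rewrite (@row_mxEr _ _ p.+1 q) mxE rshift_eq0.
by congr (b_partial _ _ _); apply/funext => z; rewrite (@row_mxEr _ _ p.+1 q).
Qed.

Lemma b_map_lsubmx m k (y : 'rV[R]_(m + k).+1) :
  @b_map_at R (m + k) m (@lsubmx R 1 m.+1 k) y.
Proof.
exists (fun=> 1); split; first exact: (@smooth_lsubmx R m.+1 k).
- exact: smooth_cst.
- exact: oner_neq0.
- by apply: filterE => z /=; rewrite mulr1 lsubmx00.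
Qed.

Lemma b_jacobian_lsubmx m k (y : 'rV[R]_(m + k).+1) :
  @b_jacobian R (m + k) m (@lsubmx R 1 m.+1 k) y =
  (col_mx 1%:M 0 : 'M[R]_(m.+1 + k, m.+1)).
Proof.
have lu : @b_map_with R (m + k) m (@lsubmx R 1 m.+1 k) (fun=> 1) y.
  split; first exact: (@smooth_lsubmx R m.+1 k).
  - exact: smooth_cst.
  - exact: oner_neq0.
  - by apply: filterE => z /=; rewrite mulr1 lsubmx00.
apply/matrixP => i j; case: (eqVneq j 0) => [->|j0].
  rewrite (b_jacobian0 _ lu) b_partialE partial_cst mulr0 mul0r addr0.
  case: (@split_ordP m.+1 k i) => l ->; first by rewrite (@col_mxEu _ m.+1 k) mxE.
  by rewrite (@col_mxEd _ m.+1 k) mxE.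
rewrite b_jacobianS//.
have -> : (fun z : 'rV[R]_(m.+1 + k) => lsubmx z 0 j) = (fun z => z 0 (lshift k j)).
  by apply/funext => z; rewrite mxE.
rewrite b_partialE partial_coord.
case: (@split_ordP m.+1 k i) => l ->; last first.
  rewrite (@col_mxEd _ m.+1 k) mxE; case: eqP => [/(congr1 val)/=|_]; last by rewrite mulr0.
  by have := ltn_ord j; lia.
rewrite (@col_mxEu _ m.+1 k) mxE /b_weight lshift_eq0 lshift_eq.
case: (eqVneq l j) => [->|_]; last by rewrite mulr0.
by rewrite (negbTE j0) mulr1.
Qed.

Lemma b_gradient_rsubmx m k (y : 'rV[R]_(m + k).+1) :
  @b_gradient (m + k) k (@rsubmx R 1 m.+1 k) y =
  (col_mx 0 1%:M : 'M[R]_(m.+1 + k, k)).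
Proof.
apply/matrixP => i j; rewrite [LHS]mxE.
have -> : (fun z : 'rV[R]_(m.+1 + k) => rsubmx z 0 j) = (fun z => z 0 (rshift m.+1 j)).
  by apply/funext => z; rewrite mxE.
rewrite b_partialE partial_coord.
case: (@split_ordP m.+1 k i) => l ->.
  rewrite (@col_mxEu _ m.+1 k) mxE; case: eqP => [/(congr1 val)/=|_]; last by rewrite mulr0.
  by have := ltn_ord l; lia.
rewrite (@col_mxEd _ m.+1 k) mxE /b_weight rshift_eq0 rshift_eq.
by rewrite mul1r.
Qed.

Lemma b_gradient_comp m p q (F : 'rV[R]_m.+1 -> 'rV[R]_p.+1)
    (H : 'rV[R]_p.+1 -> 'rV[R]_q) y :
  b_map_at F y -> smooth_rV_at H (F y) ->
  b_gradient (H \o F) y = b_jacobian F y *m b_gradient H (F y).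
Proof.
move=> bF sH; apply/matrixP => i j; rewrite !mxE.
rewrite (@b_partial_comp _ _ _ F (fun z => H z 0 j))//; last first.
  exact: smooth_differentiable (sH j).
by apply: eq_bigr => l _; rewrite [b_gradient _ _ _ _]mxE.
Qed.

Lemma b_gradient_cst m q (s : 'rV[R]_q) (y : 'rV[R]_m.+1) :
  b_gradient (fun=> s) y = 0.
Proof. by apply/matrixP => i j; rewrite !mxE b_partialE partial_cst mulr0. Qed.

Lemma b_map_insert m k (s : 'rV[R]_k) (y : 'rV[R]_m.+1) :
  @b_map_at R m (m + k) (fun z => row_mx z s) y.
Proof. by apply: (@b_map_row_mx _ _ _ id); [exact: b_map_id|exact: smooth_rV_cst]. Qed.

Lemma b_jacobian_insert m k (s : 'rV[R]_k) (y : 'rV[R]_m.+1) :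
  @b_jacobian R m (m + k) (fun z => row_mx z s) y = row_mx 1%:M 0.
Proof.
by rewrite (@b_jacobian_row_mx _ _ _ id) b_jacobian_id b_gradient_cst.
Qed.

Lemma b_map_slice m k p (F : 'rV[R]_(m + k).+1 -> 'rV[R]_p.+1) (y : 'rV[R]_m.+1)
    (s : 'rV[R]_k) :
  b_map_at F (row_mx y s) -> b_map_at (fun z => F (row_mx z s)) y.
Proof. by move=> bF; apply: (@b_map_comp _ _ (m + k) _ _ F); [exact: b_map_insert|]. Qed.

Lemma b_jacobian_slice m k p (F : 'rV[R]_(m + k).+1 -> 'rV[R]_p.+1) (y : 'rV[R]_m.+1)
    (s : 'rV[R]_k) :
  b_map_at F (row_mx y s) -> b_jacobian (fun z => F (row_mx z s)) y =
  usubmx (b_jacobian F (row_mx y s) : 'M[R]_(m.+1 + k, _)).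
Proof.
move=> bF; rewrite (@b_jacobian_comp _ _ (m + k) _ _ F)//; last exact: b_map_insert.
rewrite b_jacobian_insert -[b_jacobian F _ in LHS](@vsubmxK _ m.+1 k).
by rewrite (@mul_row_col _ _ m.+1 k) mul1mx mul0mx addr0.
Qed.

Lemma b_partial_slice m k (f : 'rV[R]_(m + k).+1 -> R) (y : 'rV[R]_m.+1)
    (s : 'rV[R]_k) i : differentiable f (row_mx y s) ->
  b_partial i (fun z => f (row_mx z s)) y = b_partial (lshift k i) f (row_mx y s).
Proof.
move=> df; rewrite (@b_partial_comp _ _ (m + k) _ f)//; last exact: b_map_insert.
rewrite b_jacobian_insert (bigD1 (lshift k i))//= (@row_mxEl _ _ m.+1 k) mxE eqxx mul1r.
rewrite big1 ?addr0// => l li; case: (@split_ordP m.+1 k l) li => l' ->.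
  by rewrite lshift_eq eq_sym (@row_mxEl _ _ m.+1 k) mxE => /negbTE ->; rewrite mul0r.
by rewrite (@row_mxEr _ _ m.+1 k) mxE mul0r.
Qed.

(** The fields of the b-frame commute: the only non-constant weight depends on x_1 alone, and only
    the first field differentiates in that direction. *)
Lemma b_partialC m i j (f : 'rV[R]_m.+1 -> R) y : smooth_at f y ->
  b_partial i (b_partial j f) y = b_partial j (b_partial i f) y.
Proof.
move=> sf.
have sw (l : 'I_m.+1) : smooth_at (b_weight l) y.
  by rewrite /b_weight; case: eqP => _; [exact: smooth_coord|exact: smooth_cst].
have E a b : b_partial a (b_partial b f) y = b_weight a y *
    (partial a (b_weight b) y * partial b f y +
     b_weight b y * partial a (partial b f) y).
  rewrite b_partialE; congr (_ * _).
  rewrite -[b_partial b f]/(fun z => b_weight b z * partial b f z) partialM//.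
    exact: smooth_differentiable.
  exact: smooth_differentiable (smooth_partial _ sf).
have W a b : partial a (b_weight b) y = ((a == 0) && (b == 0))%:R :> R.
  rewrite /b_weight; case: (b == 0); first by rewrite partial_coord andbT.
  by rewrite partial_cst andbF.
rewrite !E (partialC i j sf) !W andbC.
by case: (eqVneq i 0) => [->|_]; case: (eqVneq j 0) => [->|_] //=;
  rewrite !mul0r !add0r mulrCA.
Qed.

(* The forms dx_1/x_1, dx_2, ... are closed, hence so are their pullbacks. *)
Lemma b_jacobian_closed m p (F : 'rV[R]_m.+1 -> 'rV[R]_p.+1) y i k j :
  b_map_at F y -> b_partial i (fun z => b_jacobian F z k j) y =
  b_partial k (fun z => b_jacobian F z i j) y.
Proof.
move=> [u Fu]; have [sF su u0 _] := Fu; case: (eqVneq j 0) => [->|j0]; last first.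
  have E l : (fun z => b_jacobian F z l j) = b_partial l (fun w => F w 0 j).
    by apply/funext => z; rewrite b_jacobianS.
  by rewrite !E b_partialC//; exact: sF.
have J0 l : \forall z \near y, b_jacobian F z l 0 = (l == 0)%:R + b_partial l u z / u z.
  by apply: filterS (b_map_with_near Fu) => z Fuz; rewrite (b_jacobian0 _ Fuz).
(* The quotient rule applied to e_b(u) / u; the result is symmetric in [a] and [b] because e_a and
   e_b commute. *)
have dJ a b : b_partial a (fun z => b_jacobian F z b 0) y =
    (b_partial a (b_partial b u) y * u y - b_partial b u y * b_partial a u y) / u y ^+ 2.
  rewrite (b_partial_near_eq _ (J0 b)) !b_partialE.
  have du := smooth_differentiable su.
  have sbu := smooth_b_partial b su; have dbu := smooth_differentiable sbu.
  have sV := smoothV su u0; have dV := smooth_differentiable sV.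
  rewrite partialD; last 2 first.
  - exact: smooth_differentiable (smooth_cst _ _).
  - exact: smooth_differentiable (smoothM sbu sV).
  rewrite partial_cst partialM// partialV// b_partialE.
  move: (partial a _ y) (partial a u y) (b_partial b u y) (b_weight a y) => Da D B w.
  by move: (u y) u0 => v v0; field.
by rewrite !dJ (b_partialC k i su) [b_partial k u y * _]mulrC.
Qed.

End BGermBlocks.

Local Notation coord := Defs.coord.

(** * b-spaces with compatible b-charts *)

Section SmoothMatrix.
Context {R : realType}.

Lemma smooth_mulmx_tr m p q (v : 'rV[R]_m -> 'rV[R]_p) (A : 'rV[R]_m -> 'M[R]_(q, p)) y :
  smooth_rV_at v y -> (forall i j, smooth_at (fun z => A z i j) y) ->
  smooth_rV_at (fun z => v z *m (A z)^T) y.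
Proof.
move=> sv sA j.
have : smooth_at (fun z => \sum_l v z 0 l * A z j l) y.
  by apply: smooth_sum => l _; apply: smoothM; [exact: sv|exact: sA].
apply: smooth_near_eq; apply: filterE => z; rewrite mxE.
by apply: eq_bigr => l _; rewrite mxE.
Qed.

End SmoothMatrix.

(** What the calculus needs of a b-space, stated in coordinates because the points carry no
    topology. It holds for b-manifolds and is inherited by their b-cotangent bundles. *)
Record compatible_b_charts (R : realType) (S : b_space R) : Prop := CompatibleBCharts {
  cb_at : forall x : S, bcharts (bchart_at x) /\ dom (bchart_at x) x;
  cb_open : forall c : chart R S (bdim S).+1, bcharts c -> open (img c);
  cb_param : forall (c : chart R S (bdim S).+1) x, bcharts c -> dom c x ->
    param c (coord c x) = x;
  cb_near : forall (c c' : chart R S (bdim S).+1) x, bcharts c -> bcharts c' ->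
    dom c x -> dom c' x -> \forall y \near coord c x, dom c' (param c y);
  cb_map : forall (c c' : chart R S (bdim S).+1) x, bcharts c -> bcharts c' ->
    dom c x -> dom c' x -> b_map_at (coord c' \o param c) (coord c x)
}.

Section CompatibleBCharts.
Context {R : realType} {S : b_space R}.
Hypothesis cS : compatible_b_charts S.
Local Notation n := (bdim S).
Implicit Types (c : chart R S n.+1) (x : S).

Lemma img_param c y : bcharts c -> img c y ->
  dom c (param c y) /\ coord c (param c y) = y.
Proof. by move=> bc [x dx <-]; rewrite (cb_param cS). Qed.

Lemma img_coord c x : dom c x -> img c (coord c x).
Proof. by move=> dx; exists x. Qed.

Lemma near_img c x : bcharts c -> dom c x -> \forall y \near coord c x, img c y.
Proof.
move=> bc dx; apply: open_nbhs_nbhs; split; first exact: cb_open.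
exact: img_coord.
Qed.

Definition transition c c' x : 'M[R]_n.+1 :=
  b_jacobian (coord c' \o param c) (coord c x).

Lemma transition_id c x : bcharts c -> dom c x -> transition c c x = 1%:M.
Proof.
move=> bc dx; rewrite -(b_jacobian_id (coord c x)).
apply: b_jacobian_near_eq; last exact: cb_map.
by apply: filterS (near_img bc dx) => y /(img_param bc)[].
Qed.

Lemma transition_comp c c' c'' x : bcharts c -> bcharts c' -> bcharts c'' ->
  dom c x -> dom c' x -> dom c'' x ->
  transition c c' x *m transition c' c'' x = transition c c'' x.
Proof.
move=> bc bc' bc'' dx dx' dx''; rewrite /transition.
have xE : (coord c' \o param c) (coord c x) = coord c' x by rewrite /= (cb_param cS).
have bm : b_map_at (coord c'' \o param c') ((coord c' \o param c) (coord c x)).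
  by rewrite xE; exact: cb_map.
rewrite -[in X in _ *m X]xE -b_jacobian_comp//; last exact: cb_map.
apply: b_jacobian_near_eq; last by apply: b_map_comp; [exact: cb_map|].
by apply: filterS (cb_near cS bc bc' dx dx') => y dy; rewrite /= (cb_param cS).
Qed.

Lemma transitionK c c' x : bcharts c -> bcharts c' -> dom c x -> dom c' x ->
  transition c c' x *m transition c' c x = 1%:M.
Proof. by move=> bc bc' dx dx'; rewrite transition_comp// transition_id. Qed.

Lemma covector_inE c x xi :
  covector_in c x xi = xi *m (transition c (bchart_at x) x)^T.
Proof. by []. Qed.

(** ** The b-cotangent bundle *)

Local Notation E := (b_cotangent S).

Lemma cotangent_param c (z : 'rV[R]_(n.+1 + n.+1)) :
  param (cotangent_chart c) z = (param c (lsubmx z), rsubmx z *m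
    (transition (bchart_at (param c (lsubmx z))) c (param c (lsubmx z)))^T).
Proof. by []. Qed.

(** The preferred b-chart at the base point, which may jump from point to point, drops out by the
    cocycle relation. Only the two fixed charts remain. *)
Lemma cotangent_coordE c c' (z : 'rV[R]_(n.+1 + n.+1)) :
  bcharts c -> bcharts c' -> img c (lsubmx z) -> dom c' (param c (lsubmx z)) ->
  coord (cotangent_chart c') (param (cotangent_chart c) z) =
  row_mx ((coord c' \o param c) (lsubmx z))
    (rsubmx z *m (b_jacobian (coord c \o param c')
                             ((coord c' \o param c) (lsubmx z)))^T).
Proof.
move=> bc bc' iz dz; have [bx dx] := cb_at cS (param c (lsubmx z)).
have [cx _] := img_param bc iz.
by rewrite cotangent_param/= covector_inE -mulmxA -trmx_mul transition_comp.
Qed.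

Lemma cotangent_coordK c (z : 'rV[R]_(n.+1 + n.+1)) : bcharts c ->
  img c (lsubmx z) -> coord (cotangent_chart c) (param (cotangent_chart c) z) = z.
Proof.
move=> bc iz; have [dz zE] := img_param bc iz.
rewrite cotangent_coordE//= zE -[X in b_jacobian _ X]zE.
by rewrite -/(transition c c _) transition_id// trmx1 mulmx1 hsubmxK.
Qed.

Lemma cotangent_imgE c (z : 'rV[R]_(n.+1 + n.+1)) : bcharts c ->
  img (cotangent_chart c) z <-> img c (lsubmx z).
Proof.
move=> bc; split=> [[p dp <-]|iz].
  by rewrite /= row_mxKl; exact: img_coord.
exists (param (cotangent_chart c) z); last exact: cotangent_coordK.
by have [] := img_param bc iz.
Qed.

Lemma cotangent_coordP c (p : E) : bcharts c -> dom c p.1 ->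
  param (cotangent_chart c) (coord (cotangent_chart c) p) = p.
Proof.
move=> bc dp; rewrite cotangent_param/= row_mxKl row_mxKr covector_inE.
rewrite (cb_param cS bc dp); have [bx dx] := cb_at cS p.1.
by rewrite -mulmxA -trmx_mul transitionK// trmx1 mulmx1 -surjective_pairing.
Qed.

(** A change of cotangent charts is a chart change of the base together with a linear map of [p]
    whose matrix is a b-Jacobian, hence smooth. Its first coordinate is that of the base, so it is a
    b-map with the same factor. *)
Lemma compatible_cotangent : compatible_b_charts E.
Proof.
have clsub (z : 'rV[R]_(n.+1 + n.+1)) : {for z, continuous (@lsubmx R 1 n.+1 n.+1)}.
  exact: smooth_rV_continuous (smooth_lsubmx z).
split.
- by move=> p; have [bx dx] := cb_at cS p.1; split=> //; exists (bchart_at p.1).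
- move=> _ [c bc <-].
  have -> : img (cotangent_chart c) = @lsubmx R 1 n.+1 n.+1 @^-1` img c.
    by apply/seteqP; split=> z /(cotangent_imgE _ bc).
  by apply: open_comp => [z _|]; [exact: clsub|exact: cb_open].
- by move=> _ p [c bc <-]; exact: cotangent_coordP.
- move=> _ _ p [c bc <-] [c' bc' <-] dp dp'.
  have := cb_near cS bc bc' dp dp'.
  have := clsub (coord (cotangent_chart c) p); rewrite /= /prop_for /continuous_at.
  by rewrite row_mxKl => cl /cl.
- move=> _ _ p [c bc <-] [c' bc' <-] /= dp dp'.
  set z0 := row_mx _ _.
  have z0l : lsubmx z0 = coord c p.1 by rewrite /z0 row_mxKl.
  have bphi : b_map_at (coord c' \o param c) (lsubmx z0) by rewrite z0l; exact: cb_map.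
  have bpsi : b_map_at (coord c \o param c') ((coord c' \o param c) (lsubmx z0)).
    by rewrite z0l/= (cb_param cS)//; exact: cb_map.
  pose F (z : 'rV[R]_(n.+1 + n.+1)) := row_mx ((coord c' \o param c) (lsubmx z))
    (rsubmx z *m (b_jacobian (coord c \o param c')
                             ((coord c' \o param c) (lsubmx z)))^T).
  have bl := @b_map_comp _ (n + n.+1) n n _ _ z0 (b_map_lsubmx _) bphi.
  have bF : @b_map_at R (n + n.+1) (n + n.+1) F z0.
    apply: (@b_map_row_mx _ _ n n.+1 ((coord c' \o param c) \o lsubmx)) (bl) _.
    apply: smooth_mulmx_tr; first exact: (@smooth_rsubmx _ n.+1 n.+1).
    move=> i j; exact: (@smooth_comp R (n.+1 + n.+1) n.+1
      ((coord c' \o param c) \o lsubmx)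
      (fun w => b_jacobian (coord c \o param c') w i j) z0 (b_map_smooth bl)
      (smooth_b_jacobian i j bpsi)).
  apply: b_map_near_eq bF.
  have near_l (P : set 'rV[R]_n.+1) : nbhs (coord c p.1) P ->
      \forall z \near z0, P (lsubmx z).
    by rewrite -z0l => /(clsub z0).
  apply: filterS2 (near_l _ (near_img bc dp)) (near_l _ (cb_near cS bc bc' dp dp')).
  by move=> z iz dz; exact: esym (cotangent_coordE bc bc' iz dz).
Qed.

End CompatibleBCharts.

(** * Actions by b-maps *)

Section LieGroupCharts.
Context {R : realType} {k : nat} {G : lie_group R k}.
Implicit Types (c : chart R G k) (g : G).

Lemma group_chart g : exists2 c, @lg_atlas R k G c & dom c g.
Proof. exact: (mf_covers (lg_manifold G)). Qed.

Lemma group_open_img c : @lg_atlas R k G c -> open (img c).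
Proof. by move=> /(mf_homeo (lg_manifold G))[]. Qed.

Lemma group_paramK c g : @lg_atlas R k G c -> dom c g -> param c (coord c g) = g.
Proof. by move=> /(mf_homeo (lg_manifold G))[_ _ + _ _]; apply. Qed.

Lemma group_near_img c g : @lg_atlas R k G c -> dom c g ->
  \forall s \near coord c g, img c s.
Proof.
move=> Ac dg; apply: open_nbhs_nbhs; split; first exact: group_open_img.
by exists g.
Qed.

Lemma group_img_param c s : @lg_atlas R k G c -> img c s ->
  dom c (param c s) /\ coord c (param c s) = s.
Proof. by move=> Ac [g dg <-]; rewrite group_paramK. Qed.

End LieGroupCharts.

(** The coordinates of the point precede those of the group element, so that the coordinate of index
    0 still defines the hypersurface. *)
Definition family (R : realType) (k n : nat) (G : lie_group R k) (T : Type)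
    (act : G -> T -> T) (cG : chart R G k) (c c' : chart R T n.+1)
    (z : 'rV[R]_(n.+1 + k)) : 'rV[R]_n.+1 :=
  coord c' (act (param cG (rsubmx z)) (param c (lsubmx z))).

(** The b-map condition is joint in the point and the group element: derivatives in the group
    directions yield the fundamental fields, and mixed ones their variation along the space. *)
Record b_action (R : realType) (k : nat) (G : lie_group R k) (S : b_space R)
    (act : G -> S -> S) : Prop := BAction {
  ba_one : forall x, act 1%g x = x;
  ba_mul : forall g h x, act (g * h)%g x = act g (act h x);
  ba_near : forall cG (c c' : chart R S (bdim S).+1) g x, @lg_atlas R k G cG ->
    bcharts c -> bcharts c' -> dom cG g -> dom c x -> dom c' (act g x) ->
    \forall z \near row_mx (coord c x) (coord cG g),
      dom c' (act (param cG (rsubmx z)) (param c (lsubmx z)));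
  ba_map : forall cG (c c' : chart R S (bdim S).+1) g x, @lg_atlas R k G cG ->
    bcharts c -> bcharts c' -> dom cG g -> dom c x -> dom c' (act g x) ->
    @b_map_at R (bdim S + k) (bdim S) (family act cG c c')
      (row_mx (coord c x) (coord cG g))
}.

Section BActions.
Context {R : realType} {k : nat} {G : lie_group R k} {S : b_space R}.
Variable act : G -> S -> S.
Hypothesis (cS : compatible_b_charts S) (aS : b_action act).
Local Notation n := (bdim S).
Implicit Types (c : chart R S n.+1) (x : S) (g h : G).

Lemma act_invK g x : act g^-1%g (act g x) = x.
Proof. by rewrite -(ba_mul aS) mulVg (ba_one aS). Qed.

Lemma continuous_insert m (s : 'rV[R]_k) (y : 'rV[R]_m) :
  {for y, continuous (fun z => row_mx z s)}.
Proof.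
apply: smooth_rV_continuous; apply: (@smooth_row_mx _ _ _ _ id).
  exact: smooth_rV_id.
exact: smooth_rV_cst.
Qed.

Lemma continuous_lsubmx_rV m p (z : 'rV[R]_(m + p)) :
  {for z, continuous (@lsubmx R 1 m p)}.
Proof. exact: smooth_rV_continuous (smooth_lsubmx z). Qed.

Lemma continuous_rsubmx_rV m p (z : 'rV[R]_(m + p)) :
  {for z, continuous (@rsubmx R 1 m p)}.
Proof. exact: smooth_rV_continuous (smooth_rsubmx z). Qed.

Lemma near_lsubmx m p (a : 'rV[R]_m) (b : 'rV[R]_p) (P : set 'rV[R]_m) :
  nbhs a P -> \forall z \near row_mx a b, P (lsubmx z).
Proof.
by move=> aP; apply: (continuous_lsubmx_rV (z := row_mx a b)); rewrite row_mxKl.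
Qed.

Lemma near_rsubmx m p (a : 'rV[R]_m) (b : 'rV[R]_p) (P : set 'rV[R]_p) :
  nbhs b P -> \forall z \near row_mx a b, P (rsubmx z).
Proof.
by move=> aP; apply: (continuous_rsubmx_rV (z := row_mx a b)); rewrite row_mxKr.
Qed.

Lemma act_near c c' g x : bcharts c -> bcharts c' -> dom c x -> dom c' (act g x) ->
  \forall y \near coord c x, dom c' (act g (param c y)).
Proof.
move=> bc bc' dx dgx; have [cG AG dg] := group_chart g.
have near_dom := near_comp (@continuous_insert _ (coord cG g) (coord c x))
  (ba_near aS AG bc bc' dg dx dgx).
by apply: filterS near_dom => y /=; rewrite row_mxKr row_mxKl group_paramK.
Qed.

Definition act_in c c' g : 'rV[R]_n.+1 -> 'rV[R]_n.+1 := coord c' \o act g \o param c.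

Lemma family_slice cG c c' g : @lg_atlas R k G cG -> dom cG g ->
  (fun y => family act cG c c' (row_mx y (coord cG g))) = act_in c c' g.
Proof.
move=> AG dg; apply/funext => y.
by rewrite /family row_mxKl row_mxKr group_paramK.
Qed.

Lemma act_b_map c c' g x : bcharts c -> bcharts c' -> dom c x -> dom c' (act g x) ->
  b_map_at (act_in c c' g) (coord c x).
Proof.
move=> bc bc' dx dgx; have [cG AG dg] := group_chart g.
have := ba_map aS AG bc bc' dg dx dgx.
by move=> /(@b_map_slice _ n k n); rewrite family_slice.
Qed.

Definition act_jacobian c c' g x := b_jacobian (act_in c c' g) (coord c x).

(** Displays the b-Jacobian at fixed [g] as a block of the joint one, and thereby its smooth
    dependence on [g]. *)
Lemma act_jacobian_family cG c c' g x : @lg_atlas R k G cG ->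
  bcharts c -> bcharts c' -> dom cG g -> dom c x -> dom c' (act g x) ->
  act_jacobian c c' g x = @usubmx _ n.+1 k _
    (@b_jacobian R (n + k) n (family act cG c c') (row_mx (coord c x) (coord cG g))).
Proof.
move=> AG bc bc' dg dx dgx; have := ba_map aS AG bc bc' dg dx dgx.
move=> /(@b_jacobian_slice _ n k n) <-.
by rewrite family_slice.
Qed.

Lemma act_jacobian1 c c' x : act_jacobian c c' 1%g x = transition c c' x.
Proof.
rewrite /act_jacobian /transition; congr (b_jacobian _ _).
by apply/funext => y; rewrite /act_in /= (ba_one aS).
Qed.

Lemma act_jacobianM c c' c'' g h x : bcharts c -> bcharts c' -> bcharts c'' ->
  dom c x -> dom c' (act g x) -> dom c'' (act h (act g x)) ->
  act_jacobian c c' g x *m act_jacobian c' c'' h (act g x) =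
  act_jacobian c c'' (h * g)%g x.
Proof.
move=> bc bc' bc'' dx dgx dhgx.
have gxE : act_in c c' g (coord c x) = coord c' (act g x).
  by rewrite /act_in /= (cb_param cS).
have bh : b_map_at (act_in c' c'' h) (act_in c c' g (coord c x)).
  by rewrite gxE; exact: act_b_map.
rewrite /act_jacobian -gxE -b_jacobian_comp//; last exact: act_b_map.
apply: b_jacobian_near_eq; last by apply: b_map_comp; [exact: act_b_map|].
apply: filterS (act_near bc bc' dx dgx) => y dy.
by rewrite /act_in /= (cb_param cS)// (ba_mul aS).
Qed.

Lemma act_jacobian_trans c c' c'' g h x y : act g x = y ->
  bcharts c -> bcharts c' -> bcharts c'' ->
  dom c x -> dom c' y -> dom c'' (act h y) ->
  act_jacobian c c' g x *m act_jacobian c' c'' h y = act_jacobian c c'' (h * g)%g x.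
Proof. by move=> <-; exact: act_jacobianM. Qed.

Lemma act_jacobianV c c' g x : bcharts c -> bcharts c' ->
  dom c x -> dom c' (act g x) ->
  act_jacobian c c' g x *m act_jacobian c' c g^-1%g (act g x) = 1%:M.
Proof.
move=> bc bc' dx dgx; rewrite act_jacobianM ?act_invK// mulVg act_jacobian1.
exact: transition_id.
Qed.

(** The lift involves g^-1, whose coordinates would call for another chart of the group; inverting
    the matrix keeps everything in the coordinates of g. *)
Lemma act_jacobian_inv c c' g x : bcharts c -> bcharts c' ->
  dom c x -> dom c' (act g x) ->
  act_jacobian c' c g^-1%g (act g x) = invmx (act_jacobian c c' g x).
Proof.
move=> bc bc' dx dgx; have J1 := act_jacobianV bc bc' dx dgx.
have [uJ _] := mulmx1_unit J1.
by rewrite -[LHS](mulKmx uJ) J1 mulmx1.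
Qed.

Lemma b_diffE g x : b_diff (act g) x = act_jacobian (bchart_at x) (bchart_at (act g x)) g x.
Proof. by []. Qed.

Lemma smooth_map_of_b_action :
  smooth_map (atlas_prod (@lg_atlas R k G) (@bcharts R S)) (@bcharts R S)
    (fun gx => act gx.1 gx.2).
Proof.
move=> _ c' [[cG c] [/= AG bc] <-] bc'.
(* [chart_prod] lists the coordinates of the group first, [family] lists them last. *)
pose sw (z : 'rV[R]_(k + n.+1)) := row_mx (rsubmx z) (lsubmx z).
have ssw z : smooth_rV_at sw z.
  by apply: smooth_row_mx; [exact: smooth_rsubmx|exact: smooth_lsubmx].
have imgP z : img (chart_prod cG c) z -> exists g x, [/\ dom cG g, dom c x,
    lsubmx z = coord cG g & rsubmx z = coord c x].
  by move=> [[g x] /= [dg dx] <-]; exists g, x; rewrite row_mxKl row_mxKr.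
have actE z g x : dom cG g -> dom c x -> lsubmx z = coord cG g -> rsubmx z = coord c x ->
    act (param (chart_prod cG c) z).1 (param (chart_prod cG c) z).2 = act g x.
  by move=> dg dx /= -> ->; rewrite (cb_param cS)// group_paramK.
have swE z g x : lsubmx z = coord cG g -> rsubmx z = coord c x ->
    sw z = row_mx (coord c x) (coord cG g).
  by rewrite /sw => -> ->.
split.
  rewrite openE => z [iz dz]; have [g [x [dg dx zg zx]]] := imgP _ iz.
  rewrite (actE z g x)// in dz.
  have := ba_near aS AG bc bc' dg dx dz; rewrite -(swE z)//.
  move=> /(near_comp (smooth_rV_continuous (ssw z))) near_dom.
  have near_g : \forall w \near z, img cG (lsubmx w).
    by apply: (continuous_lsubmx_rV (z := z)); rewrite zg; exact: group_near_img.
  have near_x : \forall w \near z, img c (rsubmx w).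
    by apply: (continuous_rsubmx_rV (z := z)); rewrite zx; exact: near_img.
  rewrite /interior; apply: filterS3 near_dom near_g near_x => w /= dw [g' dg' gw] [x' dx' xw].
  split; last by move: dw; rewrite /sw row_mxKl row_mxKr.
  exists (g', x') => //=.
  by rewrite gw xw hsubmxK.
apply: smooth_on_at => z [iz dz]; have [g [x [dg dx zg zx]]] := imgP _ iz.
rewrite (actE z g x)// in dz.
have -> : coord c' \o (fun gx : G * S => act gx.1 gx.2) \o param (chart_prod cG c) =
    family act cG c c' \o sw.
  by apply/funext => w; rewrite /family /sw /= row_mxKl row_mxKr.
apply: smooth_rV_comp; first exact: ssw.
by rewrite (swE z g x)//; exact: (b_map_smooth (ba_map aS AG bc bc' dg dx dz)).
Qed.

End BActions.

(** * The lifted action on the b-cotangent bundle *)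

Section LiftedAction.
Context {R : realType} {k : nat} {G : lie_group R k} {S : b_space R}.
Variable act : G -> S -> S.
Hypothesis (cS : compatible_b_charts S) (aS : b_action act).
Local Notation n := (bdim S).
Local Notation E := (b_cotangent S).
Implicit Types (c : chart R S n.+1) (x : S) (g h : G) (p : E).

Local Notation act_hat := (@cotangent_lift R k G S act).
Local Notation J := (act_jacobian act).

Lemma cotangent_liftE g p : act_hat g p = (act g p.1,
  p.2 *m (J (bchart_at (act g p.1)) (bchart_at p.1) g^-1%g (act g p.1))^T).
Proof. by rewrite /cotangent_lift b_diffE /b_proj (act_invK aS). Qed.

Lemma cotangent_lift_one p : act_hat 1%g p = p.
Proof.
have [bx dx] := cb_at cS p.1.
rewrite cotangent_liftE (ba_one aS) invg1 (act_jacobian1 aS).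
by rewrite (transition_id cS)// trmx1 mulmx1 -surjective_pairing.
Qed.

Lemma cotangent_lift_mul g h p : act_hat (g * h)%g p = act_hat g (act_hat h p).
Proof.
rewrite !cotangent_liftE /= (ba_mul aS); set x := p.1.
have [bx dx] := cb_at cS x; have [bh dh] := cb_at cS (act h x).
have [bg dg] := cb_at cS (act g (act h x)).
have JJ := @act_jacobian_trans _ _ _ _ _ cS aS _ (bchart_at (act h x)) (bchart_at x)
  g^-1%g h^-1%g _ _ (act_invK aS g (act h x)) bg bh bx dg dh.
rewrite -mulmxA -trmx_mul invgM -JJ; first by [].
by rewrite (act_invK aS).
Qed.

(* Coordinates ((x, p), s) on b_cotangent x G, projected to (x, s). *)
Definition forget_fibre (z : 'rV[R]_(n.+1 + n.+1 + k)) : 'rV[R]_(n.+1 + k) :=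
  row_mx (lsubmx (lsubmx z)) (rsubmx z).

Lemma b_map_forget_fibre z : @b_map_at R (n + n.+1 + k) (n + k) forget_fibre z.
Proof.
apply: (@b_map_row_mx _ (n + n.+1 + k) n k (lsubmx \o @lsubmx R 1 (n.+1 + n.+1) k)).
  apply: (@b_map_comp _ (n + n.+1 + k) (n + n.+1) n); last exact: b_map_lsubmx.
  exact: (@b_map_lsubmx _ (n + n.+1) k).
exact: (@smooth_rsubmx _ (n.+1 + n.+1) k).
Qed.

(** Composing with [forget_fibre] leaves derivatives in the group directions unchanged, so
    velocities upstairs can be compared with those downstairs. *)
Lemma dsubmx_forget_fibre z : @dsubmx _ (n.+1 + n.+1) k _
  (@b_jacobian R (n + n.+1 + k) (n + k) forget_fibre z) = (row_mx 0 1%:M : 'M[R]_(k, n.+1 + k)).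
Proof.
rewrite (@b_jacobian_row_mx _ (n + n.+1 + k) n k
  (lsubmx \o @lsubmx R 1 (n.+1 + n.+1) k) (@rsubmx R 1 (n.+1 + n.+1) k)).
rewrite (@b_gradient_rsubmx _ (n + n.+1) k).
rewrite (@b_jacobian_comp _ (n + n.+1 + k) (n + n.+1) n (@lsubmx R 1 (n.+1 + n.+1) k)
  (@lsubmx R 1 n.+1 n.+1)); last 2 first.
- exact: (@b_map_lsubmx _ (n + n.+1) k).
- exact: b_map_lsubmx.
rewrite (@b_jacobian_lsubmx _ (n + n.+1) k) (@b_jacobian_lsubmx _ n n.+1).
rewrite (@mul_col_mx _ (n.+1 + n.+1) k) mul0mx.
rewrite -(@block_mxEh _ (n.+1 + n.+1) k n.+1 k) (@block_mxEv _ (n.+1 + n.+1) k n.+1 k).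
by rewrite (@col_mxKd _ (n.+1 + n.+1) k).
Qed.

Section Family.
Variables (cG : chart R G k) (c c' : chart R S n.+1).
Hypotheses (AG : @lg_atlas R k G cG) (bc : bcharts c) (bc' : bcharts c').

Definition family_jacobian (z : 'rV[R]_(n.+1 + k)) : 'M[R]_(n.+1 + k, n.+1) :=
  @b_jacobian R (n + k) n (family act cG c c') z.

Definition fibre_family (z : 'rV[R]_(n.+1 + n.+1 + k)) : 'rV[R]_n.+1 :=
  rsubmx (lsubmx z) *m (invmx (usubmx (family_jacobian (forget_fibre z))))^T.

Lemma lift_familyE g x (q : 'rV[R]_n.+1) :
  dom cG g -> dom c x -> dom c' (act g x) ->
  family act_hat cG (cotangent_chart c) (cotangent_chart c')
    (row_mx (row_mx (coord c x) q) (coord cG g)) =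
  row_mx (coord c' (act g x)) (q *m (invmx (usubmx (family_jacobian
    (row_mx (coord c x) (coord cG g)))))^T).
Proof.
move=> dg dx dgx; rewrite /family row_mxKl row_mxKr cotangent_param row_mxKl row_mxKr.
rewrite (cb_param cS bc dx) (group_paramK AG dg) cotangent_liftE /= covector_inE.
have [bx dx'] := cb_at cS x; have [bgx dgx'] := cb_at cS (act g x).
have -> : invmx (usubmx (family_jacobian (row_mx (coord c x) (coord cG g)))) =
    J c' c g^-1%g (act g x).
  rewrite (act_jacobian_inv cS aS bc bc' dx dgx).
  by rewrite (act_jacobian_family aS AG bc bc' dg dx dgx).
have dx'' : dom (bchart_at x) (act g^-1%g (act g x)) by rewrite (act_invK aS).
have dcx : dom c (act 1%g x) by rewrite (ba_one aS).
(* Changes of charts are actions of the unit: the Jacobian of g^-1 from [c'] to [c] is factored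
   through the preferred charts at [act g x] and at [x]. *)
have J1 := @act_jacobian_trans _ _ _ _ _ cS aS c' _ _ 1%g g^-1%g _ _
  (ba_one aS _) bc' bgx bx dgx dgx' dx''.
have J2 := @act_jacobian_trans _ _ _ _ _ cS aS c' _ c g^-1%g 1%g _ _
  (act_invK aS g x) bc' bx bc dgx dx' dcx.
rewrite mulg1 (act_jacobian1 aS) in J1; rewrite mul1g (act_jacobian1 aS) in J2.
by rewrite -J2 -J1 !trmx_mul !mulmxA.
Qed.

Lemma near_lift_family g x (q : 'rV[R]_n.+1) :
  dom cG g -> dom c x -> dom c' (act g x) ->
  \forall z \near row_mx (row_mx (coord c x) q) (coord cG g),
    dom c' (act (param cG (rsubmx z)) (param c (lsubmx (lsubmx z)))) /\
    family act_hat cG (cotangent_chart c) (cotangent_chart c') z =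
    row_mx (family act cG c c' (forget_fibre z)) (fibre_family z).
Proof.
move=> dg dx dgx; have near_x := near_lsubmx (coord cG g) (near_lsubmx q (near_img cS bc dx)).
have near_g := near_rsubmx (row_mx (coord c x) q) (group_near_img AG dg).
have cf : {for row_mx (row_mx (coord c x) q) (coord cG g), continuous forget_fibre}.
  exact: smooth_rV_continuous (b_map_smooth (b_map_forget_fibre _)).
have := ba_near aS AG bc bc' dg dx dgx.
have -> : row_mx (coord c x) (coord cG g) =
    forget_fibre (row_mx (row_mx (coord c x) q) (coord cG g)).
  by rewrite /forget_fibre !row_mxKl row_mxKr.
move=> /(near_comp cf) near_dom.
apply: filterS3 near_x near_g near_dom => z ix ig /=.
rewrite /forget_fibre row_mxKl row_mxKr => dz; split=> //.
have [dx' xE] := img_param cS bc ix; have [dg' gE] := group_img_param AG ig.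
have := @lift_familyE _ _ (rsubmx (lsubmx z)) dg' dx' dz.
rewrite xE gE (@hsubmxK _ _ n.+1 n.+1) (@hsubmxK _ _ (n.+1 + n.+1) k) => zE.
apply: (etrans zE); by rewrite /fibre_family /forget_fibre /family row_mxKl row_mxKr.
Qed.

Lemma smooth_fibre_family g x (q : 'rV[R]_n.+1) :
  dom cG g -> dom c x -> dom c' (act g x) ->
  smooth_rV_at fibre_family (row_mx (row_mx (coord c x) q) (coord cG g)).
Proof.
move=> dg dx dgx; set z0 := row_mx _ _.
have fz0 : forget_fibre z0 = row_mx (coord c x) (coord cG g).
  by rewrite /forget_fibre !row_mxKl row_mxKr.
have sl : smooth_rV_at (fun z : 'rV[R]_(n.+1 + n.+1 + k) => rsubmx (lsubmx z)) z0.
  exact: (smooth_rV_comp (smooth_lsubmx z0) (smooth_rsubmx _)).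
apply: smooth_mulmx_tr => // i j; apply: smooth_invmx => [a b|].
  have sJ : smooth_at (fun w => family_jacobian w (lshift k a) b) (forget_fibre z0).
    rewrite fz0; apply: (@smooth_b_jacobian R (n + k) n).
    exact: (ba_map aS AG bc bc' dg dx dgx).
  have := smooth_comp (b_map_smooth (b_map_forget_fibre z0)) sJ.
  by apply: smooth_near_eq; apply: filterE => z; rewrite mxE.
rewrite fz0 -(act_jacobian_family aS AG bc bc' dg dx dgx).
by have [] := mulmx1_unit (act_jacobianV cS aS bc bc' dx dgx).
Qed.

End Family.

Lemma b_action_lift : b_action act_hat.
Proof.
split.
- exact: cotangent_lift_one.
- exact: cotangent_lift_mul.
- move=> cG _ _ g p AG [c bc <-] [c' bc' <-] dg dp dgp.
  have {}dp : dom c p.1 := dp; have {}dgp : dom c' (act g p.1) := dgp.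
  have nf := near_lift_family AG bc bc' (covector_in c p.1 p.2) dg dp dgp.
  by apply: filterS nf => z [].
- move=> cG _ _ g p AG [c bc <-] [c' bc' <-] dg dp dgp.
  have {}dp : dom c p.1 := dp; have {}dgp : dom c' (act g p.1) := dgp.
  set z0 := row_mx _ _.
  have fz0 : forget_fibre z0 = row_mx (coord c p.1) (coord cG g).
    by rewrite /forget_fibre /z0 !row_mxKl row_mxKr.
  have bfam : @b_map_at R (n + k) n (family act cG c c') (forget_fibre z0).
    by rewrite fz0; exact: (ba_map aS AG bc bc' dg dp dgp).
  have bF := @b_map_row_mx R (n + n.+1 + k) n n.+1
    (family act cG c c' \o forget_fibre) (fibre_family cG c c') z0
    (@b_map_comp R (n + n.+1 + k) (n + k) n _ _ z0 (b_map_forget_fibre z0) bfam)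
    (smooth_fibre_family AG bc bc' (covector_in c p.1 p.2) dg dp dgp).
  apply: (@b_map_near_eq R (n + n.+1 + k) (n + n.+1) _ _ z0 _ bF).
  have nf := near_lift_family AG bc bc' (covector_in c p.1 p.2) dg dp dgp.
  by apply: filterS nf => z [_ zE]; exact: esym zE.
Qed.

End LiftedAction.

(** * Fundamental vector fields *)

Section DirectionalDerivatives.
Context {R : realType}.

Lemma derive_linear_arg m p (W : normedModType R) (L : {linear 'rV[R]_m -> 'rV[R]_p})
    (f : 'rV[R]_p -> W) v y : 'D_v (f \o L) y = 'D_(L v) f (L y).
Proof.
rewrite /derive; set F := (fun h : R => _); set H := (fun h : R => _).
suff -> : F = H by [].
apply/funext => h; rewrite /F /H /=.
have LE : L (h *: v + y) = h *: L v + L y by exact: linearP.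
by rewrite LE.
Qed.

Lemma partial_rsubmx m p (f : 'rV[R]_p -> R) a (z : 'rV[R]_(m + p)) :
  partial (rshift m a) (fun z => f (rsubmx z)) z = partial a f (rsubmx z).
Proof.
rewrite /partial (derive_linear_arg (@rsubmx R 1 m p) f).
congr ('D_ _ f _); apply/rowP => b.
by rewrite !mxE (inj_eq (@rshift_inj _ _)).
Qed.

Lemma derive_slice m p (W : normedModType R) (f : 'rV[R]_(m + p) -> W) y s v :
  'D_v (fun s => f (row_mx y s)) s = 'D_(row_mx 0 v) f (row_mx y s).
Proof.
rewrite /derive; set F := (fun h : R => _); set H := (fun h : R => _).
suff -> : F = H by [].
apply/funext => h; rewrite /F /H /= scale_row_mx add_row_mx scaler0 add0r.
by [].
Qed.

Lemma derive_jacobian_comp m p q (F : 'rV[R]_m -> 'rV[R]_p) (H : 'rV[R]_p -> 'rV[R]_q) y v :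
  differentiable F y -> differentiable H (F y) ->
  'D_v (H \o F) y = 'D_v F y *m jacobian H (F y).
Proof.
move=> dF dH; rewrite (deriveE v (differentiable_comp dF dH)) diff_comp//=.
by rewrite -(deriveE v dF) -(deriveE _ dH) deriveEjacobian.
Qed.

Lemma derive_row_mx0 m p (f : 'rV[R]_(m + p) -> R) (v : 'rV[R]_p) y :
  differentiable f y -> 'D_(row_mx 0 v) f y = \sum_a v 0 a * partial (rshift m a) f y.
Proof.
move=> df; rewrite derive_partial// big_split_ord/= big1 ?add0r => [|i _].
  by apply: eq_bigr => a _; rewrite row_mxEr.
by rewrite row_mxEl mxE mul0r.
Qed.

End DirectionalDerivatives.

Section FundamentalFields.
Context {R : realType} {k : nat} {G : lie_group R k} {S : b_space R}.
Variables (act : G -> S -> S) (e : chart R G k).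
Hypothesis (cS : compatible_b_charts S) (aS : b_action act).
Hypothesis (Ae : @lg_atlas R k G e) (e1 : dom e 1%g).
Local Notation n := (bdim S).
Implicit Types (c : chart R S n.+1) (x : S) (g h : G) (X : 'rV[R]_k).

Definition unit_at (y : 'rV[R]_n.+1) : 'rV[R]_(n.+1 + k) := row_mx y (coord e 1%g).

(** Its rows are the b-components, in the chart [c], of the fundamental fields of the frame vectors
    of the Lie algebra. *)
Definition velocity c x : 'M[R]_(k, n.+1) := @dsubmx _ n.+1 k _
  (@b_jacobian R (n + k) n (family act e c c) (unit_at (coord c x))).

Lemma family_b_map c x : bcharts c -> dom c x ->
  @b_map_at R (n + k) n (family act e c c) (unit_at (coord c x)).
Proof. by move=> bc dx; apply: (ba_map aS Ae bc bc e1 dx); rewrite (ba_one aS). Qed.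

Lemma family_unit c y : bcharts c -> img c y -> family act e c c (unit_at y) = y.
Proof.
move=> bc iy; rewrite /family /unit_at row_mxKl row_mxKr group_paramK//.
by rewrite (ba_one aS); have [] := img_param cS bc iy.
Qed.

Lemma family_unit_jacobian c x : bcharts c -> dom c x -> @usubmx _ n.+1 k _
  (@b_jacobian R (n + k) n (family act e c c) (unit_at (coord c x))) = 1%:M.
Proof.
move=> bc dx; have d1x : dom c (act 1%g x) by rewrite (ba_one aS).
rewrite /unit_at -(act_jacobian_family aS Ae bc bc e1 dx d1x).
by rewrite (act_jacobian1 aS) transition_id.
Qed.

Definition orbit_in c x (s : 'rV[R]_k) : 'rV[R]_n.+1 := coord c (act (param e s) x).

Lemma orbit_family c c' x : bcharts c -> dom c x ->
  orbit_in c' x = (fun s => family act e c c' (row_mx (coord c x) s)).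
Proof.
move=> bc dx; apply/funext => s.
by rewrite /family row_mxKl row_mxKr (cb_param cS).
Qed.

Lemma smooth_orbit c x : bcharts c -> dom c x -> smooth_rV_at (orbit_in c x) (coord e 1%g).
Proof.
move=> bc dx; rewrite (orbit_family c bc dx).
apply: (@smooth_rV_comp _ _ _ _ (fun s => row_mx (coord c x) s)).
  by apply: smooth_row_mx; [exact: smooth_rV_cst|exact: smooth_rV_id].
exact: (b_map_smooth (family_b_map bc dx)).
Qed.

Lemma fundamental_fieldE X x :
  fundamental_field e act X x = 'D_X (orbit_in (bchart_at x) x) (coord e 1%g).
Proof.
have [bx dx] := cb_at cS x; rewrite deriveEjacobian//.
exact: smooth_rV_differentiable (smooth_orbit bx dx).
Qed.

(** [vf_in] passes through the preferred chart at each point; by the chain rule for ordinary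
    Jacobians, the field is the derivative of one map, [family], in the fixed chart. *)
Lemma vf_in_fundamental X c y : bcharts c -> img c y ->
  vf_in (fundamental_field e act X) c y =
  'D_(row_mx 0 X) (family act e c c) (unit_at y).
Proof.
move=> bc iy; have [dx yE] := img_param cS bc iy.
rewrite /vf_in; set x := param c y in dx yE *.
have [bx dx'] := cb_at cS x.
rewrite fundamental_fieldE.
have oE : orbit_in (bchart_at x) x (coord e 1%g) = bcoord x.
  by rewrite /orbit_in group_paramK// (ba_one aS).
have dT := smooth_rV_differentiable (b_map_smooth (cb_map cS bx bc dx' dx)).
rewrite /bcoord -[coord (bchart_at x) x]oE -derive_jacobian_comp; last 2 first.
- exact: smooth_rV_differentiable (smooth_orbit bx dx').
- by rewrite oE.
rewrite /unit_at -derive_slice -{1}yE -(orbit_family c bc dx).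
apply: near_eq_derive.
have so := smooth_rV_continuous (smooth_orbit bx dx').
rewrite (orbit_family _ bx dx') in so *.
have d1x : dom (bchart_at x) (act 1%g x) by rewrite (ba_one aS).
have cins : {for coord e 1%g, continuous (fun s : 'rV[R]_k => row_mx (bcoord x) s)}.
  apply: smooth_rV_continuous; apply: smooth_row_mx; first exact: smooth_rV_cst.
  exact: smooth_rV_id.
have := near_comp cins (ba_near aS Ae bx bx e1 dx' d1x).
apply: filterS => s; rewrite row_mxKl row_mxKr /bcoord (cb_param cS)// => ds.
by rewrite /= /family row_mxKl row_mxKr (cb_param cS bx dx') (cb_param cS bx ds).
Qed.

(** The unit acts as the identity, so x_1 u = x_1; on the hyperplane u = 1 follows by continuity.
    Logarithmic derivatives of [u] at the unit are thus plain derivatives. *)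
Lemma family_factor c x : bcharts c -> dom c x -> exists u,
  @b_map_with R (n + k) n (family act e c c) u (unit_at (coord c x)) /\
  u (unit_at (coord c x)) = 1.
Proof.
move=> bc dx; have [u Fu] := family_b_map bc dx; exists u; split=> //.
have [_ su _ F0] := Fu.
have cins := @continuous_insert R k _ (coord e 1%g) (coord c x).
apply: (@eq_on_hyperplane _ _ (fun y => u (unit_at y)) (fun=> 1)).
- exact: (continuous_comp cins (smooth_continuous su)).
- exact: cst_continuous.
apply: filterS2 (near_img cS bc dx) (near_comp cins F0) => y iy /= Fy y0.
apply: (mulfI y0); rewrite mulr1 -[RHS](congr1 (fun v : 'rV_n.+1 => v 0 0) (family_unit bc iy)).
by rewrite [RHS]Fy -lsubmx00 row_mxKl.
Qed.

(** In x_1 u only [u] depends on the group coordinates to first order. The factor x_1 that remains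
    is the tangency of the fundamental field to the hypersurface. *)
Lemma derive_family0 c x u X :
  @b_map_with R (n + k) n (family act e c c) u (unit_at (coord c x)) ->
  \forall y \near coord c x, ('D_(row_mx 0 X) (family act e c c) (unit_at y)) 0 0 =
    y 0 0 * \sum_a X 0 a * partial (rshift n.+1 a) u (unit_at y).
Proof.
move=> Fu; have cins := @continuous_insert R k _ (coord e 1%g) (coord c x).
apply: filterS (near_comp cins (b_map_with_near Fu)) => y [sF su u0 F0].
rewrite derive_rV; last exact: smooth_rV_differentiable.
rewrite (near_eq_derive _ F0).
have sz : smooth_at (fun z : 'rV[R]_(n + k).+1 => z 0 0) (unit_at y) by exact: smooth_coord.
have szu := smoothM sz su.
rewrite (@derive_row_mx0 _ n.+1 k); last exact: smooth_differentiable szu.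
rewrite mulr_sumr; apply: eq_bigr => a _.
rewrite partialM; [|exact: smooth_differentiable sz|exact: smooth_differentiable su].
rewrite partial_coord rshift_eq0 mul0r add0r mulrCA; congr (_ * (_ * _)).
by rewrite -lsubmx00 row_mxKl.
Qed.

(** In component 0 both sides are the derivative of [u] along [X]: on the left as the field's first
    component divided by x_1, on the right as a derivative of log u where u = 1. *)
Lemma b_section_fundamental X x :
  b_section (fundamental_field e act X) x = X *m velocity (bchart_at x) x.
Proof.
have [bx dx] := cb_at cS x; set c := bchart_at x in bx dx *.
have [u [Fu u1]] := family_factor bx dx; have [sF su u0 F0] := Fu.
apply/rowP => j; rewrite [LHS]mxE [RHS]mxE; case: eqVneq => [->|j0].
  have cins := @continuous_insert R k _ (coord e 1%g) (coord c x).
  have sg : {for bcoord x, continuous (fun y =>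
      \sum_a X 0 a * partial (rshift n.+1 a) u (unit_at y))}.
    have := @smooth_sum R (n + k).+1 'I_k (index_enum 'I_k) xpredT
      (fun a z => X 0 a * partial (rshift n.+1 a) u z) (unit_at (coord c x))
      (fun a _ => smoothM (smooth_cst _ _) (smooth_partial _ su)).
    by move=> /smooth_continuous/(continuous_comp cins).
  rewrite (@b_extendE _ _ _ (fun y =>
      \sum_a X 0 a * partial (rshift n.+1 a) u (unit_at y)))//; last first.
    apply: filterS2 (near_img cS bx dx) (derive_family0 X Fu) => y iy Dy y0.
    by rewrite vf_in_fundamental// Dy mulrC mulKf.
  apply: eq_bigr => a _; rewrite mxE (b_jacobian0 _ Fu) rshift_eq0 u1.
  by rewrite add0r divr1 b_partialE /b_weight rshift_eq0 mul1r.
rewrite fundamental_fieldE -/c (orbit_family _ bx dx).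
rewrite derive_slice derive_rV; last exact: smooth_rV_differentiable.
rewrite derive_row_mx0; last exact: smooth_differentiable (sF j).
apply: eq_bigr => a _; rewrite mxE b_jacobianS// b_partialE /b_weight.
by rewrite rshift_eq0 mul1r.
Qed.

Lemma b_vector_field_fundamental X : b_vector_field (fundamental_field e act X).
Proof.
move=> c bc; split.
  apply: smooth_on_at => _ [x dx <-] j; have bF := family_b_map bc dx.
  have sD := @smooth_derive _ (n.+1 + k) _ (row_mx 0 X) _ (b_map_smooth bF j).
  have sins : smooth_rV_at unit_at (coord c x).
    by apply: (@smooth_row_mx _ _ _ _ id); [exact: smooth_rV_id|exact: smooth_rV_cst].
  apply: smooth_near_eq (smooth_comp sins sD).
  have cins := @continuous_insert R k _ (coord e 1%g) (coord c x).
  apply: filterS2 (near_img cS bc dx) (near_comp cins (b_map_near bF)) => y iy by_ /=.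
  rewrite vf_in_fundamental// derive_rV//.
  exact: smooth_rV_differentiable (b_map_smooth by_).
move=> _ [x dx <-] x0; have [u [Fu _]] := family_factor bc dx.
rewrite vf_in_fundamental//; last exact: img_coord.
by rewrite (nbhs_singleton (derive_family0 X Fu)) x0 mul0r.
Qed.

End FundamentalFields.

(** * Equivariance of the fundamental fields *)

Section Conjugation.
Context {R : realType} {k : nat} {G : lie_group R k}.
Implicit Types (c : chart R G k) (g h : G).

Lemma group_mul_at cg ch c g h : @lg_atlas R k G cg -> @lg_atlas R k G ch ->
  @lg_atlas R k G c -> dom cg g -> dom ch h -> dom c (g * h)%g ->
  (\forall z \near row_mx (coord cg g) (coord ch h),
     dom c (param cg (lsubmx z) * param ch (rsubmx z))%g) /\
  smooth_rV_at (fun z => coord c (param cg (lsubmx z) * param ch (rsubmx z))%g)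
    (row_mx (coord cg g) (coord ch h)).
Proof.
move=> Ag Ah Ac dg dh dgh.
have [|oU sU] := @lg_mul R k G (chart_prod cg ch) c _ Ac; first by exists (cg, ch).
set U := [set y | _] in oU sU.
have U0 : U (row_mx (coord cg g) (coord ch h)).
  split; first by exists (g, h).
  by rewrite /= row_mxKl row_mxKr !group_paramK.
have nU := open_nbhs_nbhs (conj oU U0).
split; first by apply: filterS nU => z [].
exact: (proj1 (smooth_onP _ oU) sU _ U0).
Qed.

Lemma group_mull_at ch c g h : @lg_atlas R k G ch -> @lg_atlas R k G c ->
  dom ch h -> dom c (g * h)%g ->
  (\forall s \near coord ch h, dom c (g * param ch s)%g) /\
  smooth_rV_at (fun s => coord c (g * param ch s)%g) (coord ch h).
Proof.
move=> Ah Ac dh dgh; have [cg Ag dg] := group_chart g.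
have [nd sm] := group_mul_at Ag Ah Ac dg dh dgh.
have sins : smooth_rV_at (fun s : 'rV[R]_k => row_mx (coord cg g) s) (coord ch h).
  by apply: smooth_row_mx; [exact: smooth_rV_cst|exact: smooth_rV_id].
split.
  apply: filterS (near_comp (smooth_rV_continuous sins) nd) => s.
  by rewrite row_mxKl row_mxKr group_paramK.
apply: smooth_rV_near_eq (smooth_rV_comp sins sm).
by apply: filterE => s; rewrite /= row_mxKl row_mxKr group_paramK.
Qed.

Lemma group_mulr_at cg c g h : @lg_atlas R k G cg -> @lg_atlas R k G c ->
  dom cg g -> dom c (g * h)%g ->
  (\forall s \near coord cg g, dom c (param cg s * h)%g) /\
  smooth_rV_at (fun s => coord c (param cg s * h)%g) (coord cg g).
Proof.
move=> Ag Ac dg dgh; have [ch Ah dh] := group_chart h.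
have [nd sm] := group_mul_at Ag Ah Ac dg dh dgh.
have sins : smooth_rV_at (fun s : 'rV[R]_k => row_mx s (coord ch h)) (coord cg g).
  by apply: smooth_row_mx; [exact: smooth_rV_id|exact: smooth_rV_cst].
split.
  apply: filterS (near_comp (smooth_rV_continuous sins) nd) => s.
  by rewrite row_mxKl row_mxKr group_paramK.
apply: smooth_rV_near_eq (smooth_rV_comp sins sm).
by apply: filterE => s; rewrite /= row_mxKl row_mxKr group_paramK.
Qed.

(** Conjugation is split into a left and a right translation joined by a chart around g, a point
    that [e] need not contain. *)
Lemma conjugation_at e g : @lg_atlas R k G e -> dom e 1%g ->
  (\forall s \near coord e 1%g, dom e (g * param e s * g^-1)%g) /\
  smooth_rV_at (coord e \o (fun h => g * h * g^-1)%g \o param e) (coord e 1%g).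
Proof.
move=> Ae e1; have [c Ac dg] := group_chart (g * 1)%g.
have dg1 : dom e (g * 1 * g^-1)%g by rewrite mulg1 mulgV.
have [nl sl] := group_mull_at Ae Ac e1 dg.
have [nr sr] := group_mulr_at Ac Ae dg dg1.
have g1E : coord c (g * param e (coord e 1))%g = coord c (g * 1)%g.
  by rewrite group_paramK.
have nr' := near_comp (smooth_rV_continuous sl).
rewrite g1E in nr'.
split.
  by apply: filterS2 nl (nr' _ nr) => s ds; rewrite group_paramK.
have sc := @smooth_rV_comp _ _ _ _ _ _ (coord e 1%g) sl; rewrite g1E in sc.
apply: smooth_rV_near_eq (sc _ _ sr).
by apply: filterS nl => s ds; rewrite /= group_paramK.
Qed.

End Conjugation.

Section Equivariance.
Context {R : realType} {k : nat} {G : lie_group R k} {S : b_space R}.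
Variables (act : G -> S -> S) (e : chart R G k).
Hypothesis (cS : compatible_b_charts S) (aS : b_action act).
Hypothesis (Ae : @lg_atlas R k G e) (e1 : dom e 1%g).
Local Notation n := (bdim S).
Local Notation s1 := (coord e 1%g).
Implicit Types (c : chart R S n.+1) (x : S) (g h : G) (X : 'rV[R]_k).

Lemma dsubmx_mul p q (A : 'M[R]_(n.+1 + k, p)) (B : 'M[R]_(p, q)) :
  dsubmx (A *m B) = dsubmx A *m B.
Proof. by rewrite -{1}(vsubmxK A) mul_col_mx col_mxKd. Qed.

Lemma mul_row0 p (A : 'M[R]_k) (B : 'M[R]_(n.+1 + k, p)) :
  row_mx 0 A *m B = A *m dsubmx B.
Proof. by rewrite -{1}(vsubmxK B) mul_row_col mul0mx add0r. Qed.

(** Differentiate g^-1 (s (g x)) = (g^-1 s g) x in s at the unit. *)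
Lemma velocity_act c c' g x : bcharts c -> bcharts c' -> dom c x -> dom c' (act g x) ->
  velocity act e c' (act g x) *m act_jacobian act c' c g^-1%g (act g x) =
  Ad e g^-1%g *m velocity act e c x.
Proof.
move=> bc bc' dx dgx.
(* [P] is (x, s) |-> (g x, s), and [Q] is (x, s) |-> (x, g^-1 s g). *)
pose P (z : 'rV[R]_(n.+1 + k)) := row_mx (act_in act c c' g (lsubmx z)) (rsubmx z).
pose kap := coord e \o (fun h => g^-1 * h * g^-1^-1)%g \o param e.
pose Q (z : 'rV[R]_(n.+1 + k)) := row_mx (lsubmx z) (kap (rsubmx z)).
pose z0 : 'rV[R]_(n.+1 + k) := row_mx (coord c x) s1.
have [nconj sconj] := conjugation_at g^-1%g Ae e1.
have kap1 : kap s1 = s1 by rewrite /kap /= group_paramK// mulg1 mulgV.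
have bg : b_map_at (act_in act c c' g) (coord c x) by exact: (act_b_map aS bc bc' dx dgx).
have bgl : @b_map_at R (n + k) n (act_in act c c' g \o @lsubmx R 1 n.+1 k) z0.
  apply: (@b_map_comp _ (n + k) n n); first exact: b_map_lsubmx.
  by rewrite /z0 row_mxKl.
have bP : @b_map_at R (n + k) (n + k) P z0.
  by apply: (b_map_row_mx bgl); exact: (@smooth_rsubmx _ n.+1 k).
have sk : smooth_rV_at (kap \o @rsubmx R 1 n.+1 k) z0.
  apply: smooth_rV_comp; first exact: smooth_rsubmx.
  by rewrite /z0 row_mxKr.
have bQ : @b_map_at R (n + k) (n + k) Q z0.
  by apply: (@b_map_row_mx _ (n + k) n k (@lsubmx R 1 n.+1 k) _ z0); [exact: b_map_lsubmx|].
have gx : act_in act c c' g (coord c x) = coord c' (act g x).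
  by rewrite /act_in /= (cb_param cS).
have P0 : P z0 = unit_at e (coord c' (act g x)).
  by rewrite /P /z0 row_mxKl row_mxKr gx.
have Q0 : Q z0 = unit_at e (coord c x) by rewrite /Q /z0 row_mxKl row_mxKr kap1.
have bF' := family_b_map aS Ae e1 bc' dgx; rewrite -P0 in bF'.
have bF := family_b_map aS Ae e1 bc dx; rewrite -Q0 in bF.
have dggx : dom c (act g^-1%g (act g x)) by rewrite (act_invK aS).
have iy : img c' (coord c' (act g x)) by exact: img_coord.
have FP : family act e c' c' (P z0) = coord c' (act g x) by rewrite P0 (family_unit cS aS Ae e1).
have bFP := @b_map_comp _ (n + k) (n + k) n _ _ z0 bP bF'.
have binv : b_map_at (act_in act c' c g^-1%g) ((family act e c' c' \o P) z0).
  by rewrite /= FP; exact: (act_b_map aS bc' bc dgx dggx).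
have bFQ := @b_map_comp _ (n + k) (n + k) n _ _ z0 bQ bF.
have eqPQ : \forall z \near z0, (family act e c c \o Q) z =
    (act_in act c' c g^-1%g \o (family act e c' c' \o P)) z.
  have cP := smooth_rV_continuous (b_map_smooth bP).
  have d1 : dom c' (act 1%g (act g x)) by rewrite (ba_one aS).
  have nF : \forall w \near P z0, dom c' (act (param e (rsubmx w)) (param c' (lsubmx w))).
    by rewrite P0; exact: (ba_near aS Ae bc' bc' e1 dgx d1).
  have nP : \forall z \near z0, dom c' (act (param e (rsubmx (P z))) (param c' (lsubmx (P z)))).
    exact: (near_comp cP nF).
  have ny := near_lsubmx s1 (act_near aS bc bc' dx dgx).
  have ns := near_rsubmx (coord c x) nconj.
  apply: filterS3 nP ny ns => z; rewrite /P row_mxKl row_mxKr /act_in /= => dz dy ds.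
  rewrite /family /Q !row_mxKl !row_mxKr /kap /= (group_paramK Ae ds).
  rewrite (cb_param cS bc' dy) in dz *; rewrite (cb_param cS bc' dz).
  by rewrite !(ba_mul aS) invgK.
have JE := b_jacobian_near_eq eqPQ bFQ.
rewrite (@b_jacobian_comp _ (n + k) (n + k) n _ _ z0 bQ bF) in JE.
rewrite (@b_jacobian_comp _ (n + k) n n _ _ z0 bFP binv) in JE.
rewrite (@b_jacobian_comp _ (n + k) (n + k) n _ _ z0 bP bF') in JE.
(* Only the group rows are compared: they are (0 | 1) for [P] and (0 | Ad) for [Q], so just the
   velocity blocks survive. *)
have := congr1 (@dsubmx R n.+1 k n.+1) JE.
rewrite !dsubmx_mul /= FP.
have -> : @dsubmx _ n.+1 k _ (@b_jacobian R (n + k) (n + k) P z0) =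
    (row_mx 0 1%:M : 'M[R]_(k, n.+1 + k)).
  rewrite (@b_jacobian_row_mx _ (n + k) n k _ (@rsubmx R 1 n.+1 k)).
  rewrite (@b_gradient_rsubmx _ n k).
  rewrite (@b_jacobian_comp _ (n + k) n n (@lsubmx R 1 n.+1 k)); last 2 first.
  - exact: b_map_lsubmx.
  - by rewrite /z0 row_mxKl.
  rewrite (@b_jacobian_lsubmx _ n k) (@mul_col_mx _ n.+1 k) mul0mx.
  rewrite -(@block_mxEh _ n.+1 k n.+1 k) (@block_mxEv _ n.+1 k n.+1 k).
  by rewrite (@col_mxKd _ n.+1 k).
have -> : @dsubmx _ n.+1 k _ (@b_jacobian R (n + k) (n + k) Q z0) =
    (row_mx 0 (Ad e g^-1%g) : 'M[R]_(k, n.+1 + k)).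
  rewrite (@b_jacobian_row_mx _ (n + k) n k _ (kap \o @rsubmx R 1 n.+1 k)).
  rewrite (@b_jacobian_lsubmx _ n k).
  apply/matrixP => a j; rewrite mxE; case: (@split_ordP n.+1 k j) => l ->.
    by rewrite !(@row_mxEl _ _ n.+1 k) (@col_mxEd _ n.+1 k).
  rewrite !(@row_mxEr _ _ n.+1 k) mxE b_partialE /b_weight rshift_eq0 mul1r.
  apply: (etrans (@partial_rsubmx _ n.+1 k (fun s => kap s 0 l) a z0)).
  rewrite /z0 row_mxKr /partial -derive_rV; last exact: smooth_rV_differentiable.
  by rewrite deriveEjacobian ?rowE -?rowE ?mxE//; exact: smooth_rV_differentiable.
rewrite P0 Q0 /velocity.
by rewrite !mul_row0 mul1mx => ->.
Qed.

(** The case g = 1 of [velocity_act], where the Jacobian of the action is a change of charts and Ad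
    is the identity. *)
Lemma velocity_transition c c' x : bcharts c -> bcharts c' -> dom c x -> dom c' x ->
  velocity act e c' x *m transition c' c x = velocity act e c x.
Proof.
move=> bc bc' dx dx'; have d1 : dom c' (act 1%g x) by rewrite (ba_one aS).
have := velocity_act bc bc' dx d1; rewrite (ba_one aS) invg1 (act_jacobian1 aS) => ->.
rewrite /Ad; have -> : jacobian (coord e \o (fun h : G => 1 * h * 1^-1)%g \o param e) s1 = 1%:M.
  have [_ sc] := conjugation_at 1%g Ae e1.
  apply/row_matrixP => i; rewrite rowE -deriveEjacobian; last exact: smooth_rV_differentiable.
  have -> : 'D_(delta_mx 0 i) (coord e \o (fun h : G => 1 * h * 1^-1)%g \o param e) s1 =
      'D_(delta_mx 0 i) id s1.
    apply: near_eq_derive; apply: filterS (group_near_img Ae e1) => s is_.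
    by rewrite /= mul1g invg1 mulg1; have [] := group_img_param Ae is_.
  by rewrite derive_id row1.
by rewrite mul1mx.
Qed.

End Equivariance.

(** * b-charts of a b-manifold *)

Section HomeoCharts.
Context {R : realType} {T : topologicalType} {m : nat}.
Implicit Types (c : chart R T m) (x : T).

Lemma homeo_param c x : homeo_chart c -> dom c x -> param c (coord c x) = x.
Proof. by move=> [_ _ + _ _]; apply. Qed.

Lemma homeo_img c y : homeo_chart c -> img c y -> dom c (param c y) /\ coord c (param c y) = y.
Proof. by move=> hc [x dx <-]; rewrite homeo_param. Qed.

Lemma homeo_near_img c x : homeo_chart c -> dom c x -> \forall y \near coord c x, img c y.
Proof. by move=> [_ oi _ _ _] dx; apply: open_nbhs_nbhs; split=> //; exists x. Qed.

Lemma homeo_coord_continuous c x : homeo_chart c -> dom c x -> {for x, continuous (coord c)}.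
Proof.
move=> [od _ _ cc _] dx; move: cc; rewrite continuous_open_subspace//.
by apply; rewrite inE.
Qed.

Lemma homeo_param_continuous c x : homeo_chart c -> dom c x ->
  {for coord c x, continuous (param c)}.
Proof.
move=> [_ oi _ _ cp] dx; move: cp; rewrite continuous_open_subspace//.
by apply; rewrite inE; exists x.
Qed.

Lemma homeo_near c x (D : set T) : homeo_chart c -> dom c x -> nbhs x D ->
  \forall y \near coord c x, D (param c y).
Proof.
move=> hc dx Dx; have := homeo_param_continuous hc dx.
by rewrite /prop_for /continuous_at homeo_param// => /(_ _ Dx).
Qed.

Lemma transition_smooth_at c c' x : homeo_chart c -> homeo_chart c' ->
  smooth_transition c c' -> dom c x -> dom c' x ->
  smooth_rV_at (coord c' \o param c) (coord c x).
Proof.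
move=> hc hc' sc dx dx'; set U := coord c @` (dom c `&` dom c').
have oU : open U.
  rewrite openE => _ [t [dt dt'] <-].
  have nd : nbhs t (dom c') by apply: open_nbhs_nbhs; split=> //; have [] := hc'.
  apply: filterS2 (homeo_near_img hc dt) (homeo_near hc dt nd) => y iy dy.
  by have [dy' yE] := homeo_img hc iy; exists (param c y).
by apply: (proj1 (smooth_onP _ oU) sc); exists x.
Qed.

End HomeoCharts.

Lemma smooth_translation (R : realType) m (w y : 'rV[R]_m) :
  smooth_rV_at (fun v => v + w) y.
Proof.
move=> j; apply: smooth_near_eq (smoothD (smooth_coord j y) (smooth_cst (w 0 j) y)).
by apply: filterE => v; rewrite mxE.
Qed.

Section MaximalAtlas.
Context {R : realType} {m : nat} {M : smooth_manifold R m}.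
Implicit Types (c a : chart R M m) (x : M).

Lemma atlas_homeo a : atlas a -> homeo_chart a.
Proof. exact: (mf_homeo (@atlas_manifold R m M)). Qed.

Lemma atlas_chart x : exists2 a, @atlas R m M a & dom a x.
Proof. exact: (mf_covers (@atlas_manifold R m M)). Qed.

Lemma homeo_dom_nbhs c x : homeo_chart c -> dom c x -> nbhs x (dom c).
Proof. by move=> [od _ _ _ _] dx; exact: open_nbhs_nbhs. Qed.

Lemma atlas_transition a a' x : @atlas R m M a -> @atlas R m M a' ->
  dom a x -> dom a' x -> smooth_rV_at (coord a' \o param a) (coord a x).
Proof.
move=> Aa Aa' dx dx'; apply: transition_smooth_at => //; [exact: atlas_homeo..|].
exact: (mf_compat (@atlas_manifold R m M)).
Qed.

Lemma maximal_atlas_to c a x : maximal_atlas c -> @atlas R m M a -> dom c x -> dom a x ->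
  smooth_rV_at (coord a \o param c) (coord c x).
Proof.
move=> [hc sc] Aa dx dx'; apply: transition_smooth_at => //; first exact: atlas_homeo.
by have [] := sc _ Aa.
Qed.

Lemma maximal_atlas_from c a x : maximal_atlas c -> @atlas R m M a -> dom c x -> dom a x ->
  smooth_rV_at (coord c \o param a) (coord a x).
Proof.
move=> [hc sc] Aa dx dx'; apply: transition_smooth_at => //; first exact: atlas_homeo.
by have [] := sc _ Aa.
Qed.

(** The two charts are compared through a chart of the given atlas around the point. *)
Lemma maximal_atlas_transition c c' x : @maximal_atlas R m M c -> maximal_atlas c' ->
  dom c x -> dom c' x -> smooth_rV_at (coord c' \o param c) (coord c x).
Proof.
move=> mc mc' dx dx'; have [a Aa ax] := atlas_chart x; have [hc _] := mc.
have ha := atlas_homeo Aa.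
have s1 := maximal_atlas_to mc Aa dx ax.
have s2 := maximal_atlas_from mc' Aa dx' ax.
have xE : (coord a \o param c) (coord c x) = coord a x by rewrite /= homeo_param.
rewrite -xE in s2; apply: smooth_rV_near_eq (smooth_rV_comp s1 s2).
apply: filterS (homeo_near hc dx (homeo_dom_nbhs ha ax)) => y dy.
by rewrite /= homeo_param.
Qed.

End MaximalAtlas.

Section BManifoldCharts.
Context {R : realType} {n : nat} (M : b_manifold R n).
Implicit Types (c a : chart R M n.+1) (x : M).
Local Notation Z := (@bm_hyp R n M).
Local Notation S := (b_space_of M).

(** * b-charts around points off the hypersurface *)

Section OffHyperplaneChart.
Variables (a : chart R M n.+1) (x : M).
Hypotheses (Aa : atlas a) (ax : dom a x) (Zx : ~ Z x).

(** The translation moves the first coordinate of [x] to 1. Off [Z], and where the translated first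
    coordinate is positive, both sides of the b-chart condition are false. *)
Definition off_shift : 'rV[R]_n.+1 := (1 - coord a x 0 0) *: delta_mx 0 0.

Definition off_chart : chart R M n.+1 :=
  Chart (dom a `&` ~` Z `&` [set t | 0 < (coord a t + off_shift) 0 0])
    (fun t => coord a t + off_shift) (fun y => param a (y - off_shift)).

Let ha : homeo_chart a := atlas_homeo Aa.

Lemma off_chart_dom : dom off_chart x.
Proof.
split=> //=; rewrite !mxE eqxx mulr1.
by rewrite addrC subrK ltr01.
Qed.

Lemma off_chart_nbhs t : dom off_chart t -> nbhs t (dom off_chart).
Proof.
move=> [[dt Zt] t0]; have [cZ _] := @bm_hypersurface R n M.
have nd := homeo_dom_nbhs ha dt.
have nZ : nbhs t (~` Z) by apply: open_nbhs_nbhs; split=> //; rewrite openC.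
have ct : {for t, continuous (fun t => (coord a t + off_shift) 0 0)}.
  have cv : {for coord a t, continuous (fun v : 'rV[R]_n.+1 => (v + off_shift) 0 0)}.
    exact: smooth_continuous (smooth_translation off_shift (coord a t) 0).
  exact: (continuous_comp (homeo_coord_continuous ha dt) cv).
have np := ct _ (open_nbhs_nbhs (conj (@open_gt R 0) t0)).
by apply: filterS3 nd nZ np => u.
Qed.

Lemma off_chart_homeo : homeo_chart off_chart.
Proof.
have od : open (dom off_chart).
  by rewrite openE => t; exact: off_chart_nbhs.
have ctr v : {for v, continuous (fun y : 'rV[R]_n.+1 => y - off_shift)}.
  exact: smooth_rV_continuous (smooth_translation _ v).
have oi : open (img off_chart).
  rewrite openE => _ [t dt <-]; have [[dat _] _] := dt.
  have tE : coord off_chart t - off_shift = coord a t by rewrite /= addrK.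
  have near_i : \forall y \near coord off_chart t - off_shift,
      img a y /\ dom off_chart (param a y).
    rewrite tE; apply: filterS2 (homeo_near_img ha dat) (homeo_near ha dat (off_chart_nbhs dt)).
    by move=> y.
  apply: filterS (near_comp (ctr _) near_i) => y [iy dy].
  have [_ yE] := homeo_img ha iy.
  by exists (param a (y - off_shift)) => //=; rewrite yE subrK.
split=> //.
- by move=> t [[dt _] _] /=; rewrite addrK homeo_param.
- rewrite continuous_open_subspace// => t; rewrite inE => -[[dt _] _].
  have := smooth_rV_continuous (smooth_translation off_shift (coord a t)).
  by move/(continuous_comp (homeo_coord_continuous ha dt)).
- rewrite continuous_open_subspace// => y; rewrite inE => -[t [[dt _] _] <-].
  apply: (@continuous_comp _ _ _ (fun y : 'rV[R]_n.+1 => y - off_shift) (param a)).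
    exact: ctr.
  by rewrite /= addrK; exact: homeo_param_continuous.
Qed.

Lemma off_chart_maximal : maximal_atlas off_chart.
Proof.
split; first exact: off_chart_homeo.
move=> b Ab; split; apply: smooth_on_at => _ [t [dt dt'] <-].
  have [[dat _] _] := dt.
  apply: (@smooth_rV_comp _ _ _ _ (fun y : 'rV[R]_n.+1 => y - off_shift)
    (coord b \o param a)); first exact: smooth_translation.
  by rewrite /= addrK; exact: (atlas_transition Aa Ab).
have [[dat _] _] := dt'.
exact: (@smooth_rV_comp _ _ _ _ (coord a \o param b) (fun v => v + off_shift) _
  (atlas_transition Ab Aa dt dat) (smooth_translation _ _)).
Qed.

Lemma off_chart_b_chart : b_chart Z off_chart.
Proof.
split; first exact: off_chart_maximal.
move=> t [[_ Zt] t0]; split=> // t00.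
by move: t0; rewrite /= in t00 *; rewrite t00 ltxx.
Qed.

End OffHyperplaneChart.

Lemma b_chart_around_P x : b_chart Z (b_chart_around x) /\ dom (b_chart_around x) x.
Proof.
rewrite /b_chart_around; case: pselect => [h|]; first exact: (svalP (cid h)).
case; have [Zx|Zx] := pselect (Z x).
  by have [_ cZ] := @bm_hypersurface R n M; have [c bc dx] := cZ x Zx; exists c.
have [a Aa ax] := atlas_chart x; exists (off_chart a x); split.
  exact: (off_chart_b_chart x Aa).
exact: (off_chart_dom ax Zx).
Qed.

Lemma b_chart_homeo c : b_chart Z c -> homeo_chart c.
Proof. by move=> [[]]. Qed.

(** Stated for maps of [M] so as to cover both chart changes, with [f] and [h] the identity, and the
    diffeomorphisms given by group elements. *)
Lemma diffeo_b_map c c' (f h : M -> M) x : b_chart Z c -> b_chart Z c' ->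
  dom c x -> dom c' (f x) -> (forall t, Z t -> Z (f t)) -> (forall t, Z t -> Z (h t)) ->
  (forall t, h (f t) = t) -> (forall t, f (h t) = t) ->
  (\forall y \near coord c x, dom c' (f (param c y))) ->
  (\forall y \near coord c' (f x), dom c (h (param c' y))) ->
  smooth_rV_at (coord c' \o f \o param c) (coord c x) ->
  smooth_rV_at (coord c \o h \o param c') (coord c' (f x)) ->
  b_map_at (coord c' \o f \o param c) (coord c x).
Proof.
move=> bc bc' dx dfx Zf Zh hf fh nf nh sf sh.
have hc := b_chart_homeo bc; have hc' := b_chart_homeo bc'.
have fxE : (coord c' \o f \o param c) (coord c x) = coord c' (f x).
  by rewrite /= homeo_param.
apply: (@b_map_left_inverse _ _ _ _ (coord c \o h \o param c')); rewrite ?fxE//.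
- apply: filterS2 nf (homeo_near_img hc dx) => y dy iy /= y0.
  have [dy' yE] := homeo_img hc iy; apply/(proj2 bc' _ dy)/Zf.
  by apply/(proj2 bc _ dy'); rewrite yE.
- apply: filterS2 nh (homeo_near_img hc' dfx) => y dy iy /= y0.
  have [dy' yE] := homeo_img hc' iy; apply/(proj2 bc _ dy)/Zh.
  by apply/(proj2 bc' _ dy'); rewrite yE.
- apply: filterS2 nf (homeo_near_img hc dx) => y dy iy /=.
  by rewrite homeo_param// hf; have [] := homeo_img hc iy.
Qed.

Lemma compatible_b_manifold : compatible_b_charts S.
Proof.
have hbc c : b_chart Z c -> homeo_chart c by exact: b_chart_homeo.
have nd c c' x : b_chart Z c -> b_chart Z c' -> dom c x -> dom c' x ->
    \forall y \near coord c x, dom c' (param c y).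
  move=> bc bc' dx dx'; apply: (homeo_near (hbc _ bc) dx).
  exact: homeo_dom_nbhs (hbc _ bc') dx'.
split.
- exact: b_chart_around_P.
- by move=> c /hbc[].
- by move=> c x /hbc hc; exact: homeo_param.
- exact: nd.
- move=> c c' x bc bc' dx dx'.
  have sm := maximal_atlas_transition (proj1 bc) (proj1 bc') dx dx'.
  have sm' := maximal_atlas_transition (proj1 bc') (proj1 bc) dx' dx.
  apply: (@diffeo_b_map c c' id id x bc bc') => //; exact: nd.
Qed.

(** * Smooth actions preserving the hypersurface are b-actions *)

Section SmoothActions.
Context {k : nat} {G : lie_group R k}.
Variable rho : G -> M -> M.
Hypothesis rho_action : smooth_action (@atlas R n.+1 M) rho.
Hypothesis rho_Z : forall (g : G) (x : M), Z x -> Z (rho g x).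

Lemma rho_invK g t : rho g^-1%g (rho g t) = t.
Proof. by have [r1 rM _] := rho_action; rewrite -rM mulVg r1. Qed.

(** Smoothness of the action is given in charts of the atlas; it is carried to charts of the maximal
    atlas through atlas charts [a] around [x] and [b] around [rho g x]. *)
Lemma rho_smooth_at cG c c' g x : @lg_atlas R k G cG -> maximal_atlas c ->
  maximal_atlas c' -> dom cG g -> dom c x -> dom c' (rho g x) ->
  (\forall z \near row_mx (coord c x) (coord cG g),
     dom c' (rho (param cG (rsubmx z)) (param c (lsubmx z)))) /\
  smooth_rV_at (family rho cG c c') (row_mx (coord c x) (coord cG g)).
Proof.
move=> AG mc mc' dg dx dgx; have [_ _ sr] := rho_action.
have [a Aa ax] := atlas_chart x; have [b Ab bgx] := atlas_chart (rho g x).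
have [|oU sU] := sr (chart_prod cG a) b _ Ab; first by exists (cG, a).
set U := [set y | _] in oU sU.
have ha := atlas_homeo Aa; have hb := atlas_homeo Ab.
have [hc _] := mc; have [hc' _] := mc'.
set z0 := row_mx (coord c x) (coord cG g).
pose w (z : 'rV[R]_(n.+1 + k)) := row_mx (rsubmx z) ((coord a \o param c) (lsubmx z)).
have sw : smooth_rV_at w z0.
  apply: smooth_row_mx; first exact: smooth_rsubmx.
  apply: smooth_rV_comp; first exact: smooth_lsubmx.
  by rewrite /z0 row_mxKl; exact: maximal_atlas_to.
have w0 : w z0 = row_mx (coord cG g) (coord a x).
  by rewrite /w /z0 row_mxKl row_mxKr /= homeo_param.
have U0 : U (w z0).
  rewrite w0; split; first by exists (g, x).
  by rewrite /= row_mxKl row_mxKr group_paramK// homeo_param.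
have nU := near_comp (smooth_rV_continuous sw) (open_nbhs_nbhs (conj oU U0)).
have sUw := smooth_rV_comp sw (proj1 (smooth_onP _ oU) sU _ U0).
have na := near_lsubmx (coord cG g) (homeo_near hc dx (homeo_dom_nbhs ha ax)).
have near_b : \forall z \near z0, dom b (rho (param cG (rsubmx z)) (param c (lsubmx z))).
  apply: filterS2 nU na => z [_ dz] daz; move: dz.
  by rewrite /w /= row_mxKl row_mxKr homeo_param.
pose F := (coord b \o (fun gx : G * M => rho gx.1 gx.2) \o param (chart_prod cG a)) \o w.
have F0 : F z0 = coord b (rho g x).
  by rewrite /F /= w0 row_mxKl row_mxKr group_paramK// homeo_param.
have FE : \forall z \near z0,
    F z = coord b (rho (param cG (rsubmx z)) (param c (lsubmx z))).
  by apply: filterS na => z daz; rewrite /F /w /= row_mxKl row_mxKr homeo_param.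
have near_F : \forall z \near z0, dom c' (param b (F z)).
  have nb : \forall v \near F z0, dom c' (param b v).
    by rewrite F0; exact: homeo_near hb bgx (homeo_dom_nbhs hc' dgx).
  exact: (near_comp (smooth_rV_continuous sUw) nb).
have near_bF : \forall z \near z0,
    param b (F z) = rho (param cG (rsubmx z)) (param c (lsubmx z)).
  by apply: filterS2 FE near_b => z -> dz; rewrite homeo_param.
split; first by apply: filterS2 near_F near_bF => z dz <-.
have sF : smooth_rV_at ((coord c' \o param b) \o F) z0.
  apply: smooth_rV_comp; first exact: sUw.
  by rewrite F0; exact: (maximal_atlas_from mc' Ab dgx bgx).
by apply: smooth_rV_near_eq sF; apply: filterS near_bF => z /= ->.
Qed.

Lemma rho_smooth_slice c c' g x : maximal_atlas c -> maximal_atlas c' ->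
  dom c x -> dom c' (rho g x) ->
  (\forall y \near coord c x, dom c' (rho g (param c y))) /\
  smooth_rV_at (coord c' \o rho g \o param c) (coord c x).
Proof.
move=> mc mc' dx dgx; have [cG AG dg] := group_chart g.
have [nr sr] := rho_smooth_at AG mc mc' dg dx dgx.
have sins : smooth_rV_at (fun y : 'rV[R]_n.+1 => row_mx y (coord cG g)) (coord c x).
  by apply: (@smooth_row_mx _ _ _ _ id); [exact: smooth_rV_id|exact: smooth_rV_cst].
split.
  apply: filterS (near_comp (smooth_rV_continuous sins) nr) => y.
  by rewrite row_mxKl row_mxKr group_paramK.
apply: smooth_rV_near_eq (smooth_rV_comp sins sr).
by apply: filterE => y; rewrite /= /family row_mxKl row_mxKr group_paramK.
Qed.

(** Hadamard's lemma gives a factor [u] of (x, s). With s fixed it agrees off the hyperplane, hence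
    everywhere near, with the factor [v] of the diffeomorphism [rho g], which is nonzero. *)
Lemma b_action_manifold : @b_action R k G S rho.
Proof.
have [r1 rM _] := rho_action; split=> //.
  move=> cG c c' g x AG [mc _] [mc' _] dg dx dgx.
  by have [] := rho_smooth_at AG mc mc' dg dx dgx.
move=> cG c c' g x AG bc bc' dg dx dgx.
have hc := b_chart_homeo bc; have hc' := b_chart_homeo bc'.
have [nr sr] := rho_smooth_at AG (proj1 bc) (proj1 bc') dg dx dgx.
set z0 := row_mx _ _ in nr sr *.
pose u := @divide_coord0 R (n + k) (fun z => family rho cG c c' z 0 0).
have van : nbhs z0 [set z : 'rV[R]_(n + k).+1 | z 0 0 = 0 -> family rho cG c c' z 0 0 = 0].
  apply: filterS2 nr (near_lsubmx (coord cG g) (homeo_near_img hc dx)) => z dz iz /= zz.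
  have [dy yE] := homeo_img hc iz; apply/(proj2 bc' _ dz)/rho_Z.
  by apply/(proj2 bc _ dy); rewrite yE lsubmx00.
have su : smooth_at u z0 by exact: (smooth_divide_coord0 (sr 0) van).
exists u; split=> //; last by apply: filterS van => z; exact: divide_coord0E.
have dggx : dom c (rho g^-1%g (rho g x)) by rewrite rho_invK.
have [nf sf] := rho_smooth_slice (proj1 bc) (proj1 bc') dx dgx.
have [nh sh] := rho_smooth_slice (proj1 bc') (proj1 bc) dgx dggx.
have gK t : rho g (rho g^-1%g t) = t by rewrite -{1}(invgK g) rho_invK.
have [v [_ sv v0 vE]] := diffeo_b_map bc bc' dx dgx (rho_Z g) (rho_Z g^-1%g)
  (rho_invK g) gK nf nh sf sh.
have cins := @continuous_insert R k _ (coord cG g) (coord c x).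
suff -> : u z0 = v (coord c x) by [].
apply: (@eq_on_hyperplane _ _ (fun y => u (row_mx y (coord cG g))) v).
- exact: (continuous_comp cins (smooth_continuous su)).
- exact: smooth_continuous.
apply: filterS2 vE (near_comp cins van) => y /= yv yvan y0.
apply: (mulfI y0); rewrite -yv.
have E := @divide_coord0E R (n + k) (fun z => family rho cG c c' z 0 0) _ yvan.
have y00 : (row_mx y (coord cG g) : 'rV[R]_(n + k).+1) 0 0 = y 0 0 by rewrite row_mx00.
rewrite y00 in E; rewrite -[LHS]E.
by rewrite /family row_mxKl row_mxKr group_paramK.
Qed.

End SmoothActions.
End BManifoldCharts.

(** * The moment map *)

Section GradientRules.
Context {R : realType}.

Lemma b_partialM m (i : 'I_m.+1) (f g : 'rV[R]_m.+1 -> R) y :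
  differentiable f y -> differentiable g y ->
  b_partial i (fun z => f z * g z) y = b_partial i f y * g y + f y * b_partial i g y.
Proof.
move=> df dg; rewrite !b_partialE partialM// mulrDr mulrA; congr (_ + _).
by rewrite mulrCA.
Qed.

Lemma b_partial_sum m p (i : 'I_m.+1) (f : 'I_p -> 'rV[R]_m.+1 -> R) y :
  (forall j, differentiable (f j) y) ->
  b_partial i (fun z => \sum_j f j z) y = \sum_j b_partial i (f j) y.
Proof. by move=> df; rewrite b_partialE partial_sum// mulr_sumr. Qed.

Lemma b_partial_cst m (i : 'I_m.+1) (c : R) y : b_partial i (fun=> c) y = 0.
Proof. by rewrite b_partialE partial_cst mulr0. Qed.

Lemma b_partial_dot m p (A B : 'rV[R]_m.+1 -> 'rV[R]_p) y i :
  smooth_rV_at A y -> smooth_rV_at B y ->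
  b_partial i (fun z => pairing (A z) (B z)) y =
  (b_gradient A y *m (B y)^T + b_gradient B y *m (A y)^T) i 0.
Proof.
move=> sA sB.
have -> : (fun z => pairing (A z) (B z)) = (fun z => \sum_l A z 0 l * B z 0 l).
  by apply/funext => z; rewrite /pairing mxE; apply: eq_bigr => l _; rewrite mxE.
rewrite b_partial_sum => [|l]; last first.
  exact: smooth_differentiable (smoothM (sA l) (sB l)).
rewrite !mxE -big_split/=; apply: eq_bigr => l _.
rewrite b_partialM; [|exact: smooth_differentiable (sA l)|exact: smooth_differentiable (sB l)].
by rewrite !mxE [X in _ + X]mulrC.
Qed.

(** Differentiate A A^-1 = 1 at a point where A = 1. *)
Lemma b_partial_invmx1 m p (A : 'rV[R]_m.+1 -> 'M[R]_p) y i j l :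
  (forall a b, smooth_at (fun z => A z a b) y) -> A y = 1%:M ->
  b_partial i (fun z => invmx (A z) j l) y = - b_partial i (fun z => A z j l) y.
Proof.
move=> sA A1; have Au : A y \in unitmx by rewrite A1 unitmx1.
have sK a b := smooth_invmx a b sA Au.
have sdet := smooth_near_neq0 (smooth_det sA).
have near_u : \forall z \near y, A z \in unitmx.
  have : \det (A y) != 0 by rewrite -unitfE -unitmxE.
  by move=> /sdet; apply: filterS => z; rewrite -unitfE -unitmxE.
have AK : \forall z \near y, \sum_a A z j a * invmx (A z) a l = (j == l)%:R.
  apply: filterS near_u => z uz.
  by have := congr1 (fun B : 'M[R]_p => B j l) (mulmxV uz); rewrite !mxE.
have := b_partial_near_eq i AK; rewrite b_partial_cst b_partial_sum; last first.
  by move=> a; exact: smooth_differentiable (smoothM (sA j a) (sK a l)).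
under eq_bigr => a _.
  rewrite b_partialM; [|exact: smooth_differentiable (sA j a)|
    exact: smooth_differentiable (sK a l)].
  rewrite A1 invmx1 !mxE; over.
rewrite big_split/= (bigD1 l)//= eqxx mulr1 big1 ?addr0; last first.
  by move=> a /negbTE ->; rewrite mulr0.
rewrite (bigD1 j)//= eqxx mul1r big1 ?addr0; last first.
  by move=> a; rewrite eq_sym => /negbTE ->; rewrite mul0r.
by move=> /eqP; rewrite addrC addr_eq0 => /eqP.
Qed.

End GradientRules.

(** * The canonical forms in cotangent charts *)

Section CanonicalForms.
Context {R : realType} {S : b_space R}.
Hypothesis cS : compatible_b_charts S.
Local Notation n := (bdim S).
Local Notation E := (b_cotangent S).
Implicit Types (c : chart R S n.+1) (x : S) (p : E).

Let cE : compatible_b_charts E := compatible_cotangent cS.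

Lemma cotangent_bchart c : bcharts c -> @bcharts R E (cotangent_chart c).
Proof. by move=> bc; exists c. Qed.

Lemma near_lsubmx_coord c p : bcharts c -> dom c p.1 ->
  \forall z \near coord (cotangent_chart c) p, img c (lsubmx z).
Proof.
move=> bc dp.
exact: (near_lsubmx (covector_in c p.1 p.2) (near_img cS bc dp)).
Qed.

Lemma proj_jacobian c c' p : bcharts c -> bcharts c' -> dom c p.1 -> dom c' p.1 ->
  @b_jacobian R (n + n.+1) n (coord c' \o @b_proj R S \o param (cotangent_chart c))
    (coord (cotangent_chart c) p) =
  (col_mx (transition c c' p.1) 0 : 'M[R]_(n.+1 + n.+1, n.+1)).
Proof.
move=> bc bc' dp dp'.
have bl := @b_map_lsubmx R n n.+1 (coord (cotangent_chart c) p).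
have lE : @lsubmx R 1 n.+1 n.+1 (coord (cotangent_chart c) p) = coord c p.1.
  by rewrite /= row_mxKl.
have bt : b_map_at (coord c' \o param c)
    (@lsubmx R 1 n.+1 n.+1 (coord (cotangent_chart c) p)).
  by rewrite lE; exact: cb_map.
rewrite -[coord c' \o _ \o _]/((coord c' \o param c) \o @lsubmx R 1 n.+1 n.+1).
rewrite (@b_jacobian_comp R (n + n.+1) n n _ _ _ bl bt) b_jacobian_lsubmx.
by rewrite (@mul_col_mx _ n.+1 n.+1) mul1mx mul0mx lE.
Qed.

Lemma mulmx_tr_col0 (v : 'rV[R]_n.+1) (T : 'M[R]_n.+1) :
  v *m (col_mx T 0 : 'M[R]_(n.+1 + n.+1, n.+1))^T = row_mx (v *m T^T) 0.
Proof. by rewrite tr_col_mx trmx0 mul_mx_row mulmx0. Qed.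

Lemma b_diff_proj p : b_diff (@b_proj R S) p = (col_mx 1%:M 0 : 'M[R]_(n.+1 + n.+1, n.+1)).
Proof.
have [bx dx] := cb_at cS p.1.
by rewrite -(transition_id cS bx dx) -(proj_jacobian bx bx dx dx).
Qed.

(** The form is sum p_i e^i in every cotangent chart at every point. This is needed on a whole
    neighbourhood in one chart, since [b_d1] differentiates coefficients while the preferred charts
    vary. *)
Lemma canonical_form1_in c (z : 'rV[R]_(n.+1 + n.+1)) : bcharts c -> img c (lsubmx z) ->
  b_form1_in (@canonical_form1 R S) (cotangent_chart c) z =
  (row_mx (rsubmx z) 0 : 'rV[R]_(n.+1 + n.+1)).
Proof.
move=> bc iz; set C := cotangent_chart c; set p := param C z.
have [dp _] := img_param cS bc iz.
have {}dp : dom c p.1 := dp.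
have zE : coord C p = z by exact: (cotangent_coordK cS).
have [bx dx] := cb_at cS p.1.
have bC : @bcharts R E C by exists c.
have bC' : @bcharts R E (cotangent_chart (bchart_at p.1)) by exists (bchart_at p.1).
(* The projection commutes with changes of charts, by the chain rule; this removes the preferred
   chart. *)
have TE : @transition R E C (cotangent_chart (bchart_at p.1)) p *m
    (b_diff (@b_proj R S) p) =
    (col_mx (transition c (bchart_at p.1) p.1) 0 : 'M[R]_(n.+1 + n.+1, n.+1)).
  rewrite -(proj_jacobian bc bx dp dx) b_diff_proj.
  rewrite -(@b_jacobian_lsubmx R n n.+1
    ((coord (cotangent_chart (bchart_at p.1)) \o param C) (coord C p))).
  have bt : @b_map_at R (n + n.+1) (n + n.+1)
     (coord (cotangent_chart (bchart_at p.1)) \o param C) (coord C p).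
    exact: (cb_map cE bC bC' dp dx).
  rewrite -(@b_jacobian_comp R (n + n.+1) (n + n.+1) n _ _ _ bt (@b_map_lsubmx R n n.+1 _)).
  apply: (@b_jacobian_near_eq R (n + n.+1) n).
    by apply: filterE => w; rewrite /= row_mxKl.
  exact: (@b_map_comp R (n + n.+1) (n + n.+1) n _ _ _ bt (@b_map_lsubmx R n n.+1 _)).
rewrite /b_form1_in covector_inE -/p /canonical_form1 /b_covector -mulmxA -trmx_mul.
apply: (etrans (congr1 (fun B => p.2 *m B^T) TE)); rewrite mulmx_tr_col0.
suff -> : rsubmx z = covector_in c p.1 p.2 by rewrite covector_inE.
by apply: (etrans (esym (congr1 (@rsubmx R 1 n.+1 n.+1) zE))); exact: row_mxKr.
Qed.

(** The cotangent coordinates are Darboux coordinates: omega = sum e^i /\ dp_i, with constant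
    coefficients. *)
Lemma canonical_form2E p : canonical_form2 p =
  (block_mx 0 1%:M (- 1%:M) 0 : 'M[R]_(n.+1 + n.+1)).
Proof.
have [bx dx] := cb_at cS p.1; set c := bchart_at p.1 in bx dx *.
pose a (z : 'rV[R]_(n.+1 + n.+1)) : 'rV[R]_(n.+1 + n.+1) := row_mx (rsubmx z) 0.
have near_a : \forall z \near coord (cotangent_chart c) p,
    b_form1_in (@canonical_form1 R S) (cotangent_chart c) z = a z.
  by apply: filterS (near_lsubmx_coord bx dx) => z iz; exact: canonical_form1_in.
have aE i j : b_partial i (fun z => b_form1_in (@canonical_form1 R S) (cotangent_chart c) z 0 j)
    (bcoord p) = (block_mx 0 0 1%:M 0 : 'M[R]_(n.+1 + n.+1)) i j.
  have -> : b_partial i (fun z => b_form1_in (@canonical_form1 R S) (cotangent_chart c) z 0 j)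
    (bcoord p) = b_partial i (fun z => a z 0 j) (bcoord p).
    by apply: b_partial_near_eq; apply: filterS near_a => z ->.
  rewrite block_mxEh; case: (@split_ordP n.+1 n.+1 j) => l ->.
    rewrite (@row_mxEl _ _ n.+1 n.+1) -(@b_gradient_rsubmx R n n.+1 (bcoord p)) mxE.
    by congr (b_partial _ _ _); apply/funext => z; rewrite /a row_mxEl.
  rewrite (@row_mxEr _ _ n.+1 n.+1).
  have -> : (fun z : 'rV[R]_(n + n.+1).+1 => a z 0 (rshift n.+1 l)) = (fun=> 0).
    by apply/funext => z; rewrite /a row_mxEr mxE.
  rewrite b_partial_cst; case: (@split_ordP n.+1 n.+1 i) => l' ->.
    by rewrite (@col_mxEu _ n.+1 n.+1) mxE.
  by rewrite (@col_mxEd _ n.+1 n.+1) mxE.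
have -> : @canonical_form2 R S p = - ((block_mx 0 0 1%:M 0 : 'M[R]_(n.+1 + n.+1)) -
    (block_mx 0 0 1%:M 0)^T).
  apply/matrixP => i j; rewrite /canonical_form2 [LHS]mxE [RHS]mxE; congr (- _).
  rewrite [LHS]mxE [RHS]mxE; congr (_ + _); first exact: aE.
  by rewrite [RHS]mxE; congr (- _); rewrite [RHS]mxE; exact: aE.
rewrite tr_block_mx !trmx0 trmx1 opp_block_mx add_block_mx opp_block_mx.
by rewrite !subr0 sub0r opprK oppr0.
Qed.

End CanonicalForms.

(** * Smoothness and equivariance of the moment map, Hamilton's equation *)

Section MomentMap.
Context {R : realType} {k : nat} {G : lie_group R k} {S : b_space R}.
Variables (act : G -> S -> S) (e : chart R G k).
Hypothesis (cS : compatible_b_charts S) (aS : b_action act).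
Hypothesis (Ae : @lg_atlas R k G e) (e1 : dom e 1%g).
Local Notation n := (bdim S).
Local Notation E := (b_cotangent S).
Local Notation s1 := (coord e 1%g).
Local Notation act_hat := (@cotangent_lift R k G S act).
Implicit Types (c : chart R S n.+1) (x : S) (p : E) (g h : G) (X : 'rV[R]_k).

Let cE : compatible_b_charts E := compatible_cotangent cS.
Let aE : b_action act_hat := b_action_lift cS aS.

Definition moment p : 'rV[R]_k := p.2 *m (velocity act e (bchart_at p.1) p.1)^T.

Lemma pairing_mulmx m q (xi : 'rV[R]_m) (V : 'M[R]_(q, m)) (X : 'rV[R]_q) :
  pairing (xi *m V^T) X = pairing xi (X *m V).
Proof. by rewrite /pairing trmx_mul mulmxA. Qed.

Lemma moment_base p X : pairing (moment p) X =
  pairing (b_covector p) (b_section (fundamental_field e act X) (b_proj p)).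
Proof. by rewrite (b_section_fundamental cS aS Ae e1) -pairing_mulmx. Qed.

(** The changes of chart of the covector and of the velocity cancel in the pairing, so the preferred
    chart may be replaced by a fixed one. *)
Lemma moment_in c p : bcharts c -> dom c p.1 ->
  moment p = covector_in c p.1 p.2 *m (velocity act e c p.1)^T.
Proof.
move=> bc dp; have [bx dx] := cb_at cS p.1.
rewrite covector_inE -mulmxA -trmx_mul /moment.
by rewrite (velocity_transition cS aS Ae e1 bx bc dx dp).
Qed.

(** [velocity] as a function of coordinates, the form in which it can be differentiated. *)
Definition velocity_field c (y : 'rV[R]_n.+1) : 'M[R]_(k, n.+1) := @dsubmx _ n.+1 k _
  (@b_jacobian R (n + k) n (family act e c c) (unit_at e y)).

Lemma moment_coord c (z : 'rV[R]_(n.+1 + n.+1)) : bcharts c -> img c (lsubmx z) ->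
  moment (param (cotangent_chart c) z) =
  rsubmx z *m (velocity_field c (lsubmx z))^T.
Proof.
move=> bc iz; set p := param (cotangent_chart c) z.
have [dp yE] : dom c p.1 /\ coord c p.1 = lsubmx z by exact: (img_param cS bc iz).
have <- : covector_in c p.1 p.2 = rsubmx z.
  apply: (etrans _ (congr1 (@rsubmx R 1 n.+1 n.+1) (cotangent_coordK cS bc iz))).
  by rewrite /= row_mxKr.
by rewrite (moment_in bc dp) /velocity yE.
Qed.

Lemma smooth_velocity_field c x i j : bcharts c -> dom c x ->
  smooth_at (fun y => velocity_field c y i j) (coord c x).
Proof.
move=> bc dx; have bF := family_b_map aS Ae e1 bc dx.
have sJ := @smooth_b_jacobian R (n + k) n _ _ (rshift n.+1 i) j bF.
have sins : smooth_rV_at (unit_at e : 'rV[R]_n.+1 -> _) (coord c x).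
  by apply: (@smooth_row_mx _ _ _ _ id); [exact: smooth_rV_id|exact: smooth_rV_cst].
by apply: smooth_near_eq (smooth_comp sins sJ); apply: filterE => y; rewrite [RHS]mxE.
Qed.

Lemma smooth_moment C : @bcharts R E C -> smooth_on (img C) (moment \o param C).
Proof.
move=> [c bc <-]; apply: smooth_on_at => _ [p dp <-].
have {}dp : dom c p.1 := dp; set z0 := coord _ p.
have lE : @lsubmx R 1 n.+1 n.+1 z0 = coord c p.1 by rewrite /z0 /= row_mxKl.
have sm : smooth_rV_at (fun z : 'rV[R]_(n.+1 + n.+1) =>
    rsubmx z *m (velocity_field c (lsubmx z))^T) z0.
  apply: smooth_mulmx_tr; first exact: (@smooth_rsubmx _ n.+1 n.+1).
  move=> i j; apply: (@smooth_comp _ _ _ (@lsubmx R 1 n.+1 n.+1)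
    (fun y => velocity_field c y i j)); first exact: (@smooth_lsubmx _ n.+1 n.+1).
  by rewrite lE; exact: smooth_velocity_field.
apply: smooth_rV_near_eq sm; apply: filterS (near_lsubmx_coord cS bc dp) => z iz.
exact: esym (moment_coord bc iz).
Qed.

(** The lift acts on covectors by the transposed Jacobian of g^-1, so this is [velocity_act]
    transposed. *)
Lemma moment_equivariant : equivariant e act_hat moment.
Proof.
move=> g p; rewrite (cotangent_liftE aS) /moment /coAd /=.
have [bx dx] := cb_at cS p.1; have [bg dg] := cb_at cS (act g p.1).
by rewrite -!mulmxA -!trmx_mul (velocity_act cS aS Ae e1 bx bg dx dg).
Qed.

Definition base_point c p : 'rV[R]_(n.+1 + n.+1 + k) :=
  row_mx (row_mx (coord c p.1) (covector_in c p.1 p.2)) s1.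

(** The base coordinates of the lifted family do not involve the fibre, so the lifted fundamental
    field projects to the one on the base. *)
Lemma velocity_lift c p : bcharts c -> dom c p.1 ->
  velocity act_hat e (cotangent_chart c) p = (row_mx (velocity act e c p.1)
    (@dsubmx _ (n.+1 + n.+1) k _ (@b_gradient R (n + n.+1 + k) n.+1
      (fibre_family act e c c) (base_point c p))) : 'M[R]_(k, n.+1 + n.+1)).
Proof.
move=> bc dp; have d1 : dom c (act 1%g p.1) by rewrite (ba_one aS).
pose z0 := base_point c p.
have nf := near_lift_family cS aS Ae bc bc (covector_in c p.1 p.2) e1 dp d1.
have bF := family_b_map aE Ae e1 (cotangent_bchart bc) (dp : dom (cotangent_chart c) p).
have nf' : \forall z \near z0,
    family act_hat e (cotangent_chart c) (cotangent_chart c) z =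
    row_mx (family act e c c (forget_fibre z)) (fibre_family act e c c z).
  by apply: filterS nf => z [].
have bfam := family_b_map aS Ae e1 bc dp.
have fz0 : forget_fibre z0 = unit_at e (coord c p.1).
  by rewrite /forget_fibre /z0 /base_point !row_mxKl row_mxKr.
rewrite -fz0 in bfam.
rewrite /velocity (@b_jacobian_near_eq R (n + n.+1 + k) (n + n.+1) _ _ z0 nf' bF).
rewrite (@b_jacobian_row_mx R (n + n.+1 + k) n n.+1 (family act e c c \o forget_fibre)).
rewrite (@b_jacobian_comp R (n + n.+1 + k) (n + k) n _ _ z0 (b_map_forget_fibre z0) bfam).
apply/matrixP => i j; rewrite mxE.
case: (@split_ordP n.+1 n.+1 j) => l ->.
  rewrite !(@row_mxEl _ _ n.+1 n.+1) -fz0.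
  have := congr1 (fun B : 'M[R]_(k, n.+1 + k) => (B *m @b_jacobian R (n + k) n
    (family act e c c) (forget_fibre z0)) i l) (dsubmx_forget_fibre z0).
  rewrite mul_row0 mul1mx => <-.
  by rewrite !mxE; apply: eq_bigr => a _; rewrite !mxE.
by rewrite !(@row_mxEr _ _ n.+1 n.+1) [RHS]mxE.
Qed.

Lemma moment_lift p X : pairing (moment p) X =
  pairing (canonical_form1 p) (b_section (fundamental_field e act_hat X) p).
Proof.
have [bx dx] := cb_at cS p.1.
rewrite (b_section_fundamental cE aE Ae e1) /canonical_form1 pairing_mulmx.
rewrite /moment pairing_mulmx -mulmxA; congr (pairing _ (_ *m _)); apply: esym.
apply: (etrans (congr1 (fun B => B *m _) (velocity_lift bx dx))).
have mulD (A B : 'M[R]_(k, n.+1)) (D : 'M[R]_(n.+1 + n.+1, n.+1)) :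
    D = col_mx 1%:M 0 -> row_mx A B *m D = A.
  by move=> ->; rewrite mul_row_col mulmx1 mulmx0 addr0.
exact: mulD (b_diff_proj cS p).
Qed.

(* The fibre component of the lifted fundamental field: since A = 1 at the unit,
   the derivative of A^-1 is - dA, and dA is the derivative of the velocity
   field because second derivatives commute. *)
Lemma fibre_velocity c p : bcharts c -> dom c p.1 -> forall a j,
  (@dsubmx _ (n.+1 + n.+1) k _ (@b_gradient R (n + n.+1 + k) n.+1
      (fibre_family act e c c) (base_point c p))) a j =
  - \sum_l (covector_in c p.1 p.2) 0 l *
     b_partial j (fun y => velocity_field c y a l) (coord c p.1).
Proof.
move=> bc dp a j; set z0 := base_point c p.
pose t0 := unit_at e (coord c p.1).
have fz0 : forget_fibre z0 = t0.
  by rewrite /forget_fibre /z0 /base_point !row_mxKl row_mxKr.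
pose FJ := family_jacobian act e c c.
have bfam : @b_map_at R (n + k) n (family act e c c) t0 by exact: (family_b_map aS Ae e1 bc dp).
have FJ1 : usubmx (FJ t0) = 1%:M by exact: (family_unit_jacobian cS aS Ae e1 bc dp).
have sFJ i l : smooth_at (fun t : 'rV[R]_(n.+1 + k) => FJ t i l) t0.
  exact: (@smooth_b_jacobian R (n + k) n _ _ _ _ bfam).
have sU i l : smooth_at (fun t => usubmx (FJ t) i l) t0.
  by apply: smooth_near_eq (sFJ (lshift k i) l); apply: filterE => t; rewrite [RHS]mxE.
pose K t := invmx (usubmx (FJ t)).
have U1 : usubmx (FJ t0) \in unitmx by rewrite FJ1 unitmx1.
have sK l : smooth_at (fun t => K t j l) t0 by exact: smooth_invmx.
have bforget := b_map_forget_fibre z0.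
have sKf l : smooth_at (fun z => K (forget_fibre z) j l) z0.
  have sKl : smooth_at (fun t => K t j l) (forget_fibre z0) by rewrite fz0.
  exact: (smooth_comp (b_map_smooth bforget) sKl).
pose A : 'I_(n + n.+1 + k).+1 := rshift (n.+1 + n.+1) a.
have sq l : smooth_at (fun z : 'rV[R]_(n.+1 + n.+1 + k) => z 0 (lshift k (rshift n.+1 l))) z0.
  exact: smooth_coord.
have -> : (@dsubmx _ (n.+1 + n.+1) k _ (@b_gradient R (n + n.+1 + k) n.+1
    (fibre_family act e c c) z0)) a j = @b_partial R (n + n.+1 + k) A
    (fun z => \sum_l z 0 (lshift k (rshift n.+1 l)) * K (forget_fibre z) j l) z0.
  have FE : (fun z => fibre_family act e c c z 0 j) =
      (fun z => \sum_l z 0 (lshift k (rshift n.+1 l)) * K (forget_fibre z) j l).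
    apply/funext => z; rewrite [LHS]mxE; apply: eq_bigr => l _.
    by rewrite [X in X * _]mxE [X in X * _]mxE [X in _ * X]mxE.
  by rewrite [LHS]mxE [LHS]mxE FE.
rewrite (@b_partial_sum R (n + n.+1 + k)); last first.
  by move=> l; exact: smooth_differentiable (smoothM (sq l) (sKf l)).
rewrite -sumrN; apply: eq_bigr => l _.
rewrite (@b_partialM R (n + n.+1 + k)); last 2 first.
- exact: smooth_differentiable (sq l).
- exact: smooth_differentiable (sKf l).
have -> : @b_partial R (n + n.+1 + k) A
    (fun z => z 0 (lshift k (rshift n.+1 l))) z0 = 0.
  rewrite b_partialE partial_coord; case: eqP => [/(congr1 val)/=|_]; last by rewrite mulr0.
  by have := ltn_ord l; lia.
have qE : z0 0 (lshift k (rshift n.+1 l)) = covector_in c p.1 p.2 0 l.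
  by rewrite /z0 /base_point row_mxEl row_mxEr.
rewrite mul0r add0r qE -mulrN; congr (_ * _).
have KfE : @b_partial R (n + n.+1 + k) A (fun z => K (forget_fibre z) j l) z0 =
    @b_partial R (n + k) (rshift n.+1 a) (fun t => K t j l) t0.
  rewrite (@b_partial_comp R (n + n.+1 + k) (n + k) _ (fun t => K t j l) _ _ bforget); last first.
    by rewrite fz0; exact: smooth_differentiable (sK l).
  have JA i : @b_jacobian R (n + n.+1 + k) (n + k) forget_fibre z0 A i =
      (row_mx 0 1%:M : 'M[R]_(k, n.+1 + k)) a i.
    have := congr1 (fun B : 'M[R]_(k, n.+1 + k) => B a i) (dsubmx_forget_fibre z0).
    by move=> <-; rewrite [RHS]mxE.
  under eq_bigr do rewrite JA fz0.
  rewrite (bigD1 (rshift n.+1 a))//= (@row_mxEr _ _ n.+1 k) mxE eqxx mul1r.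
  rewrite big1 ?addr0// => i; case: (@split_ordP n.+1 k i) => i' ->.
    by rewrite (@row_mxEl _ _ n.+1 k) mxE mul0r.
  rewrite rshift_eq (@row_mxEr _ _ n.+1 k) mxE eq_sym => /negbTE ->.
  by rewrite mul0r.
have IE := @b_partial_invmx1 R (n + k) n.+1 (fun t => usubmx (FJ t)) t0
  (rshift n.+1 a) j l sU FJ1.
have UE : (fun t : 'rV[R]_(n + k).+1 => usubmx (FJ t) j l) = (fun t => FJ t (lshift k j) l).
  by apply/funext => t; rewrite [LHS]mxE.
(* Closedness of the pulled back coframe also covers the column of logarithmic derivatives, where
   the entries are not partial derivatives of a coordinate of the family. *)
have CE := @b_jacobian_closed R (n + k) n _ t0 (rshift n.+1 a) (lshift k j) l bfam.
have SE := @b_partial_slice R n k (fun t => FJ t (rshift n.+1 a) l) (coord c p.1) s1 j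
  (smooth_differentiable (sFJ _ l)).
have VE : (fun y => velocity_field c y a l) =
    (fun y => FJ (row_mx y s1) (rshift n.+1 a) l).
  by apply/funext => y; rewrite [LHS]mxE.
rewrite KfE VE SE; apply: (etrans IE); rewrite UE.
exact: (congr1 (fun r => - r) CE).
Qed.

(** Contracting (v, w) with sum e^i /\ dp_i gives (-w, v). Here v = X V is the p-derivative of <p, X
    V>, and -w is its x-derivative by [fibre_velocity]. *)
Lemma hamiltonian_moment : hamiltonian_with e act_hat (@canonical_form2 R S) moment.
Proof.
move=> X; split; first exact: (b_vector_field_fundamental cE aE Ae e1).
move=> p; have [bx dx] := cb_at cS p.1; set c := bchart_at p.1 in bx dx.
pose z0 : 'rV[R]_(n.+1 + n.+1) := row_mx (coord c p.1) (covector_in c p.1 p.2).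
pose V := velocity act e c p.1.
pose W : 'M[R]_(k, n.+1) := \matrix_(a, j) (- \sum_l (covector_in c p.1 p.2) 0 l *
     b_partial j (fun y => velocity_field c y a l) (coord c p.1)).
have VE : velocity act_hat e (cotangent_chart c) p = (row_mx V W : 'M[R]_(k, n.+1 + n.+1)).
  apply: (etrans (velocity_lift bx dx)); apply: (congr1 (fun B => row_mx V B)).
  apply/matrixP => a j.
  by rewrite (fibre_velocity bx dx) [RHS]mxE.
rewrite (b_section_fundamental cE aE Ae e1) /contract (canonical_form2E cS).
pose J : 'M[R]_(n.+1 + n.+1) := block_mx 0 1%:M (- 1%:M) 0.
have contractE (U : 'M[R]_(k, n.+1 + n.+1)) : U = row_mx V W ->
    X *m U *m J = row_mx (- (X *m W)) (X *m V).
  move=> ->; rewrite mul_mx_row mul_row_block !mulmx0 mulmx1 mulmxN mulmx1.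
  by rewrite add0r addr0.
apply: (etrans (contractE _ VE)).
pose B (z : 'rV[R]_(n.+1 + n.+1)) : 'rV[R]_n.+1 := X *m velocity_field c (lsubmx z).
have lE : lsubmx z0 = coord c p.1 by rewrite /z0 row_mxKl.
have sXV : smooth_rV_at (fun y => X *m velocity_field c y) (coord c p.1).
  move=> j; have : smooth_at (fun y => \sum_a X 0 a * velocity_field c y a j) (coord c p.1).
    apply: smooth_sum => a _; apply: smoothM; first exact: smooth_cst.
    exact: smooth_velocity_field.
  by apply: smooth_near_eq; apply: filterE => y; rewrite [RHS]mxE.
have sB : smooth_rV_at B z0.
  apply: (@smooth_rV_comp _ _ _ _ (@lsubmx R 1 n.+1 n.+1) (fun y => X *m velocity_field c y)).
    exact: smooth_lsubmx.
  by rewrite lE.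
have near_f : \forall z \near z0, pairing (rsubmx z) (B z) =
    pairing (moment (param (cotangent_chart c) z)) X.
  apply: filterS (near_lsubmx_coord cS bx dx) => z iz.
  by rewrite (moment_coord bx iz) pairing_mulmx.
apply/rowP => i; rewrite [RHS]mxE.
have -> : b_partial i ((fun q => pairing (moment q) X) \o param (bchart_at p)) (bcoord p) =
    (@b_gradient R (n + n.+1) n.+1 (@rsubmx R 1 n.+1 n.+1) z0 *m (B z0)^T +
     @b_gradient R (n + n.+1) n.+1 B z0 *m (rsubmx z0)^T) i 0.
  rewrite -(@b_partial_dot R (n + n.+1) n.+1)//; last exact: (@smooth_rsubmx _ n.+1 n.+1).
  by apply: b_partial_near_eq; apply: filterS near_f => z ->.
rewrite (@b_gradient_rsubmx R n n.+1).
rewrite (@b_gradient_comp R (n + n.+1) n n.+1 (@lsubmx R 1 n.+1 n.+1)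
  (fun y => X *m velocity_field c y)); last 2 first.
- exact: (@b_map_lsubmx R n n.+1).
- by rewrite lE.
rewrite (@b_jacobian_lsubmx R n n.+1) !(@mul_col_mx _ n.+1 n.+1) !mul1mx !mul0mx.
rewrite (@add_col_mx _ n.+1 n.+1) add0r addr0 lE.
case: (@split_ordP n.+1 n.+1 i) => j ->; last first.
  rewrite (@row_mxEr _ _ n.+1 n.+1) (@col_mxEd _ n.+1 n.+1) [RHS]mxE /B lE.
  by [].
rewrite (@row_mxEl _ _ n.+1 n.+1) (@col_mxEu _ n.+1 n.+1) [LHS]mxE mxE.
rewrite [RHS]mxE.
have gE l : b_gradient (fun y => X *m velocity_field c y) (coord c p.1) j l =
    \sum_a X 0 a * b_partial j (fun y => velocity_field c y a l) (coord c p.1).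
  rewrite mxE; have -> : (fun y => (X *m velocity_field c y) 0 l) =
      (fun y => \sum_a X 0 a * velocity_field c y a l) by apply/funext => y; rewrite mxE.
  have sv a := smooth_velocity_field a l bx dx.
  rewrite b_partial_sum => [|a]; last first.
    exact: smooth_differentiable (smoothM (smooth_cst _ _) (sv a)).
  apply: eq_bigr => a _; rewrite b_partialM; last 2 first.
  - exact: smooth_differentiable (smooth_cst _ _).
  - exact: smooth_differentiable (sv a).
  by rewrite b_partial_cst mul0r add0r.
under eq_bigr do rewrite [W _ _]mxE mulrN mulr_sumr.
rewrite sumrN opprK exchange_big/=; apply: eq_bigr => l _.
rewrite gE mulr_suml; apply: eq_bigr => a _.
by rewrite [_^T _ _]mxE /z0 row_mxKr mulrCA [RHS]mulrC.
Qed.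

End MomentMap.

Theorem proposition20 (R : realType) (n k : nat) (M : b_manifold R n)
    (G : lie_group R k) (rho : G -> M -> M)
    (rho_action : smooth_action (@atlas R n.+1 M) rho)
    (rho_Z : forall (g : G) (x : M), @bm_hyp R n M x -> @bm_hyp R n M (rho g x))
    (e : chart R G k) (e_atlas : @lg_atlas R k G e) (e_1 : dom e 1%g) :
  let S := b_space_of M in
  let E := b_cotangent S in
  let rho_hat : G -> E -> E := @cotangent_lift R k G S rho in
  smooth_action (@bcharts R E) rho_hat /\
  exists mu : E -> 'rV[R]_k,
    [/\ forall (p : E) (X : 'rV[R]_k),
          pairing (mu p) X =
            pairing (canonical_form1 p)
                    (b_section (fundamental_field e rho_hat X) p) /\
          pairing (mu p) X =
            pairing (b_covector p)
                    (b_section (@fundamental_field R k G S e rho X) (b_proj p)),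
        forall c, @bcharts R E c -> smooth_on (img c) (mu \o param c),
        hamiltonian_with e rho_hat (@canonical_form2 R S) mu &
        equivariant e rho_hat mu].
Proof.
move=> S E rho_hat.
have cS : compatible_b_charts S := compatible_b_manifold M.
have aS : @b_action R k G S rho := b_action_manifold rho_action rho_Z.
have aE : @b_action R k G E rho_hat := b_action_lift cS aS.
split.
  split; [exact: ba_one aE|exact: ba_mul aE|].
  exact: smooth_map_of_b_action (compatible_cotangent cS) aE.
exists (@moment R k G S rho e); split.
- move=> p X; split; first exact: (moment_lift cS aS e_atlas e_1).
  exact: (moment_base cS aS e_atlas e_1).
- exact: (smooth_moment cS aS e_atlas e_1).
- exact: (hamiltonian_moment cS aS e_atlas e_1).
- exact: (moment_equivariant cS aS e_atlas e_1).
Qed.
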